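(* For any partitions $\mu$ and $\lambda$, $$\genfrac[]{0pt}{}{\lambda}{\mu}_{q,t,s}=\genfrac[]{0pt}{}{\lambda'}{\mu'}_{t,q,1/(\sqrt{qt}\,s)},\qquad \genfrac\{\}{0pt}{}{\lambda}{\mu}_{q,t,s}=\genfrac\{\}{0pt}{}{\lambda'}{\mu'}_{t,q,1/(\sqrt{qt}\,s)}.$$
   Context: Let $\mathbb F=\mathbb Q(q,t)$; $s$ is an indeterminate. For a partition $\lambda$: $\lambda'$ is the conjugate; $(i,j)\in\lambda$ means $1\le i$, $1\le j\le\lambda_i$; $\mu\subset\lambda$ means $\mu_i\le\lambda_i$ for all $i$. $m^n$ is the partition with $n$ parts equal to $m$; for $\lambda\subset m^n$, $m^n-\lambda$ is the partition with $(m^n-\lambda)_i=m-\lambda_{n+1-i}$, $1\le i\le n$. Put $C^0_\lambda(x;q,t)=\prod_{(i,j)\in\lambda}(1-q^{j-1}t^{1-i}x)$, $C^-_\lambda(x;q,t)=\prod_{(i,j)\in\lambda}(1-q^{\lambda_i-j}t^{\lambda'_j-i}x)$, and $$\langle P_\lambda,P_\lambda\rangle''_n=\frac{C^0_\lambda(t^n;q,t)C^-_\lambda(q;q,t)}{C^0_\lambda(qt^{n-1};q,t)C^-_\lambda(t;q,t)}.$$ Interpolation polynomials: $m_\lambda(x)$ is the orbit sum of $\prod_ix_i^{\lambda_i}$ under the group $BC_n$ of permutations of $x_1,\dots,x_n$ and inversions $x_i\mapsto x_i^{-1}$. Dominance: $\mu\le\lambda$ iff $\mu_1+\dots+\mu_k\le\lambda_1+\dots+\lambda_k$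 for all $k\ge1$ (the sizes may differ). For $\lambda$ with at most $n$ parts, $\bar P^{*(n)}_\lambda(x_1,\dots,x_n;q,t,s)$ is the unique $BC_n$-symmetric Laurent polynomial with coefficients in $\mathbb F(s)$ of the form $m_\lambda+\sum_{\mu<\lambda}c_{\lambda\mu}m_\mu$ whose value $\bar P^{*(n)}_\lambda(\mu;q,t,s)$ at $x_i=q^{\mu_i}t^{n-i}s$ ($1\le i\le n$) is $0$ for all partitions $\mu<\lambda$ with at most $n$ parts (it is then $0$ whenever $\lambda\not\subset\mu$, and nonzero for $\mu=\lambda$). Generalized binomial coefficients: with $m,n$ chosen so that $\lambda,\mu\subset m^n$ (the results do not depend on the choice), $$\genfrac[]{0pt}{}{\lambda}{\mu}_{q,t,s}=\frac{\bar P^{*(n)}_\mu(\lambda;q,t,t^{1-n}s)}{\bar P^{*(n)}_\mu(\mu;q,t,t^{1-n}s)},$$ $$\genfrac\{\}{0pt}{}{\lambda}{\mu}_{q,t,s}=\frac{\langle P_\mu,P_\mu\rangle''_n\,\bar P^{*(n)}_\lambda(\lambda;q,t,t^{1-n}s)\,\bar P^{*(n)}_{m^n-\lambda}(m^n-\mu;q,t,q^{-m}/s)}{\langle P_\lambda,P_\lambda\rangle''_n\,\bar P^{*(n)}_\mu(\mu;q,t,t^{1-n}s)\,\bar P^{*(n)}_{m^n-\mu}(m^n-\mu;q,t,q^{-m}/s)}.$$ They depend on $s$ only through $s^2$; the subscript $t,q,\dots$ means that $q$ and $t$ are interchanged in the definition. *)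

(* Defs.v *)
From HB Require Import structures.
From mathcomp Require Import all_boot all_order all_fingroup all_algebra.
From mathcomp Require Import finmap boolp classical_sets.
From mathcomp Require Import monalg.

Set Implicit Arguments.
Unset Strict Implicit.
Unset Printing Implicit Defensive.

Import GRing.Theory.

Local Open Scope ring_scope.

(* Without zero parts, so that equality of partitions is equality of lists;
   parts beyond the length are read as 0 through [nth 0]. Indices (of parts,
   boxes and variables) start at 0 throughout. *)
Definition is_intpart (s : seq nat) : bool := sorted geq s && (0%N \notin s).

Record intpart := IntPart { parts :> seq nat; _ : is_intpart parts }.

HB.instance Definition _ := [isSub for parts].
HB.instance Definition _ := [Choice of intpart by <:].

Definition conj_seq (s : seq nat) : seq nat :=
  [seq count (fun k => j < k)%N s | j <- iota 0 (head 0%N s)].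

(* [conj_seq] counts parts greater than [j], so it has no zero entry when [s]
   is a partition: the head of [s] is then counted for every listed [j]. *)
Lemma conj_seqP (lam : intpart) : is_intpart (conj_seq lam).
Proof.
apply/andP; split.
  apply: (homo_sorted (e := ltn)); last exact: iota_ltn_sorted.
  by move=> i j /= lt_ij; apply: sub_count => k; apply: ltn_trans.
apply/mapP=> -[j]; rewrite mem_iota /= add0n.
by case: (lam : seq nat) => [|k s] //= ->.
Qed.

Definition conjp (lam : intpart) : intpart := IntPart (conj_seqP lam).

Definition compl_seq (m n : nat) (s : seq nat) : seq nat :=
  [seq k <- mkseq (fun i => m - nth 0 s (n - i.+1))%N n | 0 < k]%N.

Lemma intpart_nth (lam : intpart) (i j : nat) :
  (i <= j)%N -> (nth 0 lam j <= nth 0 lam i)%N.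
Proof.
case: lam => s /= /andP[s_sorted _] le_ij.
have [lt_js|le_sj] := ltnP j (size s); last by rewrite nth_default.
have geq_trans : transitive geq by move=> a b c le_ab le_ca; apply: leq_trans le_ab.
apply: (sorted_leq_nth geq_trans (fun k => leqnn k) 0%N s_sorted) => //.
exact: leq_ltn_trans lt_js.
Qed.

Lemma compl_seqP (m n : nat) (lam : intpart) : is_intpart (compl_seq m n lam).
Proof.
rewrite /is_intpart mem_filter /= andbT.
apply: sorted_filter; first by move=> a b c le_ab le_ca; apply: leq_trans le_ab.
apply: (homo_sorted (e := ltn)); last exact: iota_ltn_sorted.
move=> i j /= lt_ij; apply: leq_sub2l; apply: intpart_nth.
by apply: leq_sub2l; apply: ltnW.
Qed.

Definition compl (m n : nat) (lam : intpart) : intpart :=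
  IntPart (compl_seqP m n lam).

Definition incl (mu lam : seq nat) : Prop :=
  forall i, (nth 0 mu i <= nth 0 lam i)%N.

Definition rect (m n : nat) : seq nat := nseq n m.

(* The two partitions may have different sizes. *)
Definition dom (mu lam : intpart) : Prop :=
  forall k, (sumn (take k mu) <= sumn (take k lam))%N.

Definition dom_lt (mu lam : intpart) : Prop := dom mu lam /\ mu != lam.

(* Laurent polynomials in [n] variables, as finitely supported families of
   coefficients indexed by the exponent vectors. *)
Notation laurent K n := {malg K[{ffun 'I_n -> int}]}.

Section Laurent.
Variables (K : fieldType) (n : nat).
Implicit Types (P : laurent K n) (lam mu : intpart).

Definition leval (x : 'I_n -> K) P : K :=
  mmap idfun (fun e : {ffun 'I_n -> int} => \prod_(i < n) x i ^ e i) P.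

(* BC_n acts on exponent vectors by permuting the coordinates and changing
   their signs, the latter corresponding to inversion of variables. *)
Definition bcact (g : 'S_n * {ffun 'I_n -> bool}) (e : {ffun 'I_n -> int}) :
    {ffun 'I_n -> int} :=
  [ffun i => (-1) ^+ g.2 i * e (g.1 i)].

Definition bc_symmetric P : Prop := forall g e, P@_(bcact g e) = P@_e.

Definition expo lam : {ffun 'I_n -> int} := [ffun i : 'I_n => (nth 0%N lam i)%:Z].

Definition orbit_sum lam : laurent K n :=
  \sum_(e <- undup [seq bcact g (expo lam) | g : 'S_n * {ffun 'I_n -> bool}])
    << e >>.

Definition point (q t s : K) mu (i : 'I_n) : K :=
  q ^+ nth 0%N mu i * t ^+ (n - i.+1) * s.

Definition is_interp (q t s : K) lam P : Prop :=
  [/\ bc_symmetric P,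
      exists (r : seq intpart) (c : intpart -> K),
        (forall mu, mu \in r -> (size mu <= n)%N /\ dom_lt mu lam) /\
        P = orbit_sum lam + \sum_(mu <- r) c mu *: orbit_sum mu
    & forall mu, (size mu <= n)%N -> dom_lt mu lam ->
        leval (point q t s mu) P = 0].

(* The coefficients are determined by a linear system over Q(q,t,s) with a
   unique solution. Hence for q, t, s algebraically independent over the
   rationals in any field, there is exactly one polynomial satisfying
   [is_interp], namely the interpolation polynomial for these parameters. *)
Definition interp (q t s : K) lam : laurent K n :=
  xget 0 [set P | is_interp q t s lam P].

Definition interp_at (q t s : K) lam mu : K :=
  leval (point q t s mu) (interp q t s lam).

End Laurent.

Section Binomials.
Variable K : fieldType.
Implicit Types (q t s x : K) (lam mu : intpart).

Definition C0 lam x q t : K :=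
  \prod_(i < size lam) \prod_(j < nth 0%N lam i) (1 - q ^+ j * t ^- i * x).

Definition Cminus lam x q t : K :=
  \prod_(i < size lam) \prod_(j < nth 0%N lam i)
    (1 - q ^+ (nth 0%N lam i - j.+1) * t ^+ (nth 0%N (conjp lam) j - i.+1) * x).

Definition normP (n : nat) lam q t : K :=
  C0 lam (t ^+ n) q t * Cminus lam q q t /
  (C0 lam (q * t ^ (n%:Z - 1)) q t * Cminus lam t q t).

Definition binom_sq (n : nat) lam mu q t s : K :=
  interp_at n q t (t ^ (1 - n%:Z) * s) mu lam /
  interp_at n q t (t ^ (1 - n%:Z) * s) mu mu.

Definition binom_curly (m n : nat) lam mu q t s : K :=
  (normP n mu q t * interp_at n q t (t ^ (1 - n%:Z) * s) lam lam
     * interp_at n q t (q ^- m / s) (compl m n lam) (compl m n mu)) /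
  (normP n lam q t * interp_at n q t (t ^ (1 - n%:Z) * s) mu mu
     * interp_at n q t (q ^- m / s) (compl m n mu) (compl m n mu)).

End Binomials.

(* Q(q,t), built as Q(q)(t), and the rational functions in s over it. *)
Definition Qqt : fieldType := {fraction {poly {fraction {poly rat}}}}.
Definition Qqts : fieldType := {fraction {poly Qqt}}.

Definition q_Qqt : Qqt :=
  FracField.tofrac (polyC (FracField.tofrac 'X)).
Definition t_Qqt : Qqt := FracField.tofrac 'X.

Definition gen_q : Qqts := FracField.tofrac (polyC q_Qqt).
Definition gen_t : Qqts := FracField.tofrac (polyC t_Qqt).
Definition gen_s : Qqts := FracField.tofrac 'X.

(* Main.v *)
Require Import Defs.
From mathcomp Require Import all_boot all_order all_fingroup all_algebra all_field.
From mathcomp Require Import finmap boolp monalg.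
From mathcomp Require classical_sets.
From mathcomp Require Import zify ring lra.
Import Defs.

(** Both symbols are quotients of values of interpolation polynomials at
    partitions; the proof determines how these values behave under conjugation.
    It works for any q, t, s without multiplicative relations in a field of
    characteristic zero ([generic]), a condition that is stable under all the
    shifts of s that occur and under passage to the dual parameters.

    Existence and uniqueness. Let D be a finite set of partitions closed
    downwards under dominance. The combinations of the orbit sums m_mu, mu in D,
    take arbitrary values at the points of D ([interp_exists]): setting the last
    variable to s treats the partitions with fewer than n parts, and
    multiplication by the product of the x_i + 1/x_i - s - 1/s adds a full column
    while replacing s by q s. A square system with solutions for all right-hand
    sides has unique ones ([interp_unique]). The same two operations give
    stability in n ([Pstar_stable]), extraction of a full column
    ([Pstar_addcol]) and, by removing columns, the value of the polynomial of
    lam at lam as a product over the boxes of lam ([Pval_diag]).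

    Vanishing. The polynomial of lam vanishes at mu unless lam is contained in
    mu ([Pstar_vanish]). The dominance order in the definition gives much less,
    and the missing zeros come from a difference operator of type BC: f is
    scaled by a square root v of q, multiplied by a suitable product,
    antisymmetrized and divided by the Weyl denominator. The result stays in
    the span of the m_mu with mu dominated by lam, one can arrange that it
    vanishes at all these mu, hence identically, and its value at a further mu
    expresses f(mu) through the f(kap) with kap strictly contained in mu. As a
    consequence the polynomial of lam is determined up to a factor by its degree
    and its zeros of size at most that of lam ([Pstar_degree]).

    The square symbol. Summing geometric progressions along the rows or along
    the columns of nu shows that a power sum at the point of nu' for the dual
    parameters is an affine function of the same power sum at the point of nu
    ([powsum_dual]). Symmetric functions being polynomials in power sums, the
    dual polynomial of mu' evaluated at nu' is a symmetric function of degree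
    at most |mu| of the point of nu. It has the zeros of the polynomial of mu,
    so the two are proportional ([Pval_dual]).

    The curly symbol. It is the product of E(lam) / E(mu) and of a square symbol
    of the complements, where E(lam) is the product of the values of the
    polynomials of lam and of its complement at their own partitions, divided
    by the norm of lam ([curly_diag_ratio]). With X_i = q^lam_i t^(-i) and
    Z_j = q^j t^(-lam'_j), E(lam) is a product over all boxes of the rectangle,
    and it is compared with its dual box by box ([ratio_term_dual]). What
    remains is the product of (X_i - q Z_j) / (X_i - t Z_j) over the rectangle,
    divided by a product over the boxes of lam of factors that depend on the box
    only. This is the same for all lam ([ratio_prod_boxes]), as one sees by
    adding boxes one at a time, using a telescoping identity along the boundary
    of lam ([contour_identity]). Hence E is its dual up to a constant, which
    cancels. Finally the curly symbol does not change when the rectangle gets a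
    further column, by [Pstar_addcol], or a further row, by duality
    ([binom_curly_widen]). *)

Set Implicit Arguments.
Unset Strict Implicit.
Unset Printing Implicit Defensive.

Import Order.TTheory GRing.Theory Num.Theory.
Local Open Scope ring_scope.

(** * Partitions, rearrangements and dominance *)

Section Partitions.
Implicit Types (lam mu nu : intpart) (s : seq nat).

Lemma nth_gt0 lam i : (0 < nth 0 lam i)%N = (i < size lam)%N.
Proof.
have [lt_i|le_i] := ltnP i (size lam); last by rewrite nth_default.
case: lam lt_i => s /= /andP[_ s0] lt_i; rewrite lt0n; apply: contraNneq s0 => <-.
exact: mem_nth.
Qed.

Lemma intpart_eq lam mu : (forall i, nth 0%N lam i = nth 0%N mu i) -> lam = mu.
Proof.
move=> eq_nth.
have eq_lt i : (i < size lam)%N = (i < size mu)%N by rewrite -!nth_gt0 eq_nth.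
have eq_size : size lam = size mu.
  by apply/eqP; rewrite eqn_leq leqNgt eq_lt ltnn /= leqNgt -eq_lt ltnn.
by apply: val_inj; apply: (@eq_from_nth _ 0%N) => // i _; apply: eq_nth.
Qed.

Lemma geq_total : total geq. Proof. by move=> a b; rewrite /= leq_total. Qed.
Lemma geq_transitive : transitive geq.
Proof. by move=> a b c /= ab ca; apply: leq_trans ab. Qed.
Lemma geq_antisym : antisymmetric geq.
Proof. by move=> a b /= /andP[ba ab]; apply/eqP; rewrite eqn_leq ab ba. Qed.

Lemma mkpartP s : is_intpart (sort geq [seq k <- s | 0 < k]%N).
Proof.
rewrite /is_intpart sort_sorted /=; last exact: geq_total.
by rewrite mem_sort mem_filter.
Qed.

Definition mkpart s : intpart := IntPart (mkpartP s).

Lemma mkpart_perm s1 s2 : perm_eq s1 s2 -> mkpart s1 = mkpart s2.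
Proof.
move=> eq12; apply: val_inj => /=.
apply/(perm_sortP geq_total geq_transitive geq_antisym).
exact: perm_filter.
Qed.

Lemma mkpart_sorted s : sorted geq s -> mkpart s = [seq k <- s | 0 < k]%N :> seq nat.
Proof.
move=> srt /=; apply: sorted_sort; first exact: geq_transitive.
exact: sorted_filter geq_transitive _ _ srt.
Qed.

Lemma nth_mkpart s i : sorted geq s -> nth 0%N (mkpart s) i = nth 0%N s i.
Proof.
move=> srt; rewrite mkpart_sorted //; elim: s srt i => [|k s IH] // srt i.
have srts : sorted geq s by apply: path_sorted srt.
rewrite /=; case: k srt => [|k] srt; last by case: i => //= i; apply: IH.
have s0 : s = nseq (size s) 0%N.
  apply/all_pred1P; apply/allP => j js /=.
  have /allP/(_ j js) := order_path_min geq_transitive srt.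
  by rewrite /= leqn0.
have -> : [seq k <- s | (0 < k)%N] = [::].
  by rewrite s0; elim: (size s).
rewrite nth_nil; case: i => //= i; by rewrite s0 nth_nseq if_same.
Qed.

Lemma size_mkpart s : (size (mkpart s) <= size s)%N.
Proof. by rewrite /= size_sort size_filter count_size. Qed.

Lemma sumn_mkpart s : sumn (mkpart s) = sumn s.
Proof.
rewrite /= (@perm_sumn _ [seq k <- s | 0 < k]%N); last by rewrite perm_sort.
by elim: s => //= -[|k] s IH /=; rewrite IH.
Qed.

Definition psum s k := (\sum_(i < k) nth 0 s i)%N.

Lemma psumE s k : sumn (take k s) = psum s k.
Proof.
rewrite /psum; elim: s k => [|a s IH] [|k] //=.
- by rewrite big_ord0.
- by rewrite big1 // => i _; rewrite nth_nil.
- by rewrite big_ord0.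
by rewrite big_ord_recl /= IH.
Qed.

Lemma psum_leq s j k : (j <= k)%N -> (psum s j <= psum s k)%N.
Proof. by move=> jk; rewrite /psum (big_ord_widen k (nth 0%N s) jk) [leqRHS](bigID (fun i : 'I_k => i < j)%N) leq_addr. Qed.

Lemma psum_over s k : (size s <= k)%N -> psum s k = sumn s.
Proof. by move=> sk; rewrite -psumE take_oversize. Qed.

Lemma domP mu lam : (forall k, (psum mu k <= psum lam k)%N) <-> dom mu lam.
Proof. by split=> H k; move: (H k); rewrite !psumE. Qed.

Lemma dom_trans lam mu nu : dom lam mu -> dom mu nu -> dom lam nu.
Proof. by move=> H1 H2 k; apply: leq_trans (H1 k) (H2 k). Qed.

Lemma dom_anti lam mu : dom lam mu -> dom mu lam -> lam = mu.
Proof.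
move=> /domP H1 /domP H2; apply: intpart_eq => i.
have E k : psum lam k = psum mu k by apply/eqP; rewrite eqn_leq H1 H2.
have := E i.+1; rewrite /psum !big_ord_recr /= -/(psum lam i) -/(psum mu i) E.
by move/addnI.
Qed.

Lemma dom_sumn mu lam : dom mu lam -> (sumn mu <= sumn lam)%N.
Proof.
move=> /domP/(_ (maxn (size mu) (size lam))).
by rewrite !psum_over ?leq_maxl ?leq_maxr.
Qed.

End Partitions.

Section Shape.
Variable n : nat.
Implicit Types (a b : 'I_n -> nat) (lam : intpart).

Definition shape a : intpart := mkpart [seq a i | i <- enum 'I_n].

Lemma shape_eq a b : a =1 b -> shape a = shape b.
Proof. by move=> eab; congr mkpart; apply: eq_map. Qed.

Lemma size_shape a : (size (shape a) <= n)%N.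
Proof. by rewrite (leq_trans (size_mkpart _)) // size_map size_enum_ord. Qed.

Lemma sumn_shape a : sumn (shape a) = (\sum_i a i)%N.
Proof. by rewrite sumn_mkpart sumnE big_map big_enum. Qed.

Lemma shape_perm a (p : 'S_n) : shape (fun i => a (p i)) = shape a.
Proof.
apply: mkpart_perm; rewrite (map_comp a p); apply: perm_map.
apply: uniq_perm; rewrite ?enum_uniq //.
  by rewrite map_inj_uniq ?enum_uniq //; apply: perm_inj.
move=> i; rewrite mem_enum; apply/mapP; exists (p^-1%g i) => //.
  by rewrite mem_enum.
by rewrite permKV.
Qed.

Lemma shape_sort a : exists p : 'S_n, forall i, a (p i) = nth 0%N (shape a) i.
Proof.
pose s := [tuple a i | i < n].
have /tuple_permP[p Ep] : perm_eq (sort geq s) s by rewrite perm_sort.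
exists p => i.
have -> : shape a = mkpart (sort geq s).
  apply: mkpart_perm; rewrite perm_sym perm_sort /=.
  by rewrite /image_mem enumT.
rewrite nth_mkpart; last by apply: sort_sorted; apply: geq_total.
by rewrite Ep -tnth_nth !tnth_mktuple.
Qed.

Lemma shape_nth lam : (size lam <= n)%N -> shape (fun i : 'I_n => nth 0%N lam i) = lam.
Proof.
move=> sz; apply: intpart_eq => i.
have E : [seq nth 0%N lam (val i) | i : 'I_n <- enum 'I_n] = mkseq (nth 0%N lam) n.
  by rewrite /mkseq -val_enum_ord -map_comp.
rewrite /shape E nth_mkpart.
  have [lt_in|le_ni] := ltnP i n; first by rewrite nth_mkseq.
  by rewrite !nth_default ?size_mkseq // (leq_trans sz).
rewrite /mkseq; apply: (homo_sorted (e := ltn)); last exact: iota_ltn_sorted.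
by move=> j k /= ltjk; apply: intpart_nth; apply: ltnW.
Qed.

Lemma shapeP a lam (p : 'S_n) : (size lam <= n)%N ->
  (forall i, a (p i) = nth 0%N lam i) -> shape a = lam.
Proof. by move=> sz E; rewrite -(shape_perm a p) -[RHS](shape_nth sz); apply: shape_eq. Qed.

(** The indices of C beyond the first k are as many as those among the first k
    that C misses, and the sequence is at least as large at the latter. *)
Lemma sum_le_top (f : nat -> nat) (C : {set 'I_n}) :
  (forall i j, (i <= j)%N -> (f j <= f i)%N) ->
  (\sum_(i in C) f i <= \sum_(i < #|C|) f i)%N.
Proof.
move=> dec; set k := #|C|.
have le_kn : (k <= n)%N by rewrite -[n in (_ <= n)%N]card_ord max_card.
pose D := [set i : 'I_n | (i < k)%N].
have cardD : #|D| = k.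
  rewrite cardsE -sum1_card.
  rewrite (eq_bigl (fun i : 'I_n => i < k)%N) //.
  by rewrite -(big_ord_widen n (fun=> 1%N) le_kn) sum1_card card_ord.
have -> : (\sum_(i < k) f i = \sum_(i in D) f i)%N.
  by rewrite (big_ord_widen n f le_kn); apply: eq_bigl => i; rewrite inE.
rewrite (big_setID D) [leqRHS](big_setID C) /= setIC leq_add2l.
have cardCD : #|C :\: D| = #|D :\: C|.
  by apply: (@addnI #|C :&: D|); rewrite cardsID setIC cardsID cardD.
apply: (@leq_trans (\sum_(i in C :\: D) f k)%N).
  apply: leq_sum => i; rewrite !inE -leqNgt => /andP[ki _]; exact: dec.
rewrite sum_nat_const cardCD -sum_nat_const; apply: leq_sum => i.
by rewrite !inE => /andP[_ ik]; apply: dec; apply: ltnW.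
Qed.

Lemma shape_bound a (B : {set 'I_n}) : (\sum_(i in B) a i <= psum (shape a) #|B|)%N.
Proof.
have [p Ep] := shape_sort a.
rewrite (reindex_inj (@perm_inj _ p)) /=.
rewrite (eq_bigr (fun i : 'I_n => nth 0%N (shape a) i)) //.
have -> : #|B| = #|p @^-1: B|.
  by rewrite on_card_preimset //; apply: onW_bij; exists p^-1%g; [apply: permK | apply: permKV].
rewrite (eq_bigl (mem (p @^-1: B))); last by move=> i; rewrite !inE.
by apply: sum_le_top => i j; apply: intpart_nth.
Qed.

Lemma dom_shape a (h : nat -> nat) (k : nat) :
  (forall B : {set 'I_n}, (\sum_(i in B) a i <= h #|B|)%N) ->
  (psum (shape a) (minn k n) <= h (minn k n))%N.
Proof.
move=> H; have [p Ep] := shape_sort a.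
set j := minn k n; have le_jn : (j <= n)%N by apply: geq_minr.
pose D := [set i : 'I_n | (i < j)%N].
have cardD : #|D| = j.
  rewrite cardsE -sum1_card.
  rewrite (eq_bigl (fun i : 'I_n => i < j)%N) //.
  by rewrite -(big_ord_widen n (fun=> 1%N) le_jn) sum1_card card_ord.
have := H (p @: D); rewrite card_imset ?cardD; last exact: perm_inj.
rewrite big_imset /=; last by move=> ? ? _ _ /perm_inj.
rewrite (eq_bigr (fun i : 'I_n => nth 0%N (shape a) i)) // => le_h.
apply: leq_trans le_h; rewrite /psum (big_ord_widen n _ le_jn).
by rewrite eq_leq //; apply: eq_bigl => i; rewrite inE.
Qed.

(** In this form dominance is inherited by products of monomials: bounds on
    sums over subsets of indices add up, partial sums of sorted vectors do not. *)
Lemma shape_domP a lam :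
  dom (shape a) lam <-> (forall B : {set 'I_n}, (\sum_(i in B) a i <= psum lam #|B|)%N).
Proof.
split=> [/domP H B|H]; first exact: leq_trans (shape_bound _ _) (H _).
apply/domP => k; have := @dom_shape a (psum lam) k H.
have [le_kn|/ltnW le_nk] := leqP k n; first by [].
rewrite (psum_over (size_shape a)) => le_n.
rewrite psum_over; last by rewrite (leq_trans (size_shape _)).
by rewrite (leq_trans le_n) // psum_leq.
Qed.

End Shape.

(** * Orbit sums as functions on the torus *)

Lemma closed_sum (T : Type) (K : fieldType) (C : (T -> K) -> Prop) :
  C (fun=> 0) -> (forall f g, C f -> C g -> C (fun x => f x + g x)) ->
  forall (I : eqType) (r : seq I) (F : I -> T -> K),
  (forall i, i \in r -> C (F i)) -> C (fun x => \sum_(i <- r) F i x).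
Proof.
move=> C0 CD I r F; elim: r => [|i r IH] H.
  by rewrite (_ : (fun x => _) = fun=> 0) //; apply/funext => x; rewrite big_nil.
rewrite (_ : (fun x => _) = fun x => F i x + \sum_(j <- r) F j x); last first.
  by apply/funext => x; rewrite big_cons.
apply: CD; first by apply: H; rewrite mem_head.
by apply: IH => j jr; apply: H; rewrite inE jr orbT.
Qed.

Section Monomials.
Variables (K : fieldType) (n : nat).
Implicit Types (x y : 'I_n -> K) (e : {ffun 'I_n -> int}) (lam mu : intpart).
Implicit Types (f : ('I_n -> K) -> K) (D : seq intpart).
Notation bcg := ('S_n * {ffun 'I_n -> bool})%type.

Definition torus x := forall i, x i != 0.
Definition mon x e : K := \prod_i x i ^ e i.
Definition flip (eps : {ffun 'I_n -> bool}) x : 'I_n -> K :=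
  fun i => if eps i then (x i)^-1 else x i.
Definition absv e : 'I_n -> nat := fun i => `|e i|%N.
Definition orbit_seq lam :=
  undup [seq bcact g (expo n lam) | g : bcg].
(** Laurent polynomials are handled through the functions that they define on the
    torus, so that specializing or scaling variables is plain substitution. *)
Definition mfun lam x : K := leval x (orbit_sum K n lam).

Lemma torus_flip eps x : torus x -> torus (flip eps x).
Proof. by move=> tx i; rewrite /flip; case: ifP; rewrite ?invr_eq0. Qed.

Lemma mon_eq x y e : x =1 y -> mon x e = mon y e.
Proof. by move=> exy; apply: eq_bigr => i _; rewrite exy. Qed.

Lemma mon0 x : mon x 0 = 1.
Proof. by rewrite /mon big1 // => i _; rewrite ffunE expr0z. Qed.

Lemma monD x e1 e2 : torus x -> mon x (e1 + e2) = mon x e1 * mon x e2.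
Proof.
move=> tx; rewrite -big_split; apply: eq_bigr => i _.
by rewrite ffunE expfzDr.
Qed.

Lemma levalE x P : leval x P = \sum_(e <- msupp P) P@_e * mon x e.
Proof. by rewrite /leval mmapE. Qed.

Lemma leval_sum x (I : Type) (r : seq I) (F : I -> laurent K n) :
  leval x (\sum_(i <- r) F i) = \sum_(i <- r) leval x (F i).
Proof. exact: raddf_sum. Qed.

Lemma levalD x P Q : leval x (P + Q) = leval x P + leval x Q.
Proof. exact: raddfD. Qed.

Lemma levalU x (c : K) e : leval x (<< c *g e >>) = c * mon x e.
Proof. by rewrite /leval mmapU. Qed.

Lemma levalZ x c P : leval x (c *: P) = c * leval x P.
Proof.
rewrite /leval (mmapEw (msuppZ_le c P)) mmapE mulr_sumr.
by apply: eq_bigr => e _; rewrite mcoeffZ mulrA.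
Qed.

Lemma mfunE lam x : mfun lam x = \sum_(e <- orbit_seq lam) mon x e.
Proof. by rewrite /mfun /orbit_sum leval_sum; apply: eq_bigr => e _; rewrite levalU mul1r. Qed.

Lemma mfun_eq lam x y : x =1 y -> mfun lam x = mfun lam y.
Proof. by move=> exy; rewrite !mfunE; apply: eq_bigr => e _; apply: mon_eq. Qed.

Definition bcmul (g h : bcg) : bcg :=
  ((g.1 * h.1)%g, [ffun i => g.2 i (+) h.2 (g.1 i)]).

Lemma bcactM g h e : bcact g (bcact h e) = bcact (bcmul g h) e.
Proof.
apply/ffunP => i; rewrite !ffunE permM mulrA; congr (_ * _).
by rewrite -signr_addb.
Qed.

Lemma bcmul_injl g : injective (bcmul g).
Proof.
case: g => s eps [t1 e1] [t2 e2] [] /mulgI -> /ffunP E; congr pair; apply/ffunP => i.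
by have := E ((s^-1)%g i); rewrite !ffunE /= permKV => /addbI.
Qed.

Lemma bcmul_injr h : injective (bcmul^~ h).
Proof.
case: h => s eps [t1 e1] [t2 e2] [] /mulIg -> /ffunP E; congr pair; apply/ffunP => i.
by have := E i; rewrite !ffunE /= => /addIb.
Qed.

Lemma bcact_inj g : injective (@bcact n g).
Proof.
move=> e1 e2 /ffunP E; apply/ffunP => i.
have := E ((g.1^-1 : 'S_n)%g i); rewrite !ffunE /= !permKV.
by apply: mulfI; rewrite signr_eq0.
Qed.

Lemma bcact_id e : bcact (1%g, [ffun=> false]) e = e.
Proof. by apply/ffunP => i; rewrite !ffunE /= perm1 expr0 mul1r. Qed.

Lemma absv_bcact g e i : absv (bcact g e) i = absv e (g.1 i).
Proof. by rewrite /absv !ffunE abszM abszX /= exp1n mul1n. Qed.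

(** Signs and the order of the entries are all that varies in an orbit, so the
    orbits are the fibres of the shape of the absolute values. *)
Lemma mem_orbit lam e : (size lam <= n)%N ->
  (e \in orbit_seq lam) = (shape (absv e) == lam).
Proof.
move=> sz; rewrite mem_undup; apply/imageP/eqP => [[g _ ->]|<-].
  apply: (@shapeP _ _ _ (g.1^-1)%g) => // i.
  by rewrite absv_bcact permKV /absv ffunE.
have [p Ep] := shape_sort (absv e).
exists ((p^-1)%g, [ffun i => (e i < 0)%R]) => //.
apply/ffunP => i; rewrite !ffunE /= -Ep permKV /absv.
by case: ltrP => h; rewrite ?expr1 ?expr0; lia.
Qed.

Lemma orbit_uniq lam : uniq (orbit_seq lam).
Proof. exact: undup_uniq. Qed.

Lemma mem_expo lam : (size lam <= n)%N -> expo n lam \in orbit_seq lam.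
Proof.
move=> sz; rewrite mem_orbit //; apply/eqP.
rewrite -[RHS](shape_nth sz); apply: shape_eq => i.
by rewrite /absv ffunE.
Qed.

(** The action on exponents comes from an action on points; the inverse
    permutation appears because points are functions of the index. *)
Lemma mon_act x g e :
  mon (fun i => flip g.2 x ((g.1^-1 : 'S_n)%g i)) e = mon x (bcact g e).
Proof.
rewrite /mon (reindex_inj (@perm_inj _ g.1)) /=; apply: eq_bigr => i _.
rewrite ffunE permK /flip; case: (g.2 i); last by rewrite mul1r.
by rewrite exprz_inv expr1 mulN1r.
Qed.

(** Summing over the group and not over the orbit avoids any discussion of
    stabilizers when products are expanded. *)
Definition Sym e x := \sum_(g : bcg) mon x (bcact g e).

Lemma Sym_bcact h e x : Sym (bcact h e) x = Sym e x.
Proof.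
rewrite /Sym [RHS](reindex_inj (@bcmul_injr h)); apply: eq_bigr => g _.
by rewrite bcactM.
Qed.

Lemma bcact_shape e : exists h, e = bcact h (expo n (shape (absv e))).
Proof.
have : e \in orbit_seq (shape (absv e)) by rewrite mem_orbit ?size_shape.
by rewrite mem_undup => /imageP[h _ Eh]; exists h.
Qed.

Definition stab lam := #|[set g : bcg | bcact g (expo n lam) == expo n lam]|.

Lemma stab_gt0 lam : (0 < stab lam)%N.
Proof. by apply/card_gt0P; exists (1%g, [ffun=> false]); rewrite inE bcact_id. Qed.

(** The group elements that lead to a given exponent of the orbit form a coset of
    the stabilizer. *)
Lemma Sym_expo lam x : Sym (expo n lam) x = (stab lam)%:R * mfun lam x.
Proof.
rewrite mfunE /Sym.
have -> : \sum_(g : bcg) mon x (bcact g (expo n lam)) =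
   \sum_(e <- [seq bcact g (expo n lam) | g : bcg]) mon x e.
  by rewrite big_map big_enum.
rewrite -big_undup_iterop_count mulr_sumr; apply: eq_big_seq => e.
rewrite mem_undup => /imageP[h _ ->]; rewrite mulr_natl.
have -> : count_mem (bcact h (expo n lam)) [seq bcact g (expo n lam) | g : bcg] = stab lam.
  rewrite count_map -size_filter -(card_uniqP _); last by rewrite filter_uniq ?enum_uniq.
  rewrite /stab -(card_imset _ (@bcmul_injl h)); apply: eq_card => g.
  rewrite mem_filter mem_enum andbT /=; apply/eqP/imsetP => [Eg|[k]].
    have [k Ek] : exists k, g = bcmul h k.
      by have [k1 k1K k2K] := injF_bij (@bcmul_injl h); exists (k1 g); rewrite k2K.
    exists k => //; rewrite inE; apply/eqP.
    by move: Eg; rewrite Ek -bcactM => /bcact_inj.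
  by rewrite inE => /eqP Ek ->; rewrite -bcactM Ek.
by rewrite Monoid.iteropE /iterop; elim: (stab lam) => [|k /= ->]; rewrite ?mulr0n ?mulrS.
Qed.

Lemma SymE e x : Sym e x = (stab (shape (absv e)))%:R * mfun (shape (absv e)) x.
Proof. by have [h Eh] := bcact_shape e; rewrite {1}Eh Sym_bcact Sym_expo. Qed.

(** The identity is required on the torus only, the domain on which negative powers
    make sense and where all evaluation points lie. *)
Definition span D f :=
  exists c : intpart -> K, forall x, torus x -> f x = \sum_(mu <- D) c mu * mfun mu x.

Lemma span_ext D f g : (forall x, torus x -> f x = g x) -> span D f -> span D g.
Proof. by move=> E [c Ec]; exists c => x tx; rewrite -E // Ec. Qed.

Lemma span0 D : span D (fun=> 0).
Proof. by exists (fun=> 0) => x _; rewrite big1 // => mu _; rewrite mul0r. Qed.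

Lemma spanD D f g : span D f -> span D g -> span D (fun x => f x + g x).
Proof.
move=> [c Ec] [d Ed]; exists (fun mu => c mu + d mu) => x tx.
by rewrite Ec // Ed // -big_split; apply: eq_bigr => mu _; rewrite mulrDl.
Qed.

Lemma spanZ D a f : span D f -> span D (fun x => a * f x).
Proof.
move=> [c Ec]; exists (fun mu => a * c mu) => x tx.
by rewrite Ec // mulr_sumr; apply: eq_bigr => mu _; rewrite mulrA.
Qed.

Lemma spanB D f g : span D f -> span D g -> span D (fun x => f x - g x).
Proof.
move=> Hf Hg; apply: span_ext (spanD Hf (spanZ (-1) Hg)) => x _ /=.
by rewrite mulN1r.
Qed.

Lemma span_sum D (I : eqType) (r : seq I) (F : I -> ('I_n -> K) -> K) :
  (forall i, i \in r -> span D (F i)) -> span D (fun x => \sum_(i <- r) F i x).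
Proof. exact: (closed_sum (span0 D) (@spanD D)). Qed.

Lemma span_mfun D mu : uniq D -> mu \in D -> span D (mfun mu).
Proof.
move=> uD muD; exists (fun nu => (nu == mu)%:R) => x _.
rewrite (bigD1_seq mu) //= eqxx mul1r big1 ?addr0 // => nu /negPf ->.
by rewrite mul0r.
Qed.

Lemma span_sub D1 D2 f : uniq D2 -> {subset D1 <= D2} -> span D1 f -> span D2 f.
Proof.
move=> u2 sub [c Ec].
apply: (@span_ext _ (fun x => \sum_(mu <- D1) c mu * mfun mu x)).
  by move=> x tx; rewrite Ec.
by apply: span_sum => mu /sub muD; apply/spanZ/span_mfun.
Qed.

Definition lsupp (A : {ffun 'I_n -> int} -> Prop) f :=
  exists r : seq (K * {ffun 'I_n -> int}), (forall p, p \in r -> A p.2) /\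
    forall x, torus x -> f x = \sum_(p <- r) p.1 * mon x p.2.

Lemma lsupp_ext A f g : (forall x, torus x -> f x = g x) -> lsupp A f -> lsupp A g.
Proof. by move=> E [r [Ar Er]]; exists r; split=> // x tx; rewrite -E // Er. Qed.

Lemma lsupp_sub (A B : {ffun 'I_n -> int} -> Prop) f :
  (forall e, A e -> B e) -> lsupp A f -> lsupp B f.
Proof. by move=> AB [r [Ar Er]]; exists r; split=> // p pr; apply/AB/Ar. Qed.

Lemma lsupp0 A : lsupp A (fun=> 0).
Proof. by exists [::]; split=> // x _; rewrite big_nil. Qed.

Lemma lsupp_mon (A : {ffun 'I_n -> int} -> Prop) a e : A e -> lsupp A (fun x => a * mon x e).
Proof.
move=> Ae; exists [:: (a, e)]; split=> [p|x _]; first by rewrite inE => /eqP ->.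
by rewrite big_seq1.
Qed.

Lemma lsuppD A f g : lsupp A f -> lsupp A g -> lsupp A (fun x => f x + g x).
Proof.
move=> [r [Ar Er]] [s [As Es]]; exists (r ++ s); split.
  by move=> p; rewrite mem_cat => /orP[/Ar|/As].
by move=> x tx; rewrite Er // Es // big_cat.
Qed.

Lemma lsupp_sum A (I : eqType) (r : seq I) (F : I -> ('I_n -> K) -> K) :
  (forall i, i \in r -> lsupp A (F i)) -> lsupp A (fun x => \sum_(i <- r) F i x).
Proof. exact: (closed_sum (lsupp0 A) (@lsuppD A)). Qed.

Lemma lsuppM (A B C : {ffun 'I_n -> int} -> Prop) f g :
  (forall e1 e2, A e1 -> B e2 -> C (e1 + e2)) ->
  lsupp A f -> lsupp B g -> lsupp C (fun x => f x * g x).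
Proof.
move=> ABC [r [Ar Er]] [s [Bs Es]].
apply: (@lsupp_ext _ (fun x => \sum_(p <- r) \sum_(p' <- s)
     (p.1 * p'.1) * mon x (p.2 + p'.2))).
  move=> x tx; rewrite Er // Es // mulr_suml; apply: eq_bigr => p _.
  by rewrite mulr_sumr; apply: eq_bigr => p' _; rewrite monD // mulrACA.
apply: lsupp_sum => p pr; apply: lsupp_sum => p' ps.
by apply: lsupp_mon; apply: ABC; [apply: Ar | apply: Bs].
Qed.

(** When w B is the sum of the |B| largest parts of a partition this is dominance,
    by [shape_domP]; the general form can be split along the factors of a product. *)
Definition subset_bound (w : {set 'I_n} -> nat) e := forall B : {set 'I_n}, (\sum_(i in B) absv e i <= w B)%N.

Lemma lsuppMw w1 w2 w f g : (forall B, w1 B + w2 B <= w B)%N ->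
  lsupp (subset_bound w1) f -> lsupp (subset_bound w2) g -> lsupp (subset_bound w) (fun x => f x * g x).
Proof.
move=> Hw; apply: lsuppM => e1 e2 H1 H2 B.
apply: leq_trans (Hw B); apply: leq_trans (leq_add (H1 B) (H2 B)).
rewrite -big_split; apply: leq_sum => i _; rewrite /absv ffunE; move: (e1 i) (e2 i) => a b /=; lia.
Qed.

Lemma lsupp1 : lsupp (subset_bound (fun=> 0%N)) (fun=> 1).
Proof.
apply: (@lsupp_ext _ (fun x => 1 * mon x 0)).
  by move=> x _; rewrite mon0 mulr1.
apply: lsupp_mon => B; rewrite big1 // => i _; by rewrite /absv ffunE.
Qed.

Lemma lsupp_prod (I : Type) (r : seq I) (P : pred I) (w : I -> {set 'I_n} -> nat)
    (F : I -> ('I_n -> K) -> K) :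
  (forall i, P i -> lsupp (subset_bound (w i)) (F i)) ->
  lsupp (subset_bound (fun B => \sum_(i <- r | P i) w i B)%N) (fun x => \prod_(i <- r | P i) F i x).
Proof.
move=> H; elim: r => [|i r IH].
  apply: (@lsupp_ext _ (fun=> 1)); first by move=> x _; rewrite big_nil.
  by apply: lsupp_sub lsupp1 => e He B; apply: leq_trans (He B) _.
case Pi: (P i); last first.
  apply: (@lsupp_ext _ (fun x => \prod_(j <- r | P j) F j x)).
    by move=> x _; rewrite big_cons Pi.
  by apply: lsupp_sub IH => e He B; rewrite big_cons Pi.
apply: (@lsupp_ext _ (fun x => F i x * \prod_(j <- r | P j) F j x)).
  by move=> x _; rewrite big_cons Pi.
by apply: lsuppMw (H i Pi) IH => B; rewrite big_cons Pi.
Qed.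

Lemma lsupp_scale A f (v : 'I_n -> K) : torus v -> lsupp A f ->
  lsupp A (fun x => f (fun i => v i * x i)).
Proof.
move=> tv [r [Ar Er]].
apply: (@lsupp_ext _ (fun x => \sum_(p <- r) (p.1 * mon v p.2) * mon x p.2)).
  move=> x tx; rewrite Er; last by move=> i; rewrite mulf_neq0.
  apply: eq_bigr => p _; rewrite -mulrA /mon -big_split; congr (_ * _).
  by apply: eq_bigr => i _; rewrite expfzMl.
by apply: lsupp_sum => p pr; apply: lsupp_mon; apply: Ar.
Qed.

Lemma lsupp_mfun lam : (size lam <= n)%N ->
  lsupp (fun e => shape (absv e) = lam) (mfun lam).
Proof.
move=> sz; apply: (@lsupp_ext _ (fun x => \sum_(e <- orbit_seq lam) 1 * mon x e)).
  by move=> x _; rewrite mfunE; apply: eq_bigr => e _; rewrite mul1r.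
by apply: lsupp_sum => e; rewrite mem_orbit // => /eqP Ee; apply: lsupp_mon.
Qed.

Lemma lsupp_span D f : (forall mu, mu \in D -> (size mu <= n)%N) -> span D f ->
  lsupp (fun e => shape (absv e) \in D) f.
Proof.
move=> szD [c Ec].
apply: (@lsupp_ext _ (fun x => \sum_(mu <- D) c mu * mfun mu x)); first by move=> x /Ec.
apply: lsupp_sum => mu muD.
have [r [Ar Er]] := lsupp_mfun (szD _ muD).
exists [seq (c mu * p.1, p.2) | p <- r]; split.
  by move=> p /mapP[p' /Ar E ->] /=; rewrite E.
by move=> x tx; rewrite Er // big_map mulr_sumr; apply: eq_bigr => p _ /=; rewrite mulrA.
Qed.

Definition bcsym f :=
  forall x, torus x -> forall g : bcg, f (fun i => flip g.2 x ((g.1^-1 : 'S_n)%g i)) = f x.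

Lemma bcsym_perm f : bcsym f -> (forall x y, x =1 y -> f x = f y) ->
  forall x (p : 'S_n), torus x -> f (fun i => x (p i)) = f x.
Proof.
move=> sf ef x p tx; rewrite -[RHS](sf x tx ((p^-1)%g : 'S_n, [ffun=> false])) /=.
by apply: ef => i; rewrite invgK /flip ffunE.
Qed.

Lemma mfun_sym lam : bcsym (mfun lam).
Proof.
move=> x tx g; rewrite !mfunE.
under eq_bigr do rewrite mon_act.
rewrite -(big_map (bcact g) xpredT (mon x)) /=.
apply: perm_big; apply: uniq_perm; rewrite ?orbit_uniq //.
  rewrite map_inj_uniq ?orbit_uniq //.
  exact: bcact_inj.
have [g1 g1K g2K] := injF_bij (@bcmul_injl g).
move=> e; apply/mapP/idP => [[e' He' ->]|].
  move: He'; rewrite !mem_undup => /imageP[h _ ->].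
  by rewrite bcactM; apply/imageP; exists (bcmul g h).
rewrite mem_undup => /imageP[h _ ->].
exists (bcact (g1 h) (expo n lam)); last by rewrite bcactM g2K.
by rewrite mem_undup; apply/imageP; exists (g1 h).
Qed.

Hypothesis char0 : forall k, (k%:R == 0 :> K) = (k == 0%N).

(** Averaging over the group replaces each monomial by a multiple of an orbit sum;
    characteristic zero allows the division by the order of the group. *)
Lemma sym_span D f : uniq D -> bcsym f ->
  lsupp (fun e => shape (absv e) \in D) f -> span D f.
Proof.
move=> uD sf [r [Ar Er]].
have N0 : (#|{: bcg}|)%:R != 0 :> K.
  rewrite char0 -lt0n; apply/card_gt0P; by exists (1%g, [ffun=> false]).
apply: (@span_ext _ (fun x => (#|{: bcg}|)%:R^-1 * \sum_(p <- r) p.1 * Sym p.2 x)).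
  move=> x tx; apply: (mulfI N0); rewrite mulVKf //.
  rewrite -sum1_card natr_sum mulr_suml.
  transitivity (\sum_(g : bcg) f (fun i => flip g.2 x ((g.1^-1 : 'S_n)%g i))); last first.
    by apply: eq_bigr => g _; rewrite mul1r; apply: sf.
  under [RHS]eq_bigr => g _.
    rewrite Er; last by move=> i; apply: torus_flip.
    under eq_bigr do rewrite mon_act.
    over.
  by rewrite exchange_big; apply: eq_bigr => p _; rewrite mulr_sumr.
apply: spanZ; apply: span_sum => p pr; apply: spanZ.
apply: (@span_ext _ (fun x => (stab (shape (absv p.2)))%:R * mfun (shape (absv p.2)) x)).
  by move=> x _; rewrite SymE.
by apply: spanZ; apply: span_mfun => //; apply: Ar.
Qed.

End Monomials.

(** * Specialization of the last variable *)

Section Lists.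
Implicit Types (lam mu nu : intpart).

Definition parts_upto n N : seq intpart :=
  undup [seq mu : intpart <- [seq shape (fun i : 'I_n => val (f i)) | f : {ffun 'I_n -> 'I_N.+1}]
        | (sumn mu <= N)%N].

Lemma nth_le_sumn (lam : intpart) i : (nth 0%N lam i <= sumn lam)%N.
Proof.
elim: (lam : seq nat) i => [|a s IH] [|i] //=; first by rewrite leq_addr.
by rewrite (leq_trans (IH i)) // leq_addl.
Qed.

Lemma mem_parts_upto n N mu : (mu \in parts_upto n N) = (size mu <= n)%N && (sumn mu <= N)%N.
Proof.
rewrite mem_undup mem_filter andbC; case: leqP => [le_N|_]; rewrite ?andbF // !andbT.
apply/imageP/idP => [[f _ ->]|sz]; first exact: size_shape.
exists [ffun i : 'I_n => inord (nth 0%N mu i)] => //.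
rewrite -[LHS](shape_nth sz); apply: shape_eq => i; rewrite ffunE /= inordK //.
by rewrite ltnS (leq_trans (nth_le_sumn _ _)).
Qed.

(** The error terms below decrease in size and not merely in dominance, which is
    what an induction on the size needs. *)
Definition dom_below n lam : seq intpart :=
  [seq mu : intpart <- parts_upto n (sumn lam) | `[< dom mu lam >] && (sumn mu < sumn lam)%N].

Lemma mem_dom_below n lam mu : mu \in dom_below n lam <->
  [/\ (size mu <= n)%N, dom mu lam & (sumn mu < sumn lam)%N].
Proof.
rewrite mem_filter mem_parts_upto; split.
  by case/andP => /andP[/asboolP d lt] /andP[sz _].
case=> sz d lt; rewrite sz lt (ltnW lt) !andbT; exact/asboolP.
Qed.

Definition Dle n lam : seq intpart :=
  [seq mu : intpart <- parts_upto n (sumn lam) | `[< dom mu lam >]].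

Lemma mem_Dle n lam mu : mu \in Dle n lam <-> (size mu <= n)%N /\ dom mu lam.
Proof.
rewrite mem_filter mem_parts_upto; split.
  by case/andP => /asboolP d /andP[sz _].
case=> sz d; rewrite sz (dom_sumn d) !andbT; exact/asboolP.
Qed.

Lemma Dle_uniq n lam : uniq (Dle n lam).
Proof. by rewrite filter_uniq // undup_uniq. Qed.

Lemma dom_below_uniq n lam : uniq (dom_below n lam).
Proof. by rewrite filter_uniq // undup_uniq. Qed.

Definition addcol n lam : intpart := shape (fun i : 'I_n => (nth 0%N lam i).+1).

Lemma nth_shape_dec n (a : nat -> nat) i : (forall i j, (i <= j)%N -> (a j <= a i)%N) ->
  nth 0%N (shape (fun i : 'I_n => a i)) i = if (i < n)%N then a i else 0%N.
Proof.
move=> dec; rewrite /shape.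
have -> : [seq a (val i) | i : 'I_n <- enum 'I_n] = mkseq a n.
  by rewrite /mkseq -val_enum_ord -map_comp.
rewrite nth_mkpart.
  by case: ltnP => h; [rewrite nth_mkseq | rewrite nth_default ?size_mkseq].
rewrite /mkseq; apply: (homo_sorted (e := ltn)); last exact: iota_ltn_sorted.
by move=> j k /= ltjk; apply: dec; apply: ltnW.
Qed.

Lemma nth_addcol n lam i : nth 0%N (addcol n lam) i = if (i < n)%N then (nth 0%N lam i).+1 else 0%N.
Proof. by rewrite (@nth_shape_dec n (fun i => (nth 0%N lam i).+1)) // => j k /(intpart_nth lam). Qed.

Lemma size_addcol n lam : size (addcol n lam) = n.
Proof.
have E i : (i < size (addcol n lam))%N = (i < n)%N.
  by rewrite -nth_gt0 nth_addcol; case: (ltnP i n).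
by apply/eqP; rewrite eqn_leq leqNgt E ltnn /= leqNgt -E ltnn.
Qed.

End Lists.

Section Restrict.
Variables (K : fieldType) (n : nat).
Hypothesis char0 : forall k, (k%:R == 0 :> K) = (k == 0%N).
Implicit Types (x : 'I_n -> K) (lam mu : intpart).

Definition extx x (s : K) : 'I_n.+1 -> K :=
  fun i => if unlift ord_max i is Some j then x j else s.

Definition trunc (e : {ffun 'I_n.+1 -> int}) : {ffun 'I_n -> int} :=
  [ffun j => e (lift ord_max j)].

Lemma torus_extx x s : torus x -> s != 0 -> torus (extx x s).
Proof. by move=> tx s0 i; rewrite /extx; case: unlift. Qed.

Lemma widen_lift (j : 'I_n) : widen_ord (leqnSn n) j = lift ord_max j.
Proof. by apply: ord_inj; rewrite lift_max. Qed.

Lemma mon_extx x s e : mon (extx x s) e = s ^ e ord_max * mon x (trunc e).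
Proof.
rewrite /mon big_ord_recr /= mulrC /extx unlift_none; congr (_ * _).
by apply: eq_bigr => j _; rewrite widen_lift liftK ffunE.
Qed.

Lemma trunc_inj (e1 e2 : {ffun _ -> int}) : e1 ord_max = e2 ord_max -> trunc e1 = trunc e2 -> e1 = e2.
Proof.
move=> E /ffunP E'; apply/ffunP => i; case: (unliftP ord_max i) => [j|] -> //.
by have := E' j; rewrite !ffunE.
Qed.

Lemma sum_absv_trunc e (B : {set 'I_n}) :
  (\sum_(j in B) absv (trunc e) j = \sum_(i in [set lift ord_max j | j in B]) absv e i)%N.
Proof.
rewrite big_imset /=; last by move=> ? ? _ _; apply: lift_inj.
by apply: eq_bigr => j _; rewrite /absv ffunE.
Qed.

Lemma restrict_sym lam s : s != 0 -> bcsym (fun x => mfun lam (extx x s)).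
Proof.
move=> s0 x tx g.
pose g' : 'S_n.+1 * {ffun 'I_n.+1 -> bool} := (lift_perm ord_max ord_max g.1,
   [ffun i => if unlift ord_max i is Some j then g.2 j else false]).
rewrite -[RHS](@mfun_sym _ _ lam _ _ g'); last exact: torus_extx.
apply: mfun_eq => i; rewrite /g' /= lift_permV /flip /extx.
case: (unliftP ord_max i) => [j|] ->.
  by rewrite lift_perm_lift liftK ffunE liftK.
by rewrite lift_perm_id unlift_none ffunE unlift_none.
Qed.

(** Subsets of the remaining coordinates are among the subsets of all of them. *)
Lemma dom_trunc e : dom (shape (absv (trunc e))) (shape (absv e)).
Proof.
apply/shape_domP => B; rewrite sum_absv_trunc.
apply: leq_trans (shape_bound _ _) _.
by rewrite card_imset //; apply: lift_inj.
Qed.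

Lemma restrict_span lam s : s != 0 -> (size lam <= n.+1)%N ->
  span (Dle n lam) (fun x => mfun lam (extx x s)).
Proof.
move=> s0 sz; apply: (sym_span char0); [exact: Dle_uniq | exact: restrict_sym|].
apply: (@lsupp_ext _ _ _ (fun x => \sum_(e <- orbit_seq n.+1 lam) s ^ e ord_max * mon x (trunc e))).
  by move=> x _; rewrite mfunE; apply: eq_bigr => e _; rewrite mon_extx.
apply: lsupp_sum => e; rewrite mem_orbit // => /eqP Ee.
apply: lsupp_mon; apply/mem_Dle; rewrite size_shape -Ee; split=> //.
exact: dom_trunc.
Qed.

(** Exponents with last coordinate 0 form the orbit of lam in one variable less;
    the others lose a nonzero coordinate, hence drop in size. *)
Lemma mfun_restrict lam s : s != 0 -> (size lam <= n)%N ->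
  exists2 f, span (dom_below n lam) f &
    forall x, torus x -> mfun lam (extx x s) = mfun lam x + f x.
Proof.
move=> s0 sz.
have szS : (size lam <= n.+1)%N by apply: leqW.
pose r := [seq e : {ffun 'I_n.+1 -> int} <- orbit_seq n.+1 lam | e ord_max != 0].
pose f x := \sum_(e <- r) s ^ e ord_max * mon x (trunc e).
have Ef x : torus x -> mfun lam (extx x s) = mfun lam x + f x.
  move=> tx; rewrite !mfunE (bigID (fun e : {ffun _ -> int} => e ord_max == 0)) /=.
  congr (_ + _); last by rewrite /f big_filter; apply: eq_bigr => e _; rewrite mon_extx.
  under eq_bigr => e /eqP e0 do rewrite mon_extx e0 expr0z mul1r.
  rewrite -big_filter -(big_map trunc xpredT (mon x)).
  apply: perm_big; apply: uniq_perm; rewrite ?orbit_uniq //.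
    rewrite map_inj_in_uniq ?filter_uniq ?orbit_uniq // => e1 e2.
    rewrite !mem_filter => /andP[/eqP E1 _] /andP[/eqP E2 _]; apply: trunc_inj.
    by rewrite E1.
  have shapeE (e : {ffun 'I_n.+1 -> int}) : e ord_max = 0 ->
      shape (absv (trunc e)) = shape (absv e).
    move=> e0; apply: val_inj => /=; congr sort.
    have -> : [seq absv e i | i <- enum 'I_n.+1] =
        rcons [seq absv (trunc e) i | i <- enum 'I_n] 0%N.
      have a0 : absv e ord_max = 0%N by rewrite /absv e0.
      rewrite enum_ordSr map_rcons a0; congr rcons.
      by rewrite -map_comp; apply: eq_map => j; rewrite /absv ffunE /= widen_lift.
    by rewrite -cats1 filter_cat /= cats0.
  move=> e'; rewrite mem_orbit //; apply/mapP/eqP => [[e]|E].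
    by rewrite mem_filter => /andP[/eqP e0]; rewrite mem_orbit // => /eqP <- ->; apply: shapeE.
  pose e : {ffun 'I_n.+1 -> int} := [ffun i => if unlift ord_max i is Some j then e' j else 0].
  have e0 : e ord_max = 0 by rewrite ffunE unlift_none.
  have et : trunc e = e' by apply/ffunP => j; rewrite !ffunE liftK.
  exists e => //; rewrite mem_filter e0 eqxx mem_orbit //.
  by rewrite -shapeE // et E eqxx.
exists f => //; apply: (sym_span char0); first exact: dom_below_uniq.
  move=> x tx g.
  have tgx : torus (fun i => flip g.2 x ((g.1^-1 : 'S_n)%g i)) by move=> i; apply: torus_flip.
  have F y : torus y -> f y = mfun lam (extx y s) - mfun lam y by move=> /Ef ->; rewrite addrC addKr.
  rewrite !F // mfun_sym //; congr (_ - _).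
  exact: (@restrict_sym lam s s0 x tx g).
apply: lsupp_sum => e; rewrite mem_filter mem_orbit // => /andP[e0 /eqP Ee].
apply: lsupp_mon; apply/mem_dom_below; split; first exact: size_shape.
  by rewrite -Ee; apply: dom_trunc.
rewrite -Ee !sumn_shape big_ord_recr /= -[ltnLHS]addn0 -addnS leq_add //.
  by apply: leq_sum => j _; rewrite widen_lift /absv ffunE.
by rewrite /absv lt0n absz_eq0.
Qed.

End Restrict.

(** * Multiplication by a full column *)

Section AddColumn.
Variables (K : fieldType) (n : nat).
Hypothesis char0 : forall k, (k%:R == 0 :> K) = (k == 0%N).
Implicit Types (x : 'I_n -> K) (lam mu : intpart) (e : {ffun 'I_n -> int}).

Lemma lsupp_var (i : 'I_n) (a : K) (k : int) (b : nat) : (absz k <= b)%N ->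
  lsupp (subset_bound (fun B : {set 'I_n} => if i \in B then b else 0%N)) (fun x => a * x i ^ k).
Proof.
move=> kb; pose e : {ffun 'I_n -> int} := [ffun j => if j == i then k else 0].
apply: (@lsupp_ext _ _ _ (fun x => a * mon x e)).
  move=> x _; rewrite /mon (bigD1 i) //= big1 ?mulr1 => [|j ji].
    by rewrite ffunE eqxx.
  by rewrite ffunE (negPf ji) expr0z.
apply: lsupp_mon => B.
case: ifP => iB.
  rewrite (bigD1 i) //= big1 ?addn0 => [|j /andP[_ ji]]; rewrite /absv ffunE ?eqxx //.
  by rewrite (negPf ji).
by rewrite big1 // => j jB; rewrite /absv ffunE; case: eqP jB iB => // -> ->.
Qed.

Definition palin (k : nat) (y : K) : K := y ^+ k + y ^- k.

Lemma lsupp_palin (i : 'I_n) (a : K) k b : (k <= b)%N ->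
  lsupp (subset_bound (fun B : {set 'I_n} => if i \in B then b else 0%N)) (fun x => a * palin k (x i)).
Proof.
move=> kb; apply: (@lsupp_ext _ _ _ (fun x => a * x i ^ k%:Z + a * x i ^ (- k%:Z))).
  by move=> x _; rewrite -mulrDr /palin -exprnP -invr_expz.
by apply: lsuppD; apply: lsupp_var; lia.
Qed.

(** The sum over the signs factors over the variables, which leaves a permanent. *)
Lemma Sym_perm e x :
  Sym e x = \sum_(p : 'S_n) \prod_i palin (absv e (p i)) (x i).
Proof.
rewrite /Sym -(pair_big predT predT (fun (p : 'S_n) (eps : {ffun 'I_n -> bool}) =>
   mon x (bcact (p, eps) e))) /=; apply: eq_bigr => p _.
transitivity (\prod_i \sum_(b : bool) x i ^ ((-1) ^+ b * e (p i))).
  rewrite bigA_distr_bigA /=; apply: eq_bigr => eps _.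
  by apply: eq_bigr => i _; rewrite ffunE.
apply: eq_bigr => i _; rewrite big_bool /= expr1 expr0 mul1r mulN1r /palin /absv.
rewrite -invr_expz; case: (intP (e (p i))) => [|k|k].
- by rewrite expr0z expr0 invr1.
- by rewrite addrC.
by rewrite abszN -invr_expz invrK.
Qed.

Lemma Sym_part lam x :
  (stab n lam)%:R * mfun lam x = \sum_(p : 'S_n) \prod_i palin (nth 0%N lam (p i)) (x i).
Proof.
rewrite -Sym_expo Sym_perm; apply: eq_bigr => p _; apply: eq_bigr => i _.
by rewrite /absv ffunE.
Qed.

(** A signed permutation fixes lam when its permutation does and when signs are
    changed at zero parts only. *)
Lemma stab_split lam : stab n lam =
  (#|[set p : 'S_n | [forall i, nth 0%N lam (p i) == nth 0%N lam i]]| *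
   \prod_(i < n) (if nth 0%N lam i == 0%N then 2 else 1))%N.
Proof.
pose Q (i : 'I_n) : pred bool := fun b => b ==> (nth 0%N lam i == 0%N).
have -> : (\prod_(i < n) (if nth 0%N lam i == 0%N then 2 else 1) =
   #|[set eps : {ffun 'I_n -> bool} | eps \in family Q]|)%N.
  rewrite cardsE card_family foldrE big_map big_enum /=; apply: eq_bigr => i _.
  rewrite /Q; case: eqP => _.
    rewrite (@eq_card _ _ predT); first by rewrite card_bool.
    by move=> b; rewrite !inE /in_mem /= implybT.
  rewrite (@eq_card _ _ (pred1 false)); first by rewrite card1.
  by move=> b; rewrite !inE /in_mem /=; case: b.
rewrite /stab -cardsX; apply: eq_card => -[p eps]; rewrite !inE /=.
apply/eqP/andP => [/ffunP E|[/forallP Ep /forallP Ee]].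
  have E1 i : nth 0%N lam (p i) == nth 0%N lam i.
    by have /(congr1 absz) := E i; rewrite !ffunE /= abszM abszX exp1n mul1n => /eqP.
  split; first exact/forallP.
  apply/forallP => i; rewrite /Q /in_mem /=; apply/implyP => ei.
  have := E i; rewrite !ffunE /= ei (eqP (E1 i)) expr1 mulN1r => /eqP.
  by rewrite -subr_eq0 -opprD oppr_eq0 -PoszD eqz_nat addn_eq0 => /andP[].
apply/ffunP => i; rewrite !ffunE /= (eqP (Ep i)).
have := Ee i; rewrite /Q /in_mem /=.
by case: (eps i) => /= [/eqP ->|_]; rewrite ?mulr0 ?mul1r.
Qed.

Lemma stab_addcol lam :
  (stab n lam = stab n (addcol n lam) *
     \prod_(i < n) (if nth 0%N lam i == 0%N then 2 else 1))%N.
Proof.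
rewrite !stab_split [in RHS]big1 => [|i _]; last by rewrite nth_addcol ltn_ord.
rewrite muln1; congr (_ * _)%N; apply: eq_card => p; rewrite !inE.
by apply: eq_forallb => i; rewrite !nth_addcol !ltn_ord eqSS.
Qed.

Lemma palin_mul (k : nat) (y c : K) : y != 0 ->
  palin k y * (y + y^-1 - c) = (if k == 0%N then 2 else 1)%:R * palin k.+1 y +
    (if k == 0%N then - (2%:R * c) else palin k.-1 y - c * palin k y).
Proof.
move=> y0; rewrite /palin; case: k => [|k] /=.
  by rewrite expr0 invr1 expr1; ring.
rewrite !exprSr; field.
by rewrite y0 /= expf_neq0.
Qed.

(** One factor turns y^k + y^(-k) into y^(k+1) + y^(-k-1) plus lower terms, with a
    coefficient 2 for k = 0 that makes up for the change of stabilizer. In the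
    other terms of the expansion some variable is not raised, so they are of
    smaller size; their subset sums do not exceed those of lam plus a column. *)
Lemma mfun_addcol lam (c : K) : (size lam <= n)%N ->
  exists2 f, span (dom_below n (addcol n lam)) f &
    forall x, torus x ->
      mfun lam x * \prod_i (x i + (x i)^-1 - c) = mfun (addcol n lam) x + f x.
Proof.
move=> sz; pose mu := addcol n lam.
pose A k y := (if k == 0%N then 2 else 1)%:R * palin k.+1 y.
pose d k y := if k == 0%N then - (2%:R * c) else palin k.-1 y - c * palin k y.
pose R x := \sum_(p <- enum 'S_n) \sum_(J <- [seq J <- enum {set 'I_n} | J != setT])
   \prod_i (if i \in J then A (nth 0%N lam (p i)) (x i) else d (nth 0%N lam (p i)) (x i)).
have st0 : (stab n lam)%:R != 0 :> K by rewrite char0 -lt0n stab_gt0.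
have ER x : torus x -> (stab n lam)%:R * (mfun lam x * \prod_i (x i + (x i)^-1 - c)) =
    (stab n lam)%:R * mfun mu x + R x.
  move=> tx; rewrite mulrA Sym_part mulr_suml.
  transitivity (\sum_(p : 'S_n) \prod_i (A (nth 0%N lam (p i)) (x i) + d (nth 0%N lam (p i)) (x i))).
    apply: eq_bigr => p _; rewrite -big_split; apply: eq_bigr => i _.
    by rewrite /= palin_mul.
  under eq_bigr do rewrite bigA_distr.
  under eq_bigr do rewrite (bigD1 setT) //=.
  rewrite big_split /=; congr (_ + _); last first.
    by rewrite /R big_enum; apply: eq_bigr => p _; rewrite big_filter big_enum_cond.
  rewrite stab_addcol mulnC natrM -mulrA Sym_part mulr_sumr natr_prod.
  apply: eq_bigr => p _.
  rewrite [X in _ = X * _](reindex_inj (@perm_inj _ p)) -big_split.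
  by apply: eq_bigr => i _; rewrite inE /A nth_addcol ltn_ord.
have pmu (B : {set 'I_n}) (p : 'S_n) :
    (\sum_(i in B) (nth 0%N lam (p i)).+1 <= psum mu #|B|)%N.
  have -> : #|B| = #|p @: B| by rewrite card_imset //; apply: perm_inj.
  apply: leq_trans (_ : (\sum_(i in p @: B) nth 0%N mu i <= _)%N).
    rewrite big_imset /=; last by move=> ? ? _ _ /perm_inj.
    by apply: leq_sum => i _; rewrite nth_addcol ltn_ord.
  have {2}-> : mu = shape (fun i : 'I_n => nth 0%N mu i) by rewrite shape_nth ?size_addcol.
  exact: shape_bound.
exists (fun x => (stab n lam)%:R^-1 * R x); last first.
  by move=> x tx; apply: (mulfI st0); rewrite ER // mulrDr mulVKf.
apply: spanZ; apply: (sym_span char0); first exact: dom_below_uniq.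
  have F y : torus y -> R y = (stab n lam)%:R * (mfun lam y * \prod_i (y i + (y i)^-1 - c)) -
     (stab n lam)%:R * mfun mu y by move=> /ER ->; rewrite addrC addKr.
  move=> x tx g.
  have tgx : torus (fun i => flip g.2 x ((g.1^-1 : 'S_n)%g i)) by move=> i; apply: torus_flip.
  rewrite !F // !mfun_sym //; congr (_ * (_ * _) - _).
  rewrite (reindex_inj (@perm_inj _ g.1)) /=; apply: eq_bigr => i _.
  by rewrite permK /flip; case: ifP => // _; rewrite invrK [(x i)^-1 + _]addrC.
apply: lsupp_sum => p _; apply: lsupp_sum => J; rewrite mem_filter => /andP[JT _].
pose b (i : 'I_n) := (if i \in J then (nth 0%N lam (p i)).+1 else nth 0%N lam (p i))%N.
apply: (@lsupp_sub _ _ (subset_bound (fun B : {set 'I_n} => \sum_i (if i \in B then b i else 0%N))%N)).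
  move=> e He; apply/mem_dom_below; split; first exact: size_shape.
    apply/shape_domP => B; apply: leq_trans (He B) _.
    rewrite -big_mkcond /=; apply: leq_trans (pmu B p).
    by apply: leq_sum => i _; rewrite /b; case: ifP.
  rewrite sumn_shape -(psum_over (s := mu) (k := n)) ?size_addcol //.
  rewrite /psum [X in (_ < X)%N](reindex_inj (@perm_inj _ p)).
  have /subsetPn[i0 _ i0J] : ~~ (setT \subset J) by rewrite subTset.
  apply: (@leq_trans (\sum_i b i).+1).
    rewrite ltnS; have := He setT.
    by rewrite (eq_bigl xpredT) => [|i]; rewrite ?inE // => /leq_trans; apply;
      apply: eq_leq; apply: eq_bigr => i _; rewrite inE.
  suff H : (\sum_i b i < \sum_i nth 0 mu (p i))%N by exact: H.
  rewrite [X in (X < _)%N](bigD1 i0) // [X in (_ < X)%N](bigD1 i0) // -addSn leq_add //.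
    by rewrite /b (negPf i0J) nth_addcol ltn_ord.
  by apply: leq_sum => i _; rewrite nth_addcol ltn_ord /b; case: ifP.
apply: lsupp_prod => i _; rewrite /b; case: (i \in J).
  by apply: lsupp_palin.
rewrite /d; case: eqP => [->|k0].
  apply: (@lsupp_ext _ _ _ (fun x => - (2%:R * c) * x i ^ 0)).
    by move=> x _; rewrite expr0z mulr1.
  exact: lsupp_var.
apply: (@lsupp_ext _ _ _ (fun x => 1 * palin (nth 0%N lam (p i)).-1 (x i) +
    (- c) * palin (nth 0%N lam (p i)) (x i))).
  by move=> x _; rewrite mul1r mulNr.
by apply: lsuppD; apply: lsupp_palin => //; apply: leq_pred.
Qed.

End AddColumn.

(** * Interpolation on sets closed under dominance *)

Section Generic.
Variables (K : fieldType).
Implicit Types (q t s : K).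

(** A condition on integer exponents, stable under the changes of parameters below.
    It separates the points q^a t^b s from each other and from their inverses. *)
Definition generic q t s := [/\ q != 0, t != 0, s != 0 &
  forall a b c : int, q ^ a * t ^ b * s ^ c = 1 -> [/\ a = 0, b = 0 & c = 0]].

Lemma generic_shift q t s (i j : int) : generic q t s -> generic q t (q ^ i * t ^ j * s).
Proof.
move=> [q0 t0 s0 H]; split=> //; first by rewrite !mulf_neq0 ?expfz_neq0.
move=> a b c E; have := H (a + i * c) (b + j * c) c.
case; last by move=> h1 h2 h3; move: h1 h2; rewrite h3 !mulr0 !addr0 => -> ->.
by rewrite -E !expfzDr // !expfzMl !exprz_exp; ring.
Qed.

Lemma generic_inv q t s : generic q t s -> generic q t s^-1.
Proof.
move=> [q0 t0 s0 H]; split=> //; first by rewrite invr_eq0.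
move=> a b c; rewrite exprz_inv => /H[-> -> /eqP]; rewrite oppr_eq0 => /eqP ->.
by split.
Qed.

(** The substitute for x - y among functions invariant under inversion: it vanishes
    both at x = y and at x = 1/y. *)
Definition ydiff (x y : K) := x + x^-1 - (y + y^-1).

Lemma ydiffE x y : x != 0 -> y != 0 -> ydiff x y = (x - y) * (1 - x^-1 * y^-1).
Proof. by move=> x0 y0; rewrite /ydiff; field; rewrite x0 y0. Qed.

Lemma ydiff_eq0 x y : x != 0 -> y != 0 -> x != y -> x * y != 1 -> ydiff x y != 0.
Proof.
move=> x0 y0 xy xy1; rewrite ydiffE // mulf_neq0 // subr_eq0 //.
by rewrite eq_sym -invfM invr_eq1.
Qed.

Lemma ydiffxx x : ydiff x x = 0. Proof. exact: subrr. Qed.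

Lemma generic_neq q t s (a b c a' b' c' : int) : generic q t s ->
  (a != a') || (b != b') || (c != c') ->
  q ^ a * t ^ b * s ^ c != q ^ a' * t ^ b' * s ^ c'.
Proof.
move=> [q0 t0 s0 H] D; apply/negP => /eqP E.
have : q ^ (a - a') * t ^ (b - b') * s ^ (c - c') = 1.
  rewrite !expfzDr // -!invr_expz.
  have -> : q ^ a / q ^ a' * (t ^ b / t ^ b') * (s ^ c / s ^ c') =
     (q ^ a * t ^ b * s ^ c) / (q ^ a' * t ^ b' * s ^ c') by field; rewrite !expfz_neq0.
  by rewrite E divff // !mulf_neq0 ?expfz_neq0.
move/H => [/eqP h1 /eqP h2 /eqP h3]; move: h1 h2 h3 D.
by rewrite !subr_eq0 => -> -> ->.
Qed.

Lemma ydiff_generic q t s (a b a' b' : int) : generic q t s ->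
  (a != a') || (b != b') -> ydiff (q ^ a * t ^ b * s) (q ^ a' * t ^ b' * s) != 0.
Proof.
move=> gen D; case: (gen) => q0 t0 s0 _.
apply: ydiff_eq0; rewrite ?mulf_neq0 ?expfz_neq0 //.
  have := @generic_neq q t s a b 1 a' b' 1 gen; rewrite !expr1z; apply.
  by case/orP: D => ->; rewrite ?orbT.
have := @generic_neq q t s (a + a') (b + b') 2 0 0 0 gen.
rewrite orbT !expr0z !mulr1 => /(_ isT); rewrite !expfzDr //.
by congr (_ != _); rewrite -exprnP; ring.
Qed.

End Generic.

Section Interp.
Variables (K : fieldType).
Hypothesis char0 : forall k, (k%:R == 0 :> K) = (k == 0%N).
Implicit Types (q t s : K) (lam mu nu : intpart) (D : seq intpart).

Definition nilp : intpart := mkpart [::].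

Lemma nth_nilp i : nth 0%N nilp i = 0%N.
Proof. by rewrite nth_nil. Qed.

Lemma dom_nilp mu : dom nilp mu.
Proof. by apply/domP => k; rewrite /psum big1 // => i _; rewrite nth_nil. Qed.

Lemma mfun_nil n (x : 'I_n -> K) : mfun nilp x = 1.
Proof.
rewrite mfunE (_ : \sum_(e <- _) _ = \sum_(e <- [:: 0]) mon x e).
  by rewrite big_seq1 mon0.
apply: perm_big; apply: uniq_perm; rewrite ?orbit_uniq // => e.
rewrite mem_orbit // inE; apply/eqP/eqP => [E|->].
  have := congr1 (fun mu : intpart => sumn mu) E; rewrite sumn_shape /= => /eqP.
  rewrite sum_nat_eq0 => /forallP H; apply/ffunP => i; apply/eqP.
  by rewrite ffunE -absz_eq0; have := H i.
apply: intpart_eq => i; rewrite nth_nilp.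
have E : shape (absv (0 : {ffun 'I_n -> int})) = nilp.
  have -> : nilp = shape (fun i : 'I_n => nth 0%N nilp i) by rewrite shape_nth.
  by apply: shape_eq => j; rewrite /absv ffunE nth_nil.
by rewrite E nth_nil.
Qed.

Definition lower n D := [/\ uniq D, forall mu, mu \in D -> (size mu <= n)%N &
  forall mu nu, mu \in D -> (size nu <= n)%N -> dom nu mu -> nu \in D].

Lemma psum_addcol n mu k : (size mu <= n)%N ->
  psum (addcol n mu) k = (psum mu k + \sum_(i < k) (i < n))%N.
Proof.
move=> sz; rewrite /psum -big_split; apply: eq_bigr => i _; rewrite nth_addcol /=.
by case: ltnP => h; rewrite ?addn1 // nth_default // (leq_trans sz).
Qed.

Lemma dom_addcol n mu nu : (size mu <= n)%N -> (size nu <= n)%N ->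
  dom nu mu -> dom (addcol n nu) (addcol n mu).
Proof.
by move=> h1 h2 /domP d; apply/domP => k; rewrite !psum_addcol // leq_add2r.
Qed.

Lemma addcol_inj n mu nu : (size mu <= n)%N -> (size nu <= n)%N ->
  addcol n mu = addcol n nu -> mu = nu.
Proof.
move=> h1 h2 E; apply: intpart_eq => i.
have := congr1 (fun mu : intpart => nth 0%N mu i) E; rewrite !nth_addcol.
case: ltnP => h; first by case.
by rewrite !nth_default // (leq_trans _ h).
Qed.

Definition delcol n mu : intpart := shape (fun i : 'I_n => (nth 0%N mu i).-1).

Lemma delcolK n mu : size mu = n -> addcol n (delcol n mu) = mu.
Proof.
move=> sz; apply: intpart_eq => i.
have dec j k : (j <= k)%N -> ((nth 0%N mu k).-1 <= (nth 0%N mu j).-1)%N.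
  by move=> /(intpart_nth mu); lia.
rewrite nth_addcol (nth_shape_dec n i dec).
case: ltnP => h; last by rewrite nth_default // sz.
by rewrite prednK // nth_gt0 sz.
Qed.

Lemma point_addcol n q t s mu (i : 'I_n) :
  point q t s (addcol n mu) i = point q t (q * s) mu i.
Proof. by rewrite /point nth_addcol ltn_ord exprS; ring. Qed.

Lemma point_extx n q t s mu (i : 'I_n.+1) : (size mu <= n)%N ->
  point q t s mu i = extx (point (n := n) q t (t * s) mu) s i.
Proof.
move=> sz; rewrite /point /extx; case: (unliftP ord_max i) => [j|] -> /=.
  rewrite /bump leqNgt ltn_ord add0n subSn ?ltn_ord //.
  by rewrite exprSr; ring.
by rewrite subnn nth_default // !expr0 !mul1r.
Qed.

Lemma torus_point n q t s mu : q != 0 -> t != 0 -> s != 0 ->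
  torus (point (n := n) q t s mu).
Proof. by move=> q0 t0 s0 i; rewrite /point !mulf_neq0 ?expf_neq0. Qed.

Lemma pointE n q t s mu (i : 'I_n) :
  point q t s mu i = q ^ (nth 0%N mu i)%:Z * t ^ (n - i.+1)%N%:Z * s ^ 1.
Proof. by []. Qed.

Definition liftable n (s : K) D (g : ('I_n -> K) -> K) :=
  exists2 f : ('I_n.+1 -> K) -> K, span D f & forall x, torus x -> f (extx x s) = g x.

Lemma liftable_span n s D L (g : ('I_n -> K) -> K) :
  (forall mu, mu \in L -> liftable s D (mfun (K := K) (n := n) mu)) -> span L g -> liftable s D g.
Proof.
move=> H [c Ec].
suff [f sf Ef] : liftable s D (fun x : 'I_n -> K => \sum_(mu <- L) c mu * mfun mu x).
  by exists f => // x tx; rewrite Ef // Ec.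
elim: L H {Ec} => [|mu L IH] H.
  by exists (fun=> 0); [apply: span0 | move=> x _; rewrite big_nil].
have [f sf Ef] : liftable s D (fun x : 'I_n -> K => \sum_(mu <- L) c mu * mfun mu x).
  by apply: IH => nu nuL; apply: H; rewrite inE nuL orbT.
have [g' sg Eg] := H mu (mem_head _ _).
exists (fun x => c mu * g' x + f x); first by apply: spanD => //; apply: spanZ.
by move=> x tx; rewrite big_cons Ef // Eg.
Qed.

(** [mfun_restrict] is triangular for the size, so the restriction to last variable
    s is onto. *)
Lemma lift_mfun n s D mu : s != 0 -> lower n.+1 D -> mu \in D -> (size mu <= n)%N ->
  liftable s D (mfun (K := K) (n := n) mu).
Proof.
move=> s0 [uD szD dD]; elim: {mu}_.+1 {-2}mu (ltnSn (sumn mu)) => // N IH mu leN muD sz.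
have [f sf Ef] := mfun_restrict char0 s0 sz.
have [g sg Eg] : liftable s D f.
  apply: liftable_span sf => nu /mem_dom_below[sznu dnu ltnu]; apply: IH => //.
    by rewrite -ltnS (leq_trans _ leN).
  by apply: dD muD _ dnu; apply: leqW.
exists (fun x => mfun mu x - g x); first by apply: spanB => //; apply: span_mfun.
by move=> x tx; rewrite Ef // Eg // addrK.
Qed.

(** Partitions with at most n of the n+1 possible parts have last coordinate s: their
    values are achieved by lifting a solution in n variables. A correction that is
    divisible by the product of the x_i + 1/x_i - s - 1/s does not affect them, and
    by [point_addcol] and [mfun_addcol] finding it is the same problem for the
    parameter q s on a smaller set, that of the D-partitions with n+1 parts after
    removal of the first column. *)
Theorem interp_exists n q t s D : lower n D -> generic q t s ->
  forall tau : intpart -> K, exists2 f, span D f &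
    forall mu, mu \in D -> f (point (n := n) q t s mu) = tau mu.
Proof.
elim: n s D => [|n IHn] s D.
  move=> [uD szD dD] _ tau; case: D uD szD dD => [|mu D] uD szD dD.
    by exists (fun=> 0); [apply: span0 | ].
  have E nu : nu \in mu :: D -> nu = nilp.
    move=> /szD sz; apply: intpart_eq => i; rewrite nth_nilp nth_default //.
    exact: leq_trans sz _.
  exists (fun x => tau nilp * mfun nilp x).
    by apply/spanZ/span_mfun => //; rewrite -(E mu) ?mem_head.
  by move=> nu /E ->; rewrite mfun_nil mulr1.
elim: {D}_.+1 {-2}D s (ltnSn (size D)) => // N IHN D s leN lD gen tau.
case: (lD) => uD szD dD; case: (gen) => q0 t0 s0 _.
have [D0|[mu0 mu0D]] : D = [::] \/ exists mu, mu \in D.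
- by case: (D) => [|mu D']; [left | right; exists mu; rewrite mem_head].
- by rewrite D0; exists (fun=> 0); [apply: span0 | ].
have nilD : nilp \in D by apply: dD mu0D _ (dom_nilp _).
pose D1 := [seq mu : intpart <- D | (size mu <= n)%N].
have lD1 : lower n D1.
  split; first by rewrite filter_uniq.
  - by move=> mu; rewrite mem_filter => /andP[].
  - move=> mu nu; rewrite !mem_filter => /andP[_ muD] sznu dnu.
    by rewrite sznu; apply: dD muD _ dnu; apply: leqW.
have gen1 : generic q t (t * s).
  by have := generic_shift 0 1 gen; rewrite expr0z expr1z mul1r.
have genq : generic q t (q * s).
  by have := generic_shift 1 0 gen; rewrite expr0z expr1z mulr1.
have [f1 sf1 Ef1] := IHn _ _ lD1 gen1 tau.
have [f sf Ef] : liftable s D f1.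
  apply: liftable_span sf1 => mu; rewrite mem_filter => /andP[sz muD].
  exact: lift_mfun.
pose B := (\max_(mu <- D) sumn mu)%N.
pose D2 := [seq mu : intpart <- parts_upto n.+1 B | addcol n.+1 mu \in D].
have memD2 mu : (mu \in D2) = (size mu <= n.+1)%N && (addcol n.+1 mu \in D).
  rewrite mem_filter mem_parts_upto andbC; case: leqP => //= sz.
  case muD : (addcol _ _ \in D); rewrite ?andbF // andbT.
  apply: leq_trans (_ : (sumn (addcol n.+1 mu) <= B)%N).
    rewrite -(psum_over (k := n.+1) (s := mu)) // -(psum_over (k := n.+1) (s := addcol _ _)) ?size_addcol //.
    by rewrite psum_addcol // leq_addr.
  by rewrite /B (big_rem _ muD) /= leq_maxl.
have lD2 : lower n.+1 D2.
  split; first by rewrite filter_uniq // undup_uniq.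
  - by move=> mu; rewrite memD2 => /andP[].
  - move=> mu nu; rewrite !memD2 => /andP[szmu muD] sznu dnu.
    by rewrite sznu; apply: dD muD _ (dom_addcol szmu sznu dnu); rewrite size_addcol.
have ltD2 : (size D2 < N)%N.
  rewrite -ltnS; apply: leq_trans leN.
  have -> : (size D2).+2 = (size (nilp :: [seq addcol n.+1 mu | mu <- D2])).+1.
    by rewrite /= size_map.
  rewrite ltnS; apply: uniq_leq_size.
    rewrite /= map_inj_in_uniq; last first.
      move=> mu nu; rewrite !memD2 => /andP[h1 _] /andP[h2 _]; exact: addcol_inj.
    rewrite filter_uniq ?undup_uniq // andbT; apply/mapP => -[mu _ E].
    by have := congr1 (fun mu : intpart => nth 0%N mu 0) E; rewrite nth_addcol.
  move=> mu; rewrite inE => /orP[/eqP -> //|/mapP[nu]].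
  by rewrite memD2 => /andP[_ nuD] ->.
pose W (x : 'I_n.+1 -> K) := \prod_i ydiff (x i) s.
(* The correction has to make up for the values of f, divided by the product W. *)
pose tau' mu := (tau (addcol n.+1 mu) - f (point q t s (addcol n.+1 mu))) /
   W (point q t (q * s) mu).
have [g sg Eg] := IHN D2 _ ltD2 lD2 genq tau'.
have sh : span D (fun x => g x * W x).
  case: sg => c Ec.
  apply: (@span_ext _ _ _ (fun x => \sum_(mu <- D2) c mu * (mfun mu x * W x))).
    move=> x tx; rewrite Ec // mulr_suml; apply: eq_bigr => mu _; by rewrite mulrA.
  apply: span_sum => mu; rewrite memD2 => /andP[sz muD]; apply: spanZ.
  have [h sh Eh] := mfun_addcol char0 (s + s^-1) sz.
  apply: (@span_ext _ _ _ (fun x => mfun (addcol n.+1 mu) x + h x)).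
    by move=> x tx; rewrite -Eh.
  apply: spanD; first exact: span_mfun.
  apply: span_sub sh => // nu /mem_dom_below[sznu dnu _]; exact: dD muD sznu dnu.
exists (fun x => f x + g x * W x); first exact: spanD.
move=> mu muD; have [sz|ltsz] := leqP (size mu) n.
  have [c Ec] := spanD sf sh.
  have EW : W (point q t s mu) = 0.
    rewrite /W (bigD1 ord_max) //= /point subnn nth_default // !expr0 !mul1r.
    by rewrite ydiffxx mul0r.
  rewrite EW mulr0 addr0.
  have tp : torus (point (n := n) q t (t * s) mu) by apply: torus_point; rewrite ?mulf_neq0.
  rewrite -Ef1 ?mem_filter ?sz // -Ef //.
  have [c' Ec'] := sf; rewrite !Ec'; [|exact: torus_extx|exact: torus_point].
  by apply: eq_bigr => nu _; congr (_ * _); apply: mfun_eq => i; rewrite point_extx.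
have szn : size mu = n.+1 by apply/eqP; rewrite eqn_leq szD.
pose nu := delcol n.+1 mu.
have Emu : addcol n.+1 nu = mu by apply: delcolK.
have nuD : nu \in D2 by rewrite memD2 size_shape Emu.
have EP : point (n := n.+1) q t s mu =1 point q t (q * s) nu.
  by move=> i; rewrite -Emu point_addcol.
have tp : torus (point (n := n.+1) q t (q * s) nu) by apply: torus_point; rewrite ?mulf_neq0.
have Eg' : g (point q t s mu) = tau' nu.
  rewrite -Eg //; have [c' Ec'] := sg; rewrite !Ec' //; last exact: torus_point.
  by apply: eq_bigr => ka _; congr (_ * _); apply: mfun_eq.
have EW : W (point q t s mu) = W (point q t (q * s) nu).
  by apply: eq_bigr => i _; rewrite EP.
rewrite Eg' EW /tau' Emu divfK; first by rewrite addrC subrK.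
apply/prodf_neq0 => i _; rewrite -EP.
have := @ydiff_generic _ q t s (nth 0%N mu i)%:Z (n.+1 - i.+1)%N%:Z 0 0 gen.
rewrite !expr0z !mul1r; apply.
by rewrite eqz_nat -lt0n nth_gt0 szn ltn_ord.
Qed.

(** The square evaluation matrix has a one-sided inverse by [interp_exists]. *)
Theorem interp_unique n q t s D (c : intpart -> K) : lower n D -> generic q t s ->
  (forall nu, nu \in D -> \sum_(mu <- D) c mu * mfun mu (point (n := n) q t s nu) = 0) ->
  forall mu, mu \in D -> c mu = 0.
Proof.
move=> lD gen H; case: (lD) => uD szD dD.
case: (gen) => q0 t0 s0 _.
pose N := size D.
pose M := \matrix_(i < N, j < N) mfun (nth nilp D i) (point (n := n) q t s (nth nilp D j)).
have Mfull : row_full M.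
  apply/row_fullP.
  have ex (i : 'I_N) : exists v : 'rV[K]_N, v *m M = delta_mx 0 i.
    have [f [d Ed] Ef] := interp_exists lD gen (fun mu => (mu == nth nilp D i)%:R).
    exists (\row_j d (nth nilp D j)); apply/rowP => j; rewrite !mxE eqxx /=.
    have := Ef _ (mem_nth nilp (ltn_ord j)).
    rewrite nth_uniq // -(inj_eq val_inj) /= => <-; rewrite Ed; last exact: torus_point.
    by rewrite (big_nth nilp) big_mkord; apply: eq_bigr => k _; rewrite !mxE.
  have [V HV] := choice ex.
  exists (\matrix_i V i); apply/row_matrixP => i.
  by rewrite row_mul rowK HV row1.
have Mfree : row_free M by rewrite row_free_unit -row_full_unit.
pose v := \row_(j < N) c (nth nilp D j).
have vM : v *m M = 0 *m M.
  rewrite mul0mx; apply/rowP => j; rewrite !mxE.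
  rewrite -[RHS](H _ (mem_nth nilp (ltn_ord j))) (big_nth nilp) big_mkord.
  by apply: eq_bigr => k _; rewrite !mxE.
have v0 := row_free_inj Mfree vM.
move=> mu muD; have /(congr1 (fun w : 'rV_N => w 0 (Ordinal (etrans (index_mem mu D) muD)))) := v0.
by rewrite !mxE /= nth_index.
Qed.

Corollary span_unique n q t s D f : lower n D -> generic q t s -> span D f ->
  (forall nu, nu \in D -> f (point (n := n) q t s nu) = 0) ->
  forall x, torus x -> f x = 0.
Proof.
move=> lD gen [c Ec] H x tx; case: (gen) => q0 t0 s0 _.
rewrite Ec // big_seq big1 // => mu muD.
rewrite (interp_unique (c := c) lD gen) ?mul0r // => nu nuD.
by rewrite -Ec ?H //; apply: torus_point.
Qed.

End Interp.

(** * Interpolation polynomials *)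

Section LowerSets.
Implicit Types (lam mu nu : intpart) (D : seq intpart).

Definition Dlt n lam : seq intpart := [seq mu <- Dle n lam | mu != lam].

Lemma mem_Dlt n lam mu : mu \in Dlt n lam <-> (size mu <= n)%N /\ dom_lt mu lam.
Proof.
rewrite mem_filter; split.
  by case/andP => neq /mem_Dle[sz d].
by case=> sz [d neq]; rewrite neq; apply/mem_Dle.
Qed.

Lemma Dlt_uniq n lam : uniq (Dlt n lam).
Proof. by rewrite filter_uniq // Dle_uniq. Qed.

Lemma lower_Dle n lam : lower n (Dle n lam).
Proof.
split; first exact: Dle_uniq.
  by move=> mu /mem_Dle[].
move=> mu nu /mem_Dle[_ d1] sz d2; apply/mem_Dle; split=> //.
exact: dom_trans d2 d1.
Qed.

Lemma lower_Dlt n lam : lower n (Dlt n lam).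
Proof.
split; first exact: Dlt_uniq.
  by move=> mu /mem_Dlt[].
move=> mu nu /mem_Dlt[_ [d1 neq]] sz d2; apply/mem_Dlt; split=> //; split.
  exact: dom_trans d2 d1.
apply: contraNneq neq => E; apply/eqP; apply: dom_anti => //.
by rewrite -E.
Qed.

Lemma lower_parts_upto n d : lower n (parts_upto n d).
Proof.
split; first exact: undup_uniq.
  by move=> mu; rewrite mem_parts_upto => /andP[].
move=> mu nu; rewrite !mem_parts_upto => /andP[_ h] -> /dom_sumn /leq_trans; exact.
Qed.

Lemma dom_below_Dlt n lam : {subset dom_below n lam <= Dlt n lam}.
Proof.
move=> mu /mem_dom_below[sz d lt]; apply/mem_Dlt; split=> //; split=> //.
by apply: contraTneq lt => ->; rewrite ltnn.
Qed.

End LowerSets.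

Section InterpPoly.
Variables (K : fieldType).
Hypothesis char0 : forall k, (k%:R == 0 :> K) = (k == 0%N).
Implicit Types (q t s : K) (lam mu nu : intpart) (D : seq intpart).

Lemma orbit_sum_coef n lam (e : {ffun 'I_n -> int}) :
  (orbit_sum K n lam)@_e = (e \in orbit_seq n lam)%:R.
Proof.
rewrite /orbit_sum raddf_sum /= -/(orbit_seq n lam).
have [eL|eL] := boolP (e \in orbit_seq n lam).
  rewrite (bigD1_seq e) ?orbit_uniq //= mcoeffUU big1 ?addr0 // => e' ne.
  by rewrite mcoeffU (negPf ne).
rewrite big_seq big1 // => e' e'L; rewrite mcoeffU.
by case: eqP e'L eL => // -> ->.
Qed.

Lemma orbit_sum_sym n lam : (size lam <= n)%N -> bc_symmetric (orbit_sum K n lam).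
Proof.
move=> sz g e; rewrite !orbit_sum_coef !mem_orbit //; congr (_ == _)%:R.
rewrite -(shape_perm (absv e) g.1); apply: shape_eq => i; exact: absv_bcact.
Qed.

Definition Pstar n q t s lam (x : 'I_n -> K) : K := leval x (interp n q t s lam).

(** The coefficients come from the interpolation problem for minus the values of the
    leading orbit sum. *)
Lemma is_interpP n q t s lam : generic q t s -> (size lam <= n)%N ->
  is_interp q t s lam (interp n q t s lam).
Proof.
move=> gen sz; apply: classical_sets.xgetPex.
case: (gen) => q0 t0 s0 _.
have [f [c Ec] Ef] := interp_exists char0 (lower_Dlt n lam) gen
   (fun mu => - mfun lam (point (n := n) q t s mu)).
exists (orbit_sum K n lam + \sum_(mu <- Dlt n lam) c mu *: orbit_sum K n mu); split.
- move=> g e; rewrite !mcoeffD orbit_sum_sym // !raddf_sum /=; congr (_ + _).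
  apply: eq_big_seq => mu /mem_Dlt[szmu _].
  by rewrite !mcoeffZ orbit_sum_sym.
- by exists (Dlt n lam), c; split=> // mu /mem_Dlt.
move=> mu szmu dmu; have muD : mu \in Dlt n lam by apply/mem_Dlt.
rewrite levalD.
transitivity (mfun lam (point (n := n) q t s mu) + f (point q t s mu)).
  rewrite Ec; last exact: torus_point.
  by congr (_ + _); rewrite leval_sum; apply: eq_bigr => nu _; rewrite levalZ.
by rewrite Ef // addrN.
Qed.

Lemma Pstar_lead n q t s lam : generic q t s -> (size lam <= n)%N ->
  exists2 f : ('I_n -> K) -> K, span (Dlt n lam) f & forall x, torus x -> Pstar q t s lam x = mfun lam x + f x.
Proof.
move=> gen sz; have [_ [r [c [Hr E]]] _] := is_interpP gen sz.
exists (fun x => \sum_(mu <- r) c mu * mfun mu x).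
  apply: span_sum => mu /Hr[szmu dmu]; apply: spanZ.
  by apply: span_mfun; [exact: Dlt_uniq | apply/mem_Dlt].
move=> x _; rewrite /Pstar E levalD; congr (_ + _); rewrite leval_sum.
by apply: eq_bigr => mu _; rewrite levalZ.
Qed.

Lemma Pstar_vanish_lt n q t s lam mu : generic q t s -> (size lam <= n)%N ->
  mu \in Dlt n lam -> Pstar q t s lam (point (n := n) q t s mu) = 0.
Proof. by move=> gen sz /mem_Dlt[szmu dmu]; have [_ _] := is_interpP gen sz; apply. Qed.

Lemma Pstar_unique n q t s lam (F f : ('I_n -> K) -> K) : generic q t s -> (size lam <= n)%N ->
  span (Dlt n lam) f -> (forall x, torus x -> F x = mfun lam x + f x) ->
  (forall mu, mu \in Dlt n lam -> F (point (n := n) q t s mu) = 0) ->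
  forall x, torus x -> Pstar q t s lam x = F x.
Proof.
move=> gen sz sf EF HF x tx; case: (gen) => q0 t0 s0 _.
have [g sg Eg] := Pstar_lead gen sz.
have := span_unique char0 (lower_Dlt n lam) gen (spanB sg sf).
have E y : torus y -> Pstar q t s lam y - F y = g y - f y.
  by move=> ty; rewrite Eg // EF // opprD addrACA subrr add0r.
move=> H; apply/eqP; rewrite -subr_eq0 E // H // => mu muD.
rewrite -E; last exact: torus_point.
by rewrite Pstar_vanish_lt // HF // subrr.
Qed.

Lemma Pstar_eq n q t s lam (x y : 'I_n -> K) : x =1 y -> Pstar q t s lam x = Pstar q t s lam y.
Proof.
by move=> exy; rewrite /Pstar !levalE; apply: eq_bigr => e _; rewrite (mon_eq _ exy).
Qed.

Lemma Pstar_span n q t s lam : generic q t s -> (size lam <= n)%N ->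
  span (Dle n lam) (Pstar (n := n) q t s lam).
Proof.
move=> gen sz; have [f sf Ef] := Pstar_lead gen sz.
apply: (@span_ext _ _ _ (fun x => mfun lam x + f x)); first by move=> x tx; rewrite Ef.
apply: spanD; first by apply: span_mfun; [exact: Dle_uniq | apply/mem_Dle; split].
by apply: span_sub sf; [exact: Dle_uniq | move=> mu; rewrite mem_filter => /andP[]].
Qed.

(** Otherwise all values on the partitions dominated by lam would vanish, against the
    leading coefficient 1. *)
Lemma Pstar_diag_neq0 n q t s lam : generic q t s -> (size lam <= n)%N ->
  Pstar q t s lam (point (n := n) q t s lam) != 0.
Proof.
move=> gen sz; apply/negP => /eqP E0; case: (gen) => q0 t0 s0 _.
have [f [c Ec] Ef] := Pstar_lead gen sz.
pose d mu := if mu == lam then 1 else c mu.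
have EP (x : 'I_n -> K) : torus x -> Pstar q t s lam x = \sum_(mu <- Dle n lam) d mu * mfun mu x.
  move=> tx; rewrite (bigD1_seq lam) ?Dle_uniq //=; last by apply/mem_Dle; split.
  rewrite {1}/d eqxx mul1r Ef // Ec // /Dlt big_filter; congr (_ + _).
  by apply: eq_bigr => mu /negPf ne; rewrite /d ne.
have : d lam = 0.
  apply: (interp_unique char0 (lower_Dle n lam) gen); last by apply/mem_Dle; split.
  move=> nu nuD; rewrite -EP; last exact: torus_point.
  have [->//|ne] := eqVneq nu lam.
  by apply: Pstar_vanish_lt => //; rewrite mem_filter ne.
by rewrite /d eqxx => /eqP; rewrite oner_eq0.
Qed.

(** Setting the last variable to s preserves the leading term, and by [point_extx] it
    preserves the zeros if the parameter becomes t s. *)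
Lemma Pstar_stable n q t s lam (x : 'I_n -> K) : generic q t s -> (size lam <= n)%N ->
  torus x -> Pstar q t (t * s) lam x = Pstar q t s lam (extx x s).
Proof.
move=> gen sz; case: (gen) => q0 t0 s0 _.
have gen1 : generic q t (t * s).
  by have := generic_shift 0 1 gen; rewrite expr0z expr1z mul1r.
have szS : (size lam <= n.+1)%N by apply: leqW.
have [f [c Ec] Ef] := Pstar_lead gen szS.
have [h sh Eh] := mfun_restrict char0 s0 sz.
move: x; apply: (Pstar_unique (f := fun x => h x + \sum_(mu <- Dlt n.+1 lam) c mu * mfun mu (extx x s))) => //.
- apply: spanD; first by apply: span_sub sh; [exact: Dlt_uniq | exact: dom_below_Dlt].
  apply: span_sum => mu /mem_Dlt[szmu [dmu neq]]; apply: spanZ.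
  apply: span_sub (restrict_span char0 s0 szmu); first exact: Dlt_uniq.
  move=> nu /mem_Dle[sznu dnu]; apply/mem_Dlt; split=> //; split.
    exact: dom_trans dnu dmu.
  apply: contraNneq neq => E; apply/eqP; apply: dom_anti => //; by rewrite -E.
- by move=> x tx; rewrite Ef ?Ec ?Eh ?addrA //; apply: torus_extx.
move=> mu /mem_Dlt[szmu dmu].
rewrite -(Pstar_eq _ _ _ _ (fun i => point_extx q t s i szmu)).
by apply: Pstar_vanish_lt => //; apply/mem_Dlt; split=> //; apply: leqW.
Qed.

(** The zeros at partitions with fewer than n parts come from the product, because the
    last coordinate is s there; the other zeros are those of lam for the parameter q s. *)
Lemma Pstar_addcol n q t s lam (x : 'I_n -> K) : generic q t s -> (size lam <= n)%N ->
  torus x -> Pstar q t s (addcol n lam) x = Pstar q t (q * s) lam x * \prod_i ydiff (x i) s.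
Proof.
move=> gen sz; case: (gen) => q0 t0 s0 _.
have genq : generic q t (q * s).
  by have := generic_shift 1 0 gen; rewrite expr0z expr1z mulr1.
have [f [c Ec] Ef] := Pstar_lead genq sz.
have [h sh Eh] := mfun_addcol char0 (s + s^-1) sz.
have E2 mu : (size mu <= n)%N -> exists2 h : ('I_n -> K) -> K, span (dom_below n (addcol n mu)) h &
    forall x : 'I_n -> K, torus x -> mfun mu x * \prod_i ydiff (x i) s = mfun (addcol n mu) x + h x.
  by move=> /(mfun_addcol char0 (s + s^-1)).
have domA mu : (size mu <= n)%N -> dom (addcol n mu) (addcol n lam) -> dom mu lam.
  move=> szmu /domP d; apply/domP => k; move: (d k); rewrite !psum_addcol //.
  by rewrite leq_add2r.
move: x; apply: (Pstar_unique (f := fun x => h x + \sum_(mu <- Dlt n lam) c mu * (mfun mu x * \prod_i ydiff (x i) s))) => //.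
- by rewrite size_addcol.
- apply: spanD; first by apply: span_sub sh; [exact: Dlt_uniq | exact: dom_below_Dlt].
  apply: span_sum => mu /mem_Dlt[szmu [dmu neq]]; apply: spanZ.
  have [h' sh' Eh'] := E2 mu szmu.
  apply: (@span_ext _ _ _ (fun x => mfun (addcol n mu) x + h' x)).
    by move=> x tx; rewrite Eh'.
  have muD : addcol n mu \in Dlt n (addcol n lam).
    apply/mem_Dlt; rewrite size_addcol; split=> //; split; first exact: dom_addcol.
    by apply: contraNneq neq => /addcol_inj ->.
  apply: spanD; first by apply: span_mfun => //; exact: Dlt_uniq.
  apply: span_sub sh'; first exact: Dlt_uniq.
  move=> nu /dom_below_Dlt/mem_Dlt[sznu [dnu nnu]].
  have [_ _ L] := lower_Dlt n (addcol n lam); exact: L muD sznu dnu.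
- move=> x tx; rewrite Ef // Ec // mulrDl.
  rewrite addrA -(Eh x tx); congr (_ + _).
  by rewrite mulr_suml; apply: eq_bigr => mu _; rewrite mulrA.
move=> mu /mem_Dlt[szmu [dmu neq]].
have [ltn|gen_] := ltnP (size mu) n.
  have n0 : (0 < n)%N by apply: leq_ltn_trans ltn.
  have ltn1 : (n.-1 < n)%N by rewrite prednK.
  rewrite (bigD1 (Ordinal ltn1)) //= /point /= prednK // subnn nth_default.
    by rewrite !expr0 !mul1r ydiffxx mul0r mulr0.
  by rewrite -ltnS prednK.
have szE : size mu = n by apply/eqP; rewrite eqn_leq szmu.
pose nu := delcol n mu; have Emu : addcol n nu = mu by apply: delcolK.
rewrite (Pstar_eq _ _ _ _ (y := point q t (q * s) nu)); last first.
  by move=> i; rewrite -Emu point_addcol.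
rewrite Pstar_vanish_lt ?mul0r //; apply/mem_Dlt; split; first exact: size_shape.
split; first by apply: domA; rewrite ?size_shape ?Emu.
by apply: contraNneq neq => <-; rewrite Emu.
Qed.

End InterpPoly.

(** * Alternants and divisibility by the Weyl denominator *)

Section Alternants.
Variables (K : fieldType) (n : nat).
Hypothesis char0 : forall k, (k%:R == 0 :> K) = (k == 0%N).
Implicit Types (x : 'I_n -> K) (lam mu : intpart) (e : {ffun 'I_n -> int}).
Notation bcg := ('S_n * {ffun 'I_n -> bool})%type.

(** The determinant of the signed permutation. *)
Definition bsgn (g : bcg) : K := (-1) ^+ g.1 * \prod_i (-1) ^+ g.2 i.

Definition act (g : bcg) x : 'I_n -> K :=
  fun i => flip g.2 x ((g.1^-1 : 'S_n)%g i).

Lemma torus_act g x : torus x -> torus (act g x).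
Proof. by move=> tx i; apply: torus_flip. Qed.

Lemma bsgnM g h : bsgn (bcmul g h) = bsgn g * bsgn h.
Proof.
rewrite /bsgn /= odd_permM signr_addb -!mulrA; congr (_ * _).
rewrite mulrCA; congr (_ * _).
rewrite [X in _ = _ * X](reindex_inj (@perm_inj _ g.1)) -big_split.
by apply: eq_bigr => i _; rewrite ffunE signr_addb.
Qed.

Lemma bsgn_sqr g : bsgn g * bsgn g = 1.
Proof.
rewrite /bsgn mulrACA -expr2 sqrr_sign mul1r -big_split big1 // => i _ /=.
by rewrite -expr2 sqrr_sign.
Qed.

Definition alt e x := \sum_(g : bcg) bsgn g * mon x (bcact g e).

Lemma altE e x : alt e x = \sum_(g : bcg) bsgn g * mon (act g x) e.
Proof. by apply: eq_bigr => g _; rewrite mon_act. Qed.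

Lemma alt_bcact h e x : alt (bcact h e) x = bsgn h * alt e x.
Proof.
rewrite /alt [in RHS](reindex_inj (@bcmul_injr _ h)) mulr_sumr.
apply: eq_bigr => g _; rewrite bcactM bsgnM.
by rewrite mulrA [bsgn h * _]mulrC -[bsgn g * _ * _]mulrA bsgn_sqr mulr1.
Qed.

Lemma alt_stab0 h e x : bsgn h = -1 -> bcact h e = e -> alt e x = 0.
Proof.
move=> sh he; have := alt_bcact h e x; rewrite he sh mulN1r => /eqP.
by rewrite -addr_eq0 -mulr2n -mulr_natl mulf_eq0 char0 /= => /eqP.
Qed.

Lemma alt_zero e x i : e i = 0 -> alt e x = 0.
Proof.
move=> ei; apply: (@alt_stab0 (1%g, [ffun j => j == i])).
  rewrite /bsgn /= odd_perm1 mul1r (bigD1 i) //= big1 ?mulr1 => [|j /negPf ji].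
    by rewrite ffunE eqxx expr1.
  by rewrite ffunE ji expr0.
apply/ffunP => j; rewrite !ffunE /= perm1; case: eqP => [->|_].
  by rewrite ei mulr0.
by rewrite mul1r.
Qed.

Lemma alt_repeat e x i j : i != j -> e i = e j -> alt e x = 0.
Proof.
move=> ij eij; apply: (@alt_stab0 (tperm i j, [ffun=> false])).
  rewrite /bsgn /= odd_tperm ij expr1 big1 ?mulr1 // => k _.
  by rewrite ffunE.
apply/ffunP => k; rewrite !ffunE /= mul1r.
by case: tpermP => [->|->|].
Qed.

(** By invariance f may be evaluated at the transformed point in each term. *)
Lemma alt_mul f e x (r : seq (K * {ffun 'I_n -> int})) : bcsym f -> torus x ->
  (forall x, torus x -> f x = \sum_(p <- r) p.1 * mon x p.2) ->
  f x * alt e x = \sum_(p <- r) p.1 * alt (e + p.2) x.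
Proof.
move=> sf tx Ef; rewrite altE mulr_sumr.
under [RHS]eq_bigr do rewrite altE mulr_sumr.
rewrite exchange_big; apply: eq_bigr => g _ /=.
rewrite -(sf x tx g) (Ef _ (torus_act g tx)) mulr_suml.
apply: eq_bigr => p _; rewrite monD; last exact: torus_act.
by ring.
Qed.

Definition rho : {ffun 'I_n -> int} := [ffun i : 'I_n => (n - i)%N%:Z].
Definition psum_rho (k : nat) := (\sum_(i < k) (n - i))%N.

(** The denominator alt rho is that of Weyl for type C. *)
Definition adiv (D : seq intpart) (G : ('I_n -> K) -> K) :=
  exists2 F, span D F & forall x, torus x -> G x = alt rho x * F x.

Lemma adiv_ext D G G' : (forall x, torus x -> G x = G' x) -> adiv D G -> adiv D G'.
Proof. by move=> E [F sF EF]; exists F => // x tx; rewrite -E // EF. Qed.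

Lemma adiv0 D : adiv D (fun=> 0).
Proof. by exists (fun=> 0); [apply: span0 | move=> x _; rewrite mulr0]. Qed.

Lemma adivD D G G' : adiv D G -> adiv D G' -> adiv D (fun x => G x + G' x).
Proof.
move=> [F sF EF] [F' sF' EF']; exists (fun x => F x + F' x); first exact: spanD.
by move=> x tx; rewrite EF // EF' // mulrDr.
Qed.

Lemma adivZ D a G : adiv D G -> adiv D (fun x => a * G x).
Proof.
move=> [F sF EF]; exists (fun x => a * F x); first exact: spanZ.
by move=> x tx; rewrite EF // mulrCA.
Qed.

Lemma adiv_sum D (I : eqType) (r : seq I) (G : I -> ('I_n -> K) -> K) :
  (forall i, i \in r -> adiv D (G i)) -> adiv D (fun x => \sum_(i <- r) G i x).
Proof. exact: (closed_sum (adiv0 D) (@adivD D)). Qed.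

Definition norm2 e := (\sum_i absv e i * absv e i)%N.

Lemma norm2_shape e lam : (size lam <= n)%N -> shape (absv e) = lam ->
  norm2 e = norm2 (expo n lam).
Proof.
move=> sz E; have [p Ep] := shape_sort (absv e).
rewrite /norm2 (reindex_inj (@perm_inj _ p)) /=; apply: eq_bigr => i _.
by rewrite Ep E /absv !ffunE.
Qed.

(** Summation by parts: rho is the sum of the indicators of the initial segments. *)
Lemma rho_dot (v : 'I_n -> int) :
  \sum_i rho i * v i = \sum_(k < n) \sum_(i < n | (i <= k)%N) v i.
Proof.
rewrite [RHS](exchange_big_dep xpredT) //=.
apply: eq_bigr => i _; rewrite sumr_const ffunE -mulr_natl; congr (_ * _).
rewrite natz; congr Posz; rewrite -sum1_card.
have -> : (n - i = \sum_(i <= k < n) 1)%N by rewrite sum_nat_const_nat muln1.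
by rewrite (big_nat_widenl _ 0%N) // big_mkord; apply: eq_bigl => k; rewrite andTb.
Qed.

(** After summation by parts the difference is a sum of differences of partial sums,
    each nonnegative since the partial sums of lam are the largest of its orbit. *)
Lemma rho_dot_lt lam e : (size lam <= n)%N -> shape (absv e) = lam ->
  e != expo n lam -> \sum_i rho i * e i < \sum_i rho i * expo n lam i.
Proof.
move=> sz E ne; rewrite !rho_dot -subr_gt0 -sumrB.
pose d (k : nat) := \sum_(i < n | (i < k)%N) expo n lam i - \sum_(i < n | (i < k)%N) e i.
have d0 k : 0 <= d k.
  rewrite /d subr_ge0.
  apply: (@le_trans _ _ (\sum_(i < n | (i < k)%N) (absv e i)%:Z)).
    by apply: ler_sum => i _; rewrite /absv abszE ler_norm.
  rewrite -(big_morph _ PoszD (erefl (Posz 0))).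
  rewrite (eq_bigr (fun i : 'I_n => (nth 0%N lam i)%:Z)); last by move=> i _; rewrite ffunE.
  rewrite -(big_morph _ PoszD (erefl (Posz 0))) lez_nat.
  pose B := [set i : 'I_n | (i < k)%N].
  have := shape_bound (absv e) B; rewrite E.
  have -> : (\sum_(i in B) absv e i = \sum_(i < n | (i < k)%N) absv e i)%N.
    by apply: eq_bigl => i; rewrite inE.
  move=> /leq_trans; apply.
  have [lt_nk|le_kn] := ltnP n k.
    rewrite (eq_bigl xpredT); last by move=> i; rewrite (ltn_trans _ lt_nk).
    by apply: psum_leq; rewrite -[n in (_ <= n)%N]card_ord max_card.
  have -> : #|B| = k.
    rewrite cardsE -sum1_card (eq_bigl (fun i : 'I_n => i < k)%N) //.
    by rewrite -(big_ord_widen n (fun=> 1%N) le_kn) sum1_card card_ord.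
  by rewrite /psum (big_ord_widen n (nth 0%N lam) le_kn).
have dS (i : 'I_n) : d i.+1 = d i + (expo n lam i - e i).
  have S (v : 'I_n -> int) : \sum_(j < n | (j < i.+1)%N) v j = \sum_(j < n | (j < i)%N) v j + v i.
    rewrite (bigD1 i) //= addrC; congr (_ + _); apply: eq_bigl => j.
    by rewrite ltnS ltn_neqAle andbC.
  by rewrite /d !S opprD addrACA.
rewrite lt_neqAle sumr_ge0 ?andbT; last by move=> k _; apply: (d0 k.+1).
rewrite eq_sym psumr_neq0; last by move=> k _; apply: (d0 k.+1).
apply: contraNT ne => /hasPn H; apply/eqP/ffunP => i.
have dz k : (k <= n)%N -> d k = 0.
  case: k => [|k] kn; first by rewrite /d !big_pred0.
  have := H (Ordinal kn) (mem_index_enum _); rewrite /= -leNgt => h.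
  by apply/eqP; rewrite eq_le d0 andbT.
have := dS i; rewrite !dz //; last by apply: ltnW.
by rewrite add0r => /esym/eqP; rewrite subr_eq0 => /eqP.
Qed.

(** In the expansion of the squared norm only the scalar product with rho varies
    within the orbit. *)
Lemma norm2_rho_lt lam e : (size lam <= n)%N -> shape (absv e) = lam ->
  e != expo n lam -> (norm2 (rho + e)%R < norm2 (rho + expo n lam)%R)%N.
Proof.
move=> sz E ne.
have F (v : {ffun 'I_n -> int}) : (norm2 (rho + v))%:Z =
    \sum_i rho i * rho i + 2%:R * \sum_i rho i * v i + (norm2 v)%:Z.
  have G (w : {ffun 'I_n -> int}) : (norm2 w)%:Z = \sum_i w i * w i.
    rewrite /norm2 (big_morph _ PoszD (erefl (Posz 0))); apply: eq_bigr => i _.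
    by rewrite PoszM /absv abszE -normrM ger0_norm // -expr2 sqr_ge0.
  rewrite !G mulr_sumr -!big_split /=; apply: eq_bigr => i _.
  by rewrite [(rho + v) i]ffunE; ring.
rewrite -ltz_nat !F (norm2_shape sz E) ltrD2r ltrD2l ltr_pM2l //.
exact: rho_dot_lt.
Qed.

Lemma psum_rho_bound (B : {set 'I_n}) : (\sum_(i in B) (n - i) <= psum_rho #|B|)%N.
Proof. by apply: sum_le_top => i j ij; apply: leq_sub2l. Qed.

(** Up to sign e is a partition lam, and alt e is zero unless lam is positive and
    strictly decreasing, that is lam = rho + kap. The product of m_kap and alt rho
    is the sum of the alt (rho + e') over the orbit of kap; one term is alt e, the
    others have smaller norm and satisfy the same bounds. *)
Theorem alt_div (h : nat -> nat) D : uniq D ->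
  (forall mu, (size mu <= n)%N -> (forall k, (k <= n)%N -> (psum mu k <= h k)%N) -> mu \in D) ->
  forall e, subset_bound (fun B : {set 'I_n} => h #|B| + psum_rho #|B|)%N e -> adiv D (alt e).
Proof.
move=> uD HD e; elim: {e}_.+1 {-2}e (ltnSn (norm2 e)) => // N IH e leN He.
pose lam := shape (absv e).
have sz : (size lam <= n)%N by apply: size_shape.
have [g Eg] := bcact_shape e; rewrite -/lam in Eg.
suff [F sF EF] : adiv D (alt (expo n lam)).
  exists (fun x => bsgn g * F x); first exact: spanZ.
  by move=> x tx; rewrite Eg alt_bcact EF // mulrCA.
have [/existsP[i /eqP li0]|/existsPn pos] := boolP [exists i : 'I_n, nth 0%N lam i == 0%N].
  apply: adiv_ext (adiv0 D) => x _; rewrite (@alt_zero _ _ i) //.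
  by rewrite ffunE li0.
have [/existsP[i /existsP[j /andP[ij /eqP lij]]]|reg] :=
    boolP [exists i : 'I_n, [exists j : 'I_n, (i != j) && (nth 0%N lam i == nth 0%N lam j)]].
  apply: adiv_ext (adiv0 D) => x _; rewrite (@alt_repeat _ _ i j) //.
  by rewrite !ffunE lij.
have neq i j : (i < n)%N -> (j < n)%N -> i != j -> nth 0%N lam i != nth 0%N lam j.
  move=> hi hj ij; apply: contraNneq reg => E.
  apply/existsP; exists (Ordinal hi); apply/existsP; exists (Ordinal hj).
  by rewrite -(inj_eq val_inj) /= ij E eqxx.
(* A strictly decreasing sequence drops by at least d in d steps. *)
have step d i : (i + d < n)%N -> (nth 0%N lam (i + d) + d <= nth 0%N lam i)%N.
  elim: d => [|d IHd] lt; first by rewrite !addn0.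
  have lt' : (i + d < n)%N by apply: ltn_trans lt; rewrite addnS.
  apply: leq_trans (IHd lt'); rewrite addnS -addSn leq_add2r addnS ltn_neqAle.
  have lt1 : ((i + d).+1 < n)%N by rewrite -addnS.
  rewrite (neq _ _ lt1 lt') ?andTb; first by apply: intpart_nth; apply: leqnSn.
  by rewrite neq_ltn ltnSn orbT.
have lb i : (i < n)%N -> (n - i <= nth 0%N lam i)%N.
  move=> lti; have := step (n.-1 - i)%N i; have := pos (Ordinal (_ : (n.-1 < n)%N)).
  have n0 : (n.-1 < n)%N by lia.
  move=> /(_ n0) /= p; have -> : (i + (n.-1 - i) = n.-1)%N by lia.
  move=> /(_ n0); lia.
pose kap := shape (fun i : 'I_n => nth 0%N lam i - (n - i))%N.
have nkap i : nth 0%N kap i = (nth 0%N lam i - (n - i))%N.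
  rewrite (@nth_shape_dec n (fun i => nth 0%N lam i - (n - i))%N).
    by case: ltnP => // le; rewrite nth_default // (leq_trans sz).
  move=> j k jk; have [ltk|lek] := ltnP k n; last first.
    by rewrite nth_default // (leq_trans sz).
  have := step (k - j)%N j; rewrite subnKC // => /(_ ltk).
  have := lb k ltk; lia.
have szk : (size kap <= n)%N by apply: size_shape.
have Elam : expo n lam = rho + expo n kap.
  apply/ffunP => i; rewrite !ffunE nkap -PoszD subnKC //; exact: lb.
have psk k : (k <= n)%N -> (psum kap k + psum_rho k)%N = psum lam k.
  move=> kn; rewrite /psum /psum_rho -big_split; apply: eq_bigr => i _ /=.
  by rewrite nkap subnK // lb // (leq_trans (ltn_ord i)).
have hk k : (k <= n)%N -> (psum kap k <= h k)%N.
  move=> kn; rewrite -(leq_add2r (psum_rho k)) psk //.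
  have := @dom_shape n (absv e) (fun k => h k + psum_rho k)%N k.
  by rewrite -/lam (minn_idPl kn); apply => B; apply: He.
have kD : kap \in D by apply: HD.
have bnd (B : {set 'I_n}) : (#|B| <= n)%N by rewrite -[n in (_ <= n)%N]card_ord max_card.
pose r := [seq (1 : K, e') | e' <- orbit_seq n kap].
have Er x : torus x -> mfun kap x * alt rho x = \sum_(e' <- orbit_seq n kap) alt (rho + e') x.
  move=> tx; rewrite (@alt_mul _ rho x r (@mfun_sym K n kap) tx).
    by rewrite big_map; apply: eq_bigr => e' _; rewrite mul1r.
  by move=> y _; rewrite mfunE big_map; apply: eq_bigr => e' _; rewrite mul1r.
apply: (@adiv_ext _ (fun x => mfun kap x * alt rho x +
   (-1) * \sum_(e' <- [seq e' <- orbit_seq n kap | e' != expo n kap]) alt (rho + e') x)).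
  move=> x tx; rewrite Er // (bigD1_seq (expo n kap)) ?orbit_uniq ?mem_expo //=.
  by rewrite big_filter Elam mulN1r addrK.
apply: adivD.
  by exists (mfun kap); [apply: span_mfun | move=> x _; rewrite mulrC].
apply/adivZ/adiv_sum => e'; rewrite mem_filter mem_orbit // => /andP[ne /eqP Ee'].
apply: IH.
  apply: leq_trans (norm2_rho_lt szk Ee' ne) _.
  by rewrite -Elam -(norm2_shape sz (erefl lam)).
move=> B; apply: (@leq_trans (\sum_(i in B) (n - i) + \sum_(i in B) absv e' i)%N).
  rewrite -big_split; apply: leq_sum => i _; rewrite /absv !ffunE /=.
  move: (e' i) => a; lia.
rewrite addnC leq_add ?psum_rho_bound //.
apply: leq_trans (hk _ (bnd B)).
by rewrite -Ee'; apply: shape_bound.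
Qed.

Definition antisym (f : ('I_n -> K) -> K) x := \sum_(g : bcg) bsgn g * f (act g x).

Theorem antisym_div (h : nat -> nat) D f : uniq D ->
  (forall mu, (size mu <= n)%N -> (forall k, (k <= n)%N -> (psum mu k <= h k)%N) -> mu \in D) ->
  lsupp (subset_bound (fun B : {set 'I_n} => h #|B| + psum_rho #|B|)%N) f -> adiv D (antisym f).
Proof.
move=> uD HD [r [Ar Er]].
apply: (@adiv_ext _ (fun x => \sum_(p <- r) p.1 * alt p.2 x)).
  move=> x tx; rewrite /antisym.
  under [RHS]eq_bigr => g _ do rewrite (Er _ (torus_act g tx)) mulr_sumr.
  rewrite exchange_big; apply: eq_bigr => p _; rewrite altE mulr_sumr.
  by apply: eq_bigr => g _; rewrite mulrCA.
by apply: adiv_sum => p pr; apply: adivZ; apply: (alt_div uD HD); apply: Ar.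
Qed.

End Alternants.

(** * Non-vanishing of the Weyl denominator *)

Section PairProducts.
Variables (K : fieldType) (n : nat).
Hypothesis char0 : forall k, (k%:R == 0 :> K) = (k == 0%N).

Definition pairprod (psi : 'I_n -> 'I_n -> K) := \prod_(i < n) \prod_(j < n | (i < j)%N) psi i j.

Lemma pairprod_sym (psi : 'I_n -> 'I_n -> K) (s : 'S_n) :
  (forall i j, psi i j = psi j i) ->
  pairprod (fun i j => psi (s i) (s j)) = pairprod psi.
Proof.
move=> sy; rewrite /pairprod !pair_big_dep /=.
pose srt (p : 'I_n * 'I_n) := if (p.1 < p.2)%N then p else (p.2, p.1).
pose F (r : 'S_n) (p : 'I_n * 'I_n) := srt (r p.1, r p.2).
have srtP (p : 'I_n * 'I_n) : p.1 != p.2 -> ((srt p).1 < (srt p).2)%N.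
  move=> ne; rewrite /srt; case: ifP => //= /negbT; rewrite -leqNgt leq_eqVlt.
  by rewrite (inj_eq val_inj) eq_sym (negPf ne).
have FP r (p : 'I_n * 'I_n) : (p.1 < p.2)%N -> ((F r p).1 < (F r p).2)%N.
  by move=> lt; apply: srtP => /=; rewrite (inj_eq perm_inj) neq_ltn lt.
have FK (r : 'S_n) (p : 'I_n * 'I_n) : (p.1 < p.2)%N -> F (r^-1)%g (F r p) = p.
  move=> lt; rewrite /F /srt /=; case: (r p.1 < r p.2)%N; rewrite /= !permK.
    by rewrite lt; case: p {lt}.
  by rewrite ltnNge (ltnW lt) /=; case: p {lt}.
rewrite [RHS](reindex_onto (F s) (F (s^-1)%g)) /=; last first.
  by move=> p lt; rewrite -{1}[s]invgK FK.
apply: eq_big => [p|p lt].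
  apply/idP/andP => [lt|[lt /eqP E]].
    by rewrite FP // FK.
  by rewrite -E FP.
by rewrite /F /srt /=; case: ifP.
Qed.

(** The sign that arises from reordering the pairs does not depend on psi; the
    Vandermonde determinant identifies it as the signature. *)
Lemma pairprod_antisym (psi : 'I_n -> 'I_n -> K) (s : 'S_n) :
  (forall i j, psi j i = - psi i j) ->
  pairprod (fun i j => psi (s i) (s j)) = (-1) ^+ s * pairprod psi.
Proof.
pose sg (i j : 'I_n) : K := if (s i < s j)%N then 1 else -1.
have main (ph : 'I_n -> 'I_n -> K) : (forall i j, ph j i = - ph i j) ->
   pairprod (fun i j => ph (s i) (s j)) = pairprod sg * pairprod ph.
  move=> asy; pose ps (i j : 'I_n) := if (i < j)%N then ph i j else ph j i.
  have -> : pairprod ph = pairprod ps.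
    by apply: eq_bigr => i _; apply: eq_bigr => j lt; rewrite /ps lt.
  rewrite -(@pairprod_sym ps s); last first.
    by move=> i j; rewrite /ps; case: ltngtP => // /val_inj ->.
  rewrite /pairprod -big_split; apply: eq_bigr => i _ /=.
  rewrite -big_split; apply: eq_bigr => j lt /=; rewrite /sg /ps.
  by case: ifP => _; rewrite ?mul1r // mulN1r asy.
move=> asy; rewrite main //; congr (_ * _).
pose a : 'rV[K]_n := \row_i i%:R.
have V0 : pairprod (fun i j => a 0 j - a 0 i) != 0.
  apply/prodf_neq0 => i _; apply/prodf_neq0 => j lt; rewrite !mxE.
  by rewrite -natrB 1?ltnW // char0 subn_eq0 -ltnNge.
apply: (mulIf V0); rewrite -main; last by move=> i j; rewrite opprB.
rewrite /pairprod -(det_Vandermonde a).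
transitivity (\det (Vandermonde n (\row_i a 0 (s i)))).
  rewrite det_Vandermonde; apply: eq_bigr => i _; apply: eq_bigr => j _.
  by rewrite !mxE.
have -> : Vandermonde n (\row_i a 0 (s i)) = col_perm s (Vandermonde n a).
  by apply/matrixP => i j; rewrite !mxE.
rewrite col_permE det_mulmx det_perm odd_permV mulrC; congr (_ * _).
Qed.

(** The ordered pairs that meet B are counted through those that avoid it. *)
Lemma pair_count (B : {set 'I_n}) :
  (\sum_(i < n) (if i \in B then 1 else 0) +
   \sum_(i < n) \sum_(j < n | i < j) (if (i \in B) || (j \in B) then 1 else 0)
   <= psum_rho n #|B|)%N.
Proof.
pose w (i j : 'I_n) := (if (i \in B) || (j \in B) then 1 else 0)%N.
set T := (\sum_(i < n) \sum_(j < n | i < j) _)%N.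
have bn : (#|B| <= n)%N by rewrite -[n in (_ <= n)%N]card_ord max_card.
have S1 : (\sum_(i < n) (if i \in B then 1 else 0) = #|B|)%N.
  by rewrite -big_mkcond /= sum1_card.
have S2 : (\sum_(i < n) \sum_(j < n) w i j = #|B| + 2 * T)%N.
  have T' : (\sum_(i < n) \sum_(j < n | j < i) w i j = T)%N.
    rewrite (exchange_big_dep predT) //=; apply: eq_bigr => i _.
    by apply: eq_bigr => j _; rewrite /w orbC.
  rewrite -S1 mul2n -addnn -{2}T' addnA -!big_split /=; apply: eq_bigr => i _.
  rewrite (bigD1 i) //= {1}/w orbb -addnA; congr addn.
  rewrite (bigID (fun j : 'I_n => i < j)%N) /=; congr addn.
    by apply: eq_bigl => j; case: ltngtP => h; rewrite ?andbF ?andbT //; apply/eqP => E; rewrite E ltnn in h.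
  apply: eq_bigl => j; case: ltngtP => h; rewrite ?andbF ?andbT //.
    by apply/eqP => E; rewrite E ltnn in h.
  by rewrite (val_inj h) eqxx.
have S3 : (\sum_(i < n) \sum_(j < n) w i j + (n - #|B|) * (n - #|B|) = n * n)%N.
  have cC : #|~: B| = (n - #|B|)%N by rewrite cardsCs setCK card_ord.
  have -> : ((n - #|B|) * (n - #|B|) =
     \sum_(i < n) \sum_(j < n) (if i \in ~: B then 1 else 0) * (if j \in ~: B then 1 else 0))%N.
    under eq_bigr do rewrite -big_distrr /= -big_mkcond sum1_card cC.
    by rewrite -big_distrl /= -big_mkcond sum1_card cC.
  rewrite -big_split /=; under eq_bigr do rewrite -big_split /=.
  rewrite -[in RHS](card_ord n) -sum_nat_const; apply: eq_bigr => i _.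
  rewrite -sum1_card; apply: eq_bigr => j _; rewrite /w !inE.
  by case: (i \in B); case: (j \in B).
have S4 b : (b <= n)%N -> (2 * psum_rho n b + b * b = 2 * n * b + b)%N.
  elim: b => [|b IH] lt; first by rewrite /psum_rho big_ord0 !muln0.
  have := IH (ltnW lt); rewrite /psum_rho big_ord_recr /= => IHb.
  nia.
have := S4 _ bn; rewrite S1; nia.
Qed.

(** One factor of degree 1 for each index and each pair is exactly what the Weyl
    denominator takes away. *)
Lemma pairprod_supp (h : nat -> nat) (F : 'I_n -> ('I_n -> K) -> K)
    (G : 'I_n -> 'I_n -> ('I_n -> K) -> K) f :
  (forall i, lsupp (subset_bound (fun B : {set 'I_n} => if i \in B then 1 else 0)%N) (F i)) ->
  (forall i j, lsupp (subset_bound (fun B : {set 'I_n} => if (i \in B) || (j \in B) then 1 else 0)%N) (G i j)) ->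
  lsupp (subset_bound (fun B : {set 'I_n} => h #|B|)) f ->
  lsupp (subset_bound (fun B : {set 'I_n} => h #|B| + psum_rho n #|B|)%N)
    (fun x => (\prod_i F i x) * pairprod (fun i j => G i j x) * f x).
Proof.
move=> HF HG Hf.
apply: (@lsuppMw _ _ (fun B : {set 'I_n} => psum_rho n #|B|) (fun B : {set 'I_n} => h #|B|)) Hf.
  by move=> B; rewrite addnC.
apply: lsuppMw; last first.
- apply: lsupp_prod => i _; apply: lsupp_prod => j _; exact: HG.
- apply: lsupp_prod => i _; exact: HF.
by move=> B; apply: pair_count.
Qed.

Lemma lsupp_pair1 (i j : 'I_n) (a : K) (k : int) : (absz k <= 1)%N ->
  lsupp (subset_bound (fun B : {set 'I_n} => if (i \in B) || (j \in B) then 1 else 0)%N) (fun x => a * x i ^ k).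
Proof.
move=> k1; apply: lsupp_sub (lsupp_var i a k1) => e He B.
by apply: leq_trans (He B) _; case: (i \in B).
Qed.

Lemma lsupp_pair2 (i j : 'I_n) (a : K) (k : int) : (absz k <= 1)%N ->
  lsupp (subset_bound (fun B : {set 'I_n} => if (i \in B) || (j \in B) then 1 else 0)%N) (fun x => a * x j ^ k).
Proof.
move=> k1; apply: lsupp_sub (lsupp_pair1 j i a k1) => e He B.
by apply: leq_trans (He B) _; rewrite orbC.
Qed.

(** The Weyl denominator in factored form. *)
Definition delta (x : 'I_n -> K) : K :=
  (\prod_i (x i - (x i)^-1)) * pairprod (fun i j => ydiff (x i) (x j)).

Lemma ydiff_sym (a b : K) : ydiff b a = - ydiff a b.
Proof. by rewrite /ydiff opprB. Qed.

Lemma delta_act g x : delta (act g x) = bsgn K g * delta x.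
Proof.
case: g => s eps; rewrite /bsgn /delta.
have -> : pairprod (fun i j => ydiff (act (s, eps) x i) (act (s, eps) x j)) =
    (-1) ^+ s * pairprod (fun i j => ydiff (x i) (x j)).
  pose ps (i j : 'I_n) := ydiff (x i) (x j).
  transitivity (pairprod (fun i j => ps ((s^-1 : 'S_n)%g i) ((s^-1 : 'S_n)%g j))).
    apply: eq_bigr => i _; apply: eq_bigr => j _; rewrite /act /flip /ps /=.
    have E (b : bool) (y : K) : (if b then y^-1 else y) + (if b then y^-1 else y)^-1 = y + y^-1.
      by case: b; rewrite ?invrK 1?addrC.
    by rewrite /ydiff !E.
  rewrite pairprod_antisym ?odd_permV // => i j; exact: ydiff_sym.
have -> : \prod_i (act (s, eps) x i - (act (s, eps) x i)^-1) =
    \prod_i (-1) ^+ eps i * \prod_i (x i - (x i)^-1).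
  rewrite (reindex_inj (@perm_inj _ s)) -big_split; apply: eq_bigr => i _.
  rewrite /act /= permK /flip; case: (eps i); rewrite ?mul1r //.
  by rewrite expr1 mulN1r opprB invrK.
by rewrite mulrACA [X in X * _]mulrC.
Qed.

(** As delta is antisymmetric, it is its own antisymmetrization up to the order of
    the group. By degree the quotient by alt rho is constant, so alt rho is nonzero
    wherever delta is. *)
Lemma alt_rho_neq0 (x : 'I_n -> K) : torus x -> (forall i, x i - (x i)^-1 != 0) ->
  (forall i j, i != j -> ydiff (x i) (x j) != 0) -> alt (@rho n) x != 0.
Proof.
move=> tx H1 H2.
have d0 : delta x != 0.
  rewrite mulf_neq0 //; first exact/prodf_neq0.
  apply/prodf_neq0 => i _; apply/prodf_neq0 => j lt; apply: H2.
  by apply: contraTneq lt => ->; rewrite ltnn.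
have [|||F sF EF] := @antisym_div K n char0 (fun=> 0%N) [:: nilp] delta.
- by [].
- move=> mu sz H; rewrite inE; apply/eqP/intpart_eq => i; rewrite nth_nilp.
  have := H n (leqnn n); rewrite psum_over // leqn0 => /eqP s0.
  by have := nth_le_sumn mu i; rewrite s0 leqn0 => /eqP.
- apply: (@lsupp_ext _ _ _ (fun x => (\prod_i (x i - (x i)^-1)) *
     pairprod (fun i j => ydiff (x i) (x j)) * 1)).
    by move=> y _; rewrite mulr1.
  apply: (@pairprod_supp (fun=> 0%N) (fun i x => x i - (x i)^-1)
    (fun i j x => ydiff (x i) (x j)) (fun=> 1)) => [i|i j|]; last exact: lsupp1.
    apply: (@lsupp_ext _ _ _ (fun x => 1 * x i ^ 1 + (-1) * x i ^ (-1))).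
      by move=> y _; rewrite mul1r mulN1r expr1z exprN1.
    by apply: lsuppD; apply: lsupp_var.
  apply: (@lsupp_ext _ _ _ (fun x => (1 * x i ^ 1 + 1 * x i ^ (-1)) +
     ((-1) * x j ^ 1 + (-1) * x j ^ (-1)))).
    by move=> y _; rewrite !mul1r !mulN1r !expr1z !exprN1 /ydiff opprD.
  by apply: lsuppD; apply: lsuppD; (apply: lsupp_pair1 || apply: lsupp_pair2).
apply/negP => /eqP a0; have := EF x tx; rewrite a0 mul0r /antisym.
under eq_bigr => g _ do rewrite delta_act mulrA bsgn_sqr mul1r.
rewrite sumr_const -mulr_natl => /eqP; rewrite mulf_eq0 (negPf d0) orbF char0.
by rewrite eqn0Ngt => /negP; apply; apply/card_gt0P; exists (1%g, [ffun=> false]).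
Qed.

End PairProducts.

(** * A difference operator in type BC *)

Section Operator.
Variables (K : fieldType) (n : nat).
Hypothesis char0 : forall k, (k%:R == 0 :> K) = (k == 0%N).
Variables (q t s v : K).
Hypothesis gen : generic q t s.
Hypothesis v2 : v ^+ 2 = q.
Implicit Types (x : 'I_n -> K) (lam mu nu kap : intpart).
Implicit Types (eps : {ffun 'I_n -> bool}).

Let s0 := s / v.

Lemma v_neq0 : v != 0.
Proof. by case: gen => q0 _ _ _; move: q0; rewrite -v2 expf_eq0. Qed.

Lemma generic_half : generic q t s0.
Proof.
case: (gen) => q0 t0 sn0 H; split=> //; first by rewrite mulf_neq0 ?invr_eq0 ?v_neq0.
move=> a b c E.
have E2 (y : K) (k : int) : y ^ (2 * k) = (y ^ k) ^+ 2 by rewrite mulrC -exprz_exp.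
have : q ^ (2 * a - c) * t ^ (2 * b) * s ^ (2 * c) = 1.
  rewrite -[RHS](expr1n _ 2) -[X in X ^+ 2]E /s0 expfzMl exprz_inv.
  have Eq : q ^ (- c) = (v ^ (- c)) ^+ 2 by rewrite -E2 -v2 -exprz_exp.
  rewrite expfzDr // Eq !E2.
  move: (q ^ a) (t ^ b) (s ^ c) (v ^ (- c)) => A B C D; ring.
move/H => [h1 h2 h3]; have c0 : c = 0 by lia.
split=> //; lia.
Qed.

Variable u : K.
Definition theta (y : K) := (1 - s0 * y) * (1 - u * y) * y^-1.
Definition chi (a b : K) := (1 - t * a * b) * (a^-1 - b^-1).
(** The operator is f -> antisym (diff_term f) / alt rho. The zeros of theta at
    1/s0 and of chi at a b = 1/t remove, at the points of partitions, all terms of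
    the antisymmetrization that do not lead to partitions again; the zero of theta
    at 1/u is free. *)
Definition diff_term (f : ('I_n -> K) -> K) x :=
  (\prod_i theta (x i)) * pairprod (fun i j => chi (x i) (x j)) * f (fun i => v * x i).

Lemma diff_term_supp lam : (size lam <= n)%N ->
  lsupp (subset_bound (fun B : {set 'I_n} => psum lam #|B| + psum_rho n #|B|)%N) (diff_term (Pstar q t s lam)).
Proof.
move=> sz.
apply: (@pairprod_supp K n (psum lam) (fun i x => theta (x i)) (fun i j x => chi (x i) (x j))
   (fun x => Pstar q t s lam (fun i => v * x i))) => [i|i j|].
- apply: (@lsupp_ext _ _ _ (fun x => (1 * x i ^ (-1) + (- (s0 + u)) * x i ^ 0) + (s0 * u) * x i ^ 1)).
    move=> x tx; rewrite exprN1 expr0z expr1z /theta; field; exact: tx.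
  by apply: lsuppD; [apply: lsuppD|]; apply: lsupp_var.
- apply: (@lsupp_ext _ _ _ (fun x => (1 * x i ^ (-1) + (-1) * x j ^ (-1)) +
     (t * x i ^ 1 + (- t) * x j ^ 1))).
    move=> x tx; rewrite !exprN1 !expr1z /chi; field; by rewrite !tx.
  by apply: lsuppD; apply: lsuppD; (apply: lsupp_pair1 || apply: lsupp_pair2).
apply: lsupp_scale; first by move=> i; apply: v_neq0.
apply: lsupp_sub (lsupp_span _ (Pstar_span char0 gen sz)).
  by move=> e /mem_Dle[_ /shape_domP].
by move=> mu /mem_Dle[].
Qed.

Lemma diff_term_div lam : (size lam <= n)%N -> adiv (Dle n lam) (antisym (diff_term (Pstar q t s lam))).
Proof.
move=> sz; apply: (antisym_div char0 (h := psum lam)); last exact: diff_term_supp.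
  exact: Dle_uniq.
move=> mu szm H; apply/mem_Dle; split=> //; apply/domP => k.
have [kn|/ltnW nk] := leqP k n; first exact: H.
rewrite psum_over ?(leq_trans szm) // psum_over ?(leq_trans sz) //.
by have := H n (leqnn n); rewrite !psum_over.
Qed.

Lemma Pstar_bcsym lam : (size lam <= n)%N -> bcsym (Pstar (n := n) q t s lam).
Proof.
move=> sz x tx g; have [c Ec] := Pstar_span char0 gen sz.
rewrite !Ec //; last by move=> i; apply: torus_flip.
by apply: eq_bigr => mu _; rewrite mfun_sym.
Qed.

(** The factors chi change sign like differences, and f is symmetric. *)
Lemma diff_term_perm lam x (p : 'S_n) : (size lam <= n)%N -> torus x ->
  diff_term (Pstar q t s lam) (fun i => x (p i)) = (-1) ^+ p * diff_term (Pstar q t s lam) x.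
Proof.
move=> sz tx; rewrite /diff_term.
have -> : Pstar q t s lam (fun i => v * x (p i)) = Pstar q t s lam (fun i => v * x i).
  apply: (@bcsym_perm _ _ _ (Pstar_bcsym sz) _ (fun i => v * x i)).
    by move=> y z; apply: Pstar_eq.
  by move=> i; rewrite mulf_neq0 // v_neq0.
have -> : \prod_i theta (x (p i)) = \prod_i theta (x i).
  by rewrite [RHS](reindex_inj (@perm_inj _ p)).
rewrite (@pairprod_antisym _ _ char0 (fun i j => chi (x i) (x j))).
  by rewrite [X in X * _ = _]mulrCA [RHS]mulrA.
by move=> i j; rewrite /chi -[RHS]mulrN opprB [t * x j * x i]mulrAC.
Qed.

(** Permutations only contribute a factor n!, by [diff_term_perm]. *)
Lemma antisym_diff_term lam x : (size lam <= n)%N -> torus x ->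
  antisym (diff_term (Pstar q t s lam)) x =
  (n`!)%:R * \sum_(eps : {ffun 'I_n -> bool}) (\prod_i (-1) ^+ eps i) * diff_term (Pstar q t s lam) (flip eps x).
Proof.
move=> sz tx; rewrite /antisym.
rewrite -(pair_big predT predT (fun (p : 'S_n) eps =>
   bsgn K (p, eps) * diff_term (Pstar q t s lam) (act (p, eps) x))) /=.
rewrite (eq_bigr (fun=> \sum_(eps : {ffun 'I_n -> bool}) (\prod_i (-1) ^+ eps i) * diff_term (Pstar q t s lam) (flip eps x))).
  by rewrite sumr_const card_Sn mulr_natl.
move=> p _; apply: eq_bigr => eps _.
rewrite /act /= diff_term_perm //; last exact: torus_flip.
rewrite /bsgn /= odd_permV.
by rewrite mulrACA -expr2 sqrr_sign mul1r.
Qed.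

End Operator.

(** * Vanishing outside inclusion *)

Section VanishHalf.
Variables (K : fieldType) (n : nat).
Hypothesis char0 : forall k, (k%:R == 0 :> K) = (k == 0%N).
Variables (q t s v : K).
Hypothesis gen : generic q t s.
Hypothesis v2 : v ^+ 2 = q.
Implicit Types (x : 'I_n -> K) (lam mu nu kap : intpart).
Implicit Types (eps : {ffun 'I_n -> bool}).

Let s0 := s / v.
Let v0 := v_neq0 gen v2.
Let gen0 : generic q t s0 := generic_half gen v2.

Lemma scale_point nu (i : 'I_n) : v * point q t s0 nu i = point q t s nu i.
Proof. by rewrite /point /s0 mulrCA; congr (_ * _); rewrite mulrC divfK. Qed.

(** Inverting x_i and scaling by v has the effect of lowering part i by 1, up to the
    symmetry of f. If part i is the last possible one and is 0, theta vanishes;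
    if parts i and i+1 are equal and only x_i is inverted, chi vanishes. In the
    remaining cases the lowered parts form a partition. *)
Lemma diff_term_neq0 u lam nu eps : (size lam <= n)%N -> (size nu <= n)%N ->
  diff_term t s v u (Pstar q t s lam) (flip eps (point q t s0 nu)) != 0 ->
  exists kap, [/\ (size kap <= n)%N,
    forall i : 'I_n, nth 0%N kap i = (nth 0%N nu i - eps i)%N,
    forall i : 'I_n, eps i -> (0 < nth 0%N nu i)%N &
    Pstar q t s lam (point (n := n) q t s kap) != 0].
Proof.
case: (gen) => q0 t0 sn0 _ szl szn.
have s00 : s0 != 0 by case: gen0.
have tp : torus (point (n := n) q t s0 nu) by apply: torus_point.
rewrite /diff_term !mulf_eq0 !negb_or => /andP[/andP[/prodf_neq0 th /prodf_neq0 ch] fne].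
have E1 (i : 'I_n) : i.+1 = n -> eps i -> (0 < nth 0%N nu i)%N.
  move=> iN ei; rewrite lt0n; apply/negP => /eqP nui.
  have := th i isT; rewrite /theta /flip ei /point nui iN subnn !expr0 !mul1r.
  by rewrite -/s0 divff // subrr !mul0r eqxx.
have E2 (i j : 'I_n) : j = i.+1 :> nat -> eps i -> ~~ eps j -> (nth 0%N nu j < nth 0%N nu i)%N.
  move=> ji ei ej; rewrite ltn_neqAle intpart_nth ?ji // andbT -ji.
  apply/negP => /eqP E.
  have := ch i isT => /prodf_neq0/(_ j); rewrite ji ltnSn => /(_ isT).
  rewrite /chi /flip ei (negPf ej) /point E ji.
  have -> : (n - i.+1 = (n - i.+2).+1)%N by have := ltn_ord j; rewrite ji; lia.
  rewrite (_ : 1 - _ = 0) ?mul0r ?eqxx // exprS; field.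
  by rewrite s00 t0 !expf_neq0.
(* The flips extended by 0, so that the lowered parts are a function on nat. *)
pose en (i : nat) : nat := if insub i is Some j then eps (j : 'I_n) else false.
have enE (i : 'I_n) : en i = eps i by rewrite /en valK.
have en0 i : (n <= i)%N -> en i = 0%N by move=> h; rewrite /en insubF // ltnNge h.
have posD d (i : 'I_n) : (n - i.+1 = d)%N -> eps i -> (0 < nth 0%N nu i)%N.
  elim: d i => [|d IH] i Ed ei.
    by apply: E1 => //; have := ltn_ord i; lia.
  have lti : (i.+1 < n)%N by lia.
  have [ej|ej] := boolP (eps (Ordinal lti)).
    apply: (@leq_trans (nth 0%N nu i.+1)); first by apply: (IH (Ordinal lti)) => //=; lia.
    exact: intpart_nth.
  by apply: leq_ltn_trans (@E2 i (Ordinal lti) _ ei ej).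
have pos (i : 'I_n) : eps i -> (0 < nth 0%N nu i)%N by apply: (posD (n - i.+1)%N).
pose a i := (nth 0%N nu i - en i)%N.
have decS i : (a i.+1 <= a i)%N.
  rewrite /a; have [lti|lei] := ltnP i.+1 n; last first.
    by rewrite (@nth_default _ _ _ i.+1) // (leq_trans szn).
  have Ei := enE (Ordinal (ltnW lti)); have Ej := enE (Ordinal lti).
  rewrite /= in Ei Ej; rewrite Ei Ej.
  have le := intpart_nth nu (leqnSn i).
  case ei : (eps (Ordinal (ltnW lti))); case ej : (eps (Ordinal lti)) => /=.
  - exact: leq_sub2r.
  - rewrite subn0 subn1 -ltnS prednK.
      by have := @E2 (Ordinal (ltnW lti)) (Ordinal lti) erefl; rewrite ei ej; apply.
    exact: (pos (Ordinal (ltnW lti)) ei).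
  - by rewrite subn0 (leq_trans (leq_subr _ _)).
  by rewrite !subn0.
have dec i j : (i <= j)%N -> (a j <= a i)%N.
  move=> /subnKC <-; elim: (j - i)%N => [|d IH]; first by rewrite addn0.
  by rewrite addnS; apply: leq_trans (decS _) IH.
exists (shape (fun i : 'I_n => a i)); split=> //.
- exact: size_shape.
- by move=> i; rewrite (nth_shape_dec n i dec) ltn_ord /a enE.
apply: contraNneq fne => E0; apply/eqP; rewrite -[RHS]E0.
have tk : torus (point (n := n) q t s (shape (fun i : 'I_n => a i))) by apply: torus_point.
rewrite -[RHS](Pstar_bcsym char0 gen szl tk (1%g, eps)).
apply: Pstar_eq => i; rewrite invg1 perm1 /flip /=.
case ei : (eps i); last first.
  rewrite scale_point /point (nth_shape_dec n i dec) ltn_ord /a enE ei.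
  by rewrite subn0.
rewrite /point (nth_shape_dec n i dec) ltn_ord /a enE ei /=.
have := pos i ei; case: (nth 0%N nu i) => // k _; rewrite subn1 /= exprS /s0 -v2.
by field; rewrite sn0 v0 !expf_neq0.
Qed.

(** Choose a row k where lam exceeds mu, and let u be the inverse of the k-th
    coordinate of the point of lam. At the point of a nu dominated by lam each term
    leads to some kap contained in nu; it vanishes by definition of f unless
    kap = nu = lam, and then by the choice of u. So the result of the operator is
    zero. At mu the terms with some variable inverted vanish by induction on |mu|,
    and the coefficient of the remaining term f(mu) is not zero. *)
Theorem vanish_of_sqrt lam mu : (size lam <= n)%N -> (size mu <= n)%N ->
  ~ incl lam mu -> Pstar q t s lam (point (n := n) q t s mu) = 0.
Proof.
case: (gen) => q0 t0 sn0 Hg szl.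
have s00 : s0 != 0 by case: gen0.
elim: {mu}_.+1 {-2}mu (ltnSn (sumn mu)) => // N IH mu leN szm ninc.
have [k ltk] : exists k : 'I_n, (nth 0%N mu k < nth 0%N lam k)%N.
  apply: contrapT => H; apply: ninc => i; rewrite leqNgt; apply/negP => lt.
  have lti : (i < n)%N by apply: leq_trans szl; rewrite -nth_gt0 (leq_ltn_trans _ lt).
  by apply: H; exists (Ordinal lti).
pose u := (point q t s0 lam k)^-1.
have tp nu : torus (point (n := n) q t s0 nu) by apply: torus_point.
have a0 nu : alt (rho n) (point (n := n) q t s0 nu) != 0.
  apply: alt_rho_neq0 => //.
    move=> i; rewrite subr_eq0; apply/negP => /eqP E.
    have := generic_neq (a := nth 0%N nu i) (b := (n - i.+1)%N) (c := 1)
       (a' := - (nth 0%N nu i)%:Z) (b' := - (n - i.+1)%N%:Z) (c' := -1) gen0.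
    rewrite orbT => /(_ isT) /negP; apply; apply/eqP.
    rewrite -!invr_expz -!invfM expr1z; exact: E.
  move=> i j ij; rewrite !pointE !expr1z; apply: ydiff_generic gen0 _.
  apply/orP; right; apply: contra ij => /eqP[E]; apply/eqP/val_inj => /=.
  by have := ltn_ord i; have := ltn_ord j; lia.
have [F sF EF] := diff_term_div char0 gen v2 u szl.
have zero x : torus x -> F x = 0.
  apply: (span_unique char0 (lower_Dle n lam) gen0 sF) => nu /mem_Dle[sznu dnu].
  apply: (mulfI (a0 nu)); rewrite -EF // mulr0 antisym_diff_term // big1 ?mulr0 // => eps _.
  apply/eqP; rewrite mulf_eq0; apply/orP; right; apply/negP => /negP ne.
  have [kap [szk Ek pos fne]] := diff_term_neq0 szl sznu ne.
  have dk : dom kap nu.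
    apply/domP => j; apply: leq_sum => i _; have [lt|le] := ltnP i n.
      by rewrite (Ek (Ordinal lt)) leq_subr.
    by rewrite nth_default // (leq_trans szk).
  have kl : kap = lam.
    apply/eqP; apply: contraNT fne => nkl; apply/eqP; apply: Pstar_vanish_lt => //.
    apply/mem_Dlt; split=> //; split=> //; exact: dom_trans dk dnu.
  have nl : nu = lam by apply: dom_anti => //; rewrite -kl.
  have ek : eps k = false.
    case ek : (eps k) => //; have := pos k ek; have := Ek k.
    rewrite ek kl nl subn1; case: (nth 0%N lam k) => // j /eqP.
    by rewrite /= eqn_leq ltnn.
  move: ne; rewrite /diff_term (bigD1 k) //= {1}/theta /flip ek nl /u.
  by rewrite mulVf ?subrr ?mulr0 ?mul0r ?eqxx //; apply: tp.
have : antisym (diff_term t s v u (Pstar q t s lam)) (point (n := n) q t s0 mu) = 0.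
  by rewrite EF // zero // mulr0.
rewrite antisym_diff_term //; move/eqP; rewrite mulf_eq0 char0 -[_ == 0%N]negbK -lt0n fact_gt0 /=.
rewrite (bigD1 ([ffun=> false] : {ffun 'I_n -> bool})) //= [X in _ + X]big1 ?addr0 => [|eps ne]; last first.
  apply/eqP; rewrite mulf_eq0; apply/orP; right; apply/negP => /negP nz.
  have [kap [szk Ek pos /negP[]]] := diff_term_neq0 szl szm nz; apply/eqP.
  have ik : incl kap mu.
    move=> i; have [lt|le] := ltnP i n; last by rewrite nth_default // (leq_trans szk).
    by rewrite (Ek (Ordinal lt)) leq_subr.
  apply: IH => //; last first.
    by move=> il; apply: ninc => i; apply: leq_trans (il i) (ik i).
  have [i0 ei0] : exists i, eps i.
    apply/existsP; apply: contraNT ne => /existsPn H; apply/eqP/ffunP => i.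
    by rewrite ffunE; apply/negbTE.
  rewrite -ltnS; apply: leq_trans leN.
  rewrite -(psum_over szk) -(psum_over szm) /psum (bigD1 i0) //= [X in (_ < X.+1)%N](bigD1 i0) //=.
  rewrite ltnS -addSn leq_add //; first by rewrite Ek ei0; have := pos _ ei0; lia.
  by apply: leq_sum => i _; apply: ik.
rewrite mulf_eq0 => /orP[/eqP|].
  rewrite big1 => [/eqP|i _]; first by rewrite oner_eq0.
  by rewrite ffunE.
have -> : diff_term t s v u (Pstar q t s lam) (flip ([ffun=> false] : {ffun 'I_n -> bool}) (point (n := n) q t s0 mu)) =
   (\prod_i theta s v u (point (n := n) q t s0 mu i)) *
   pairprod (fun i j : 'I_n => chi t (point q t s0 mu i) (point q t s0 mu j)) *
   Pstar q t s lam (point (n := n) q t s mu).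
  rewrite /diff_term; congr (_ * _ * _).
  - by apply: eq_bigr => i _; rewrite /flip ffunE.
  - by apply: eq_bigr => i _; apply: eq_bigr => j _; rewrite /flip !ffunE.
  by apply: Pstar_eq => i; rewrite /flip ffunE scale_point.
rewrite -mulrA mulf_eq0 => /orP[/prodf_eq0[i _]|].
  rewrite /theta -/s0 !mulf_eq0 invr_eq0 (negPf (tp _ _)) orbF => /orP[|].
    rewrite subr_eq0 eq_sym => /eqP E.
    have := generic_neq (a := nth 0%N mu i) (b := (n - i.+1)%N) (c := 2)
       (a' := 0) (b' := 0) (c' := 0) gen0.
    rewrite !orbT => /(_ isT) /negP[]; apply/eqP; rewrite !expr0z !mulr1 -[RHS]E /point.
    by rewrite -!exprnP expr2; ring.
  rewrite subr_eq0 => /eqP E.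
  have E' : point q t s0 lam k = point q t s0 mu i.
    by apply: (mulfI (invr_neq0 (tp lam k))); rewrite mulVf -/u ?E //; apply: tp.
  have := generic_neq (a := nth 0%N lam k) (b := (n - k.+1)%N) (c := 1)
       (a' := nth 0%N mu i) (b' := (n - i.+1)%N) (c' := 1) gen0.
  have D : (nth 0%N lam k != nth 0%N mu i :> int) || ((n - k.+1)%N != (n - i.+1)%N :> int).
    rewrite -negb_and; apply/negP => /andP[/eqP[Ea] /eqP[Eb]].
    have ki : k = i by apply: val_inj; have := ltn_ord k; have := ltn_ord i; rewrite /=; lia.
    by move: ltk; rewrite Ea ki ltnn.
  rewrite D => /(_ isT) /negP[]; apply/eqP; rewrite expr1z; exact: E'.
rewrite mulf_eq0 => /orP[/prodf_eq0[i _ /prodf_eq0[j lt]]|/eqP //].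
rewrite /chi mulf_eq0 !subr_eq0 => /orP[].
  rewrite eq_sym => /eqP E.
  have := generic_neq (a := (nth 0%N mu i)%:Z + (nth 0%N mu j)%:Z) (b := (n - i.+1)%N%:Z + (n - j.+1)%N%:Z + 1) (c := 2)
       (a' := 0) (b' := 0) (c' := 0) gen0.
  rewrite !orbT => /(_ isT) /negP[]; apply/eqP; rewrite !expr0z !mulr1 -[RHS]E /point.
  by rewrite !expfzDr // !expr1z -!exprnP; ring.
move/eqP/invr_inj => E.
have := generic_neq (a := nth 0%N mu i) (b := (n - i.+1)%N) (c := 1)
       (a' := nth 0%N mu j) (b' := (n - j.+1)%N) (c' := 1) gen0.
have D : ((n - i.+1)%N != (n - j.+1)%N :> int).
  by apply/negP => /eqP[Eb]; have := ltn_ord i; have := ltn_ord j; lia.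
rewrite D orbT => /(_ isT) /negP[]; apply/eqP; rewrite expr1z; exact: E.
Qed.

End VanishHalf.

Lemma sqrt_extension (K : fieldType) (q : K) :
  exists (L : fieldType) (j : {rmorphism K -> L}) (v : L), v ^+ 2 = j q.
Proof.
have [[x Ex]|H] := pselect (exists x : K, x ^+ 2 = q).
  by exists K, idfun, x.
have sz : size ('X^2 - q%:P : {poly K}) = 3.
  by rewrite size_polyDl ?size_polyXn // size_polyN (leq_ltn_trans (size_polyC_leq1 _)).
have irr : irreducible_poly ('X^2 - q%:P : {poly K}).
  apply: cubic_irreducible; first by rewrite sz.
  move=> x; apply/negP; rewrite /root !hornerE subr_eq0 => /eqP E.
  by apply: H; exists x.
have [L _ [z rz _]] := irredp_FAdjoin irr.
exists L, (in_alg L), z; move: rz.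
by rewrite rmorphB /= map_polyXn map_polyC /root !hornerE subr_eq0 => /eqP.
Qed.

Section Transfer.
Variables (K L : fieldType) (j : {rmorphism K -> L}).
Hypothesis char0 : forall k, (k%:R == 0 :> K) = (k == 0%N).
Implicit Types (lam mu nu : intpart).

Lemma char0_ext k : (k%:R == 0 :> L) = (k == 0%N).
Proof. by rewrite -(rmorph_nat j) fmorph_eq0 char0. Qed.

Lemma generic_ext q t s : generic q t s -> generic (j q) (j t) (j s).
Proof.
case=> q0 t0 s0 H; split; rewrite ?fmorph_eq0 // => a b c.
by rewrite -!fmorphXz -!rmorphM -[X in _ = X](rmorph1 j) => /fmorph_inj/H.
Qed.

Lemma mfun_ext n lam (x : 'I_n -> K) : mfun lam (fun i => j (x i)) = j (mfun lam x).
Proof.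
rewrite !mfunE rmorph_sum; apply: eq_bigr => e _; rewrite /mon rmorph_prod.
by apply: eq_bigr => i _; rewrite fmorphXz.
Qed.

Lemma point_ext n q t s mu (i : 'I_n) :
  point (j q) (j t) (j s) mu i = j (point q t s mu i).
Proof. by rewrite /point !rmorphM !rmorphXn. Qed.

(** The image of the polynomial has the characteristic properties over L. *)
Lemma Pstar_ext n q t s lam mu : generic q t s -> (size lam <= n)%N ->
  Pstar (j q) (j t) (j s) lam (point (n := n) (j q) (j t) (j s) mu) =
  j (Pstar q t s lam (point (n := n) q t s mu)).
Proof.
move=> gen sz; have [f [c Ec] Ef] := Pstar_lead char0 gen sz; case: (gen) => q0 t0 s0 _.
have ex (x : 'I_n -> K) : torus x ->
   mfun lam (fun i => j (x i)) + \sum_(nu <- Dlt n lam) j (c nu) * mfun nu (fun i => j (x i)) =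
   j (Pstar q t s lam x).
  move=> tx; rewrite Ef // Ec // rmorphD mfun_ext; congr (_ + _).
  rewrite rmorph_sum; by apply: eq_bigr => nu _; rewrite rmorphM mfun_ext.
have tp nu : torus (point (n := n) q t s nu) by apply: torus_point.
have pe nu : point (n := n) (j q) (j t) (j s) nu =1 fun i => j (point q t s nu i).
  by move=> i; rewrite point_ext.
rewrite -(ex _ (tp mu)).
rewrite (Pstar_eq _ _ _ _ (pe mu)).
apply: (Pstar_unique char0_ext (f := fun x => \sum_(nu <- Dlt n lam) j (c nu) * mfun nu x)
  (F := fun x => mfun lam x + \sum_(nu <- Dlt n lam) j (c nu) * mfun nu x)) => //.
- exact: generic_ext.
- by exists (fun nu => j (c nu)).
- move=> nu nuD; rewrite (mfun_eq _ (pe nu)).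
  under eq_bigr do rewrite (mfun_eq _ (pe nu)).
  by rewrite ex // Pstar_vanish_lt // rmorph0.
by move=> i; rewrite fmorph_eq0; apply: tp.
Qed.

End Transfer.

Section Vanishing.
Variables (K : fieldType).
Hypothesis char0 : forall k, (k%:R == 0 :> K) = (k == 0%N).
Implicit Types (q t s : K) (lam mu nu : intpart).

(** A square root of q is adjoined for [vanish_of_sqrt]. *)
Theorem Pstar_vanish n q t s lam mu : generic q t s ->
  (size lam <= n)%N -> (size mu <= n)%N -> ~ incl lam mu ->
  Pstar q t s lam (point (n := n) q t s mu) = 0.
Proof.
move=> gen szl szm H; have [L [j [v v2]]] := sqrt_extension q.
apply: (fmorph_inj j); rewrite rmorph0 -Pstar_ext //.
exact: (vanish_of_sqrt (char0_ext j char0) (generic_ext j gen) v2).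
Qed.

Lemma incl_sumn lam mu : incl lam mu -> (sumn mu <= sumn lam)%N -> lam = mu.
Proof.
move=> il le; pose N := maxn (size lam) (size mu).
have E : (\sum_(i < N) (nth 0%N mu i - nth 0%N lam i) = 0)%N.
  rewrite sumnB; last by move=> i _; apply: il.
  rewrite -/(psum mu N) -/(psum lam N) !psum_over ?leq_maxl ?leq_maxr //.
  by apply/eqP; rewrite subn_eq0.
move/eqP: E; rewrite sum_nat_eq0 => /forallP H; apply: intpart_eq => i.
have [lt|ge] := ltnP i N.
  apply/eqP; rewrite eqn_leq il /=; have := H (Ordinal lt).
  by rewrite subn_eq0.
by rewrite !nth_default // (leq_trans _ ge) ?leq_maxl ?leq_maxr.
Qed.

(** Bounding the size instead of using dominance admits more monomials, and
    [Pstar_vanish] provides as many more zeros. *)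
Theorem Pstar_degree n q t s lam f : generic q t s -> (size lam <= n)%N ->
  span (parts_upto n (sumn lam)) f ->
  (forall nu, nu \in parts_upto n (sumn lam) -> nu != lam -> f (point (n := n) q t s nu) = 0) ->
  forall x, torus x ->
    Pstar q t s lam (point (n := n) q t s lam) * f x = f (point q t s lam) * Pstar q t s lam x.
Proof.
move=> gen sz sf Hf x tx; case: (gen) => q0 t0 s0 _.
have tp nu : torus (point (n := n) q t s nu) by apply: torus_point.
set a := Pstar q t s lam (point q t s lam); set b := f (point q t s lam).
have sP : span (parts_upto n (sumn lam)) (Pstar (n := n) q t s lam).
  apply: span_sub (Pstar_span char0 gen sz); first by case: (lower_parts_upto n (sumn lam)).
  by move=> mu /mem_Dle[szm dm]; rewrite mem_parts_upto szm dom_sumn.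
apply/eqP; rewrite -subr_eq0; apply/eqP.
apply: (span_unique char0 (lower_parts_upto n (sumn lam)) gen
  (spanB (spanZ a sf) (spanZ b sP))) => // nu nuD.
have [->|ne] := eqVneq nu lam; first by rewrite /a /b mulrC subrr.
rewrite Hf // Pstar_vanish ?mulr0 ?subr0 //; first by move: nuD; rewrite mem_parts_upto => /andP[].
move=> il; move: nuD ne; rewrite mem_parts_upto => /andP[_ le].
by rewrite (incl_sumn il le) eqxx.
Qed.

End Vanishing.

Section Diagonal.
Variables (K : fieldType).
Hypothesis char0 : forall k, (k%:R == 0 :> K) = (k == 0%N).
Implicit Types (q t s S : K) (lam mu nu : intpart).

Local Arguments mkpart : simpl never.
Local Arguments conjp : simpl never.

(** With this shift of the parameter the values do not depend on n. *)
Definition Pval n q t S mu lam : K := interp_at n q t (t ^ (1 - n%:Z) * S) mu lam.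

Lemma Pval_P n q t S mu lam :
  Pval n q t S mu lam = Pstar q t (t ^ (1 - n%:Z) * S) mu (point (n := n) q t (t ^ (1 - n%:Z) * S) lam).
Proof. by []. Qed.

Lemma generic_tS q t S (k : int) : generic q t S -> generic q t (t ^ k * S).
Proof. by move=> /(generic_shift 0 k); rewrite expr0z mul1r. Qed.

Lemma Pval_stableS n q t S mu lam : generic q t S -> (size mu <= n)%N -> (size lam <= n)%N ->
  Pval n.+1 q t S mu lam = Pval n q t S mu lam.
Proof.
move=> gen szm szl; case: (gen) => q0 t0 S0 _; rewrite !Pval_P.
set s := t ^ (1 - n.+1%:Z) * S.
have gs : generic q t s by apply: generic_tS.
have -> : t ^ (1 - n%:Z) * S = t * s.
  by rewrite /s mulrA -{2}[t]expr1z -expfzDr //; congr (t ^ _ * _); lia.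
rewrite (Pstar_stable char0 gs szm); last by case: gs => _ _ s0 _; apply: torus_point => //; rewrite mulf_neq0.
by apply: Pstar_eq => i; apply: point_extx.
Qed.

Lemma Pval_stable n n' q t S mu lam : generic q t S ->
  (size mu <= n)%N -> (size lam <= n)%N -> (size mu <= n')%N -> (size lam <= n')%N ->
  Pval n q t S mu lam = Pval n' q t S mu lam.
Proof.
move=> gen.
have main k d : (size mu <= k)%N -> (size lam <= k)%N -> Pval (k + d) q t S mu lam = Pval k q t S mu lam.
  move=> h1 h2; elim: d => [|d IH]; first by rewrite addn0.
  by rewrite addnS Pval_stableS // (leq_trans _ (leq_addr _ _)).
move=> h1 h2 h3 h4; have [le|/ltnW le] := leqP n n'.
  by rewrite -(subnKC le) main.
by rewrite -(subnKC le) main.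
Qed.

Lemma Pval_addcol n q t S mu lam : generic q t S -> (size mu <= n)%N ->
  Pval n q t S (addcol n mu) (addcol n lam) =
  Pval n q t (q * S) mu lam * \prod_(i < n) ydiff (q ^ (nth 0%N lam i).+1%:Z * t ^ (- i%:Z) * S) (t ^ (1 - n%:Z) * S).
Proof.
move=> gen sz; case: (gen) => q0 t0 S0 _; rewrite !Pval_P.
rewrite (Pstar_addcol char0 (generic_tS _ gen) sz); last first.
  by apply: torus_point => //; rewrite mulf_neq0 ?expfz_neq0.
have -> : t ^ (1 - n%:Z) * (q * S) = q * (t ^ (1 - n%:Z) * S) by rewrite mulrCA.
congr (_ * _); first by apply: Pstar_eq => i; apply: point_addcol.
apply: eq_bigr => i _; congr ydiff.
rewrite /point nth_addcol ltn_ord mulrA -[_ * _ * t ^ _]mulrA; congr (_ * _ * _).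
rewrite exprnP -expfzDr //; congr (_ ^ _); have := ltn_ord i; lia.
Qed.

Lemma nth_conj lam j : nth 0%N (conjp lam) j = count (fun k => j < k)%N lam.
Proof.
rewrite /conjp /= /conj_seq; have [lt|ge] := ltnP j (head 0%N lam).
  by rewrite (nth_map 0%N) ?size_iota // nth_iota.
rewrite nth_default ?size_map ?size_iota //; apply/esym/eqP.
rewrite -leqn0 leqNgt -has_count; apply/hasPn => k /(nthP 0%N)[i _ <-].
by rewrite -leqNgt (leq_trans _ ge) // -nth0 intpart_nth.
Qed.

Lemma nth_conj_sum n lam j : (size lam <= n)%N ->
  nth 0%N (conjp lam) j = (\sum_(i < n) (j < nth 0%N lam i))%N.
Proof.
move=> sz; rewrite nth_conj -sum1_count big_mkcond /= (big_nth 0%N) big_mkord.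
rewrite (big_ord_widen n (fun i => if (j < nth 0%N lam i)%N then 1%N else 0%N) sz) big_mkcond.
apply: eq_bigr => i _; case: ltnP => [_|h]; first by case: ifP.
by rewrite nth_default.
Qed.

(** With as many variables as parts, lam has a full column. Removing it by
    [Pval_addcol] gives the factors j = 0 and replaces S by q S, which shifts the
    other factors by one column. *)
Theorem Pval_diag n q t S lam : generic q t S -> (size lam <= n)%N ->
  Pval n q t S lam lam = \prod_(i < n) \prod_(j < nth 0%N lam i)
    ydiff (q ^ (nth 0%N lam i)%:Z * t ^ (- i%:Z) * S)
          (q ^ j%:Z * t ^ (1 - (nth 0%N (conjp lam) j)%:Z) * S).
Proof.
elim: {lam}_.+1 {-2}lam S (ltnSn (sumn lam)) n => // N IH lam S leN n gen sz.
case: (gen) => q0 t0 S0 _.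
rewrite (Pval_stable gen sz sz (leqnn _) (leqnn _)).
have -> : \prod_(i < n) \prod_(j < nth 0%N lam i)
    ydiff (q ^ (nth 0%N lam i)%:Z * t ^ (- i%:Z) * S)
          (q ^ j%:Z * t ^ (1 - (nth 0%N (conjp lam) j)%:Z) * S) =
   \prod_(i < size lam) \prod_(j < nth 0%N lam i)
    ydiff (q ^ (nth 0%N lam i)%:Z * t ^ (- i%:Z) * S)
          (q ^ j%:Z * t ^ (1 - (nth 0%N (conjp lam) j)%:Z) * S).
  rewrite [RHS](big_ord_widen n (fun i => \prod_(j < nth 0%N lam i)
    ydiff (q ^ (nth 0%N lam i)%:Z * t ^ (- i%:Z) * S)
          (q ^ j%:Z * t ^ (1 - (nth 0%N (conjp lam) j)%:Z) * S)) sz) big_mkcond [RHS]big_mkcond.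
  apply: eq_bigr => i _ /=; case: ltnP => // h.
  by rewrite nth_default // big_ord0.
have [s0|spos] := posnP (size lam).
  rewrite s0 big_ord0.
  have -> : lam = nilp by apply: intpart_eq => i; rewrite !nth_default ?s0.
  rewrite Pval_P; have [f [c Ec] ->] := Pstar_lead char0 (generic_tS (1 - 0%:Z) gen) (isT : size nilp <= 0)%N.
    rewrite mfun_nil Ec; last by apply: torus_point; rewrite // mulf_neq0 ?expfz_neq0.
    rewrite big_seq big1 ?addr0 // => mu /mem_Dlt[szm [_ ne]].
    case/eqP: ne; apply: intpart_eq => i; rewrite nth_nilp nth_default //.
    exact: leq_trans szm _.
  by apply: torus_point; rewrite // mulf_neq0 ?expfz_neq0.
move: spos; set k := size lam => spos.
pose kap := delcol k lam.
have Ek : addcol k kap = lam by apply: delcolK.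
have szk : (size kap <= k)%N by apply: size_shape.
have nl i : (i < k)%N -> nth 0%N lam i = (nth 0%N kap i).+1 by move=> h; rewrite -Ek nth_addcol h.
have lts : (sumn kap < sumn lam)%N.
  rewrite -(psum_over szk) -(psum_over (leqnn (size lam))) -/k /psum.
  rewrite (bigD1 (Ordinal spos)) // [X in (_ < X)%N](bigD1 (Ordinal spos)) //= nl //.
  by rewrite -addSn leq_add2l; apply: leq_sum => i _; rewrite nl.
have genq : generic q t (q * S).
  by have := generic_shift 1 0 gen; rewrite expr1z expr0z mulr1.
rewrite -{1 2}Ek Pval_addcol // IH //; last exact: leq_trans lts _.
rewrite -big_split; apply: eq_bigr => i _ /=; rewrite (nl i) // big_ord_recl mulrC.
congr (_ * _).
  congr ydiff; rewrite expr0z mul1r (nth_conj_sum 0 (leqnn (size lam))) -/k.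
  rewrite (eq_bigr (fun=> 1%N)); last by move=> i' _; rewrite nl.
  by rewrite sum1_card card_ord.
apply: eq_bigr => j _; congr ydiff.
  by rewrite exprSz; ring.
have -> : nth 0%N (conjp kap) j = nth 0%N (conjp lam) (lift ord0 j).
  rewrite (nth_conj_sum _ szk) (nth_conj_sum _ (leqnn (size lam))).
  by apply: eq_bigr => i' _; rewrite nl.
by rewrite lift0 exprSz; ring.
Qed.

End Diagonal.

(** * Conjugation and power sums *)

Local Arguments mkpart : simpl never.
Local Arguments conjp : simpl never.

Section Conjugation.
Implicit Types (lam mu nu : intpart).

Lemma conj_lt lam i j : (i < nth 0 (conjp lam) j)%N = (j < nth 0 lam i)%N.
Proof.
pose n := maxn (size lam) i.+1.
have szn : (size lam <= n)%N by apply: leq_maxl.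
have ltin : (i < n)%N by apply: leq_maxr.
rewrite (nth_conj_sum j szn); case: (ltnP j (nth 0 lam i)) => h.
  apply: (@leq_trans (\sum_(i' < i.+1) (j < nth 0 lam i'))%N).
    rewrite (eq_bigr (fun=> 1%N)) ?sum1_card ?card_ord // => i' _.
    by rewrite (leq_trans h) // intpart_nth // -ltnS.
  rewrite (big_ord_widen n (fun i' => (j < nth 0%N lam i') : nat) ltin).
  by rewrite [leqRHS](bigID (fun i' : 'I_n => i' < i.+1)%N) leq_addr.
apply/negbTE; rewrite -leqNgt (bigID (fun i' : 'I_n => i' < i)%N) /=.
rewrite [X in (_ + X)%N]big1 ?addn0 => [|i' ]; last first.
  by rewrite -leqNgt => le; rewrite ltnNge (leq_trans (intpart_nth lam le) h).
rewrite -(big_ord_widen n (fun i' => (j < nth 0%N lam i') : nat) (ltnW ltin)).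
apply: (@leq_trans (\sum_(i' < i) 1)%N); last by rewrite sum1_card card_ord.
by apply: leq_sum => i' _; case: (_ < _)%N.
Qed.

Lemma conjK lam : conjp (conjp lam) = lam.
Proof.
apply: intpart_eq => i; apply/eqP; rewrite eqn_leq.
apply/andP; split; rewrite leqNgt; apply/negP.
  by rewrite conj_lt conj_lt ltnn.
by rewrite -conj_lt -conj_lt ltnn.
Qed.

Lemma conj_inj : injective conjp.
Proof. exact: can_inj conjK. Qed.

Lemma size_leP lam n : (size lam <= n)%N = (nth 0 lam n == 0)%N.
Proof. by rewrite -leqn0 leqNgt -nth_gt0 -leqNgt leqn0. Qed.

Lemma size_conj lam : size (conjp lam) = nth 0%N lam 0.
Proof.
apply/eqP; rewrite eqn_leq; apply/andP; split; rewrite leqNgt -?nth_gt0 ?conj_lt ?ltnn //.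
by rewrite -conj_lt nth_gt0 ltnn.
Qed.

Definition inbox m n lam := (size lam <= n)%N && (size (conjp lam) <= m)%N.

Lemma inbox_conj m n lam : inbox m n lam = inbox n m (conjp lam).
Proof. by rewrite /inbox conjK andbC. Qed.

Lemma inbox_incl m n lam : incl lam (rect m n) -> inbox m n lam.
Proof.
move=> H; apply/andP; split; last first.
  by rewrite size_conj (leq_trans (H 0%N)) // /rect nth_nseq; case: ifP.
by rewrite size_leP -leqn0 (leq_trans (H n)) // /rect nth_nseq ltnn.
Qed.

Lemma box_exchange (R : Type) (idx : R) (op : Monoid.com_law idx) m n lam (F : nat -> nat -> R) :
  inbox m n lam ->
  \big[op/idx]_(i < n) \big[op/idx]_(j < nth 0%N lam i) F i j =
  \big[op/idx]_(j < m) \big[op/idx]_(i < nth 0%N (conjp lam) j) F i j.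
Proof.
move=> /andP[szn szm].
have le_m i : (nth 0 lam i <= m)%N.
  by rewrite (leq_trans _ szm) // size_conj intpart_nth.
have le_n j : (nth 0 (conjp lam) j <= n)%N.
  by rewrite (leq_trans _ szn) // -{2}[lam]conjK size_conj intpart_nth.
under eq_bigr => i _ do rewrite (big_ord_widen m (F i) (le_m i)) big_mkcond.
under [RHS]eq_bigr => j _ do rewrite (big_ord_widen n (F^~ j) (le_n j)) big_mkcond.
rewrite exchange_big; apply: eq_bigr => j _; apply: eq_bigr => i _.
by rewrite conj_lt.
Qed.

Lemma sumn_conj lam : sumn (conjp lam) = sumn lam.
Proof.
have B : inbox (size (conjp lam)) (size lam) lam by rewrite /inbox !leqnn.
rewrite -(psum_over (leqnn (size lam))) -(psum_over (leqnn (size (conjp lam)))) /psum.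
have E k : k = (\sum_(i < k) 1)%N by rewrite sum1_card card_ord.
under [RHS]eq_bigr do rewrite [nth _ _ _]E.
rewrite (box_exchange addn (fun _ _ => 1%N) B); apply: eq_bigr => j _; exact: E.
Qed.

End Conjugation.

Section PowerSums.
Variables (K : fieldType) (N : nat).
Hypothesis char0 : forall k, (k%:R == 0 :> K) = (k == 0%N).
Implicit Types (x : 'I_N -> K) (a b : 'I_N -> nat) (lam mu nu : intpart).

Definition powsum k x : K := \sum_i palin k (x i).
(** A multiple of the orbit sum of the partition formed by a. *)
Definition palin_sum a x : K := \sum_(p : 'S_N) \prod_i palin (a (p i)) (x i).
Definition upd a j v : 'I_N -> nat := fun i => if i == j then v else a i.

Lemma palinM k l (y : K) : y != 0 -> palin k y * palin l y = palin (l + k) y + palin (maxn k l - minn k l) y.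
Proof.
move=> y0; wlog le : k l / (k <= l)%N => [H|].
  have [le|/ltnW le] := leqP k l; first by have := H _ _ le; rewrite (maxn_idPr le) (minn_idPl le).
  by rewrite mulrC (H _ _ le) addnC [maxn l k]maxnC [minn l k]minnC (maxn_idPl le) (minn_idPr le).
rewrite (maxn_idPr le) (minn_idPl le) -{1 2}(subnKC le) /palin !exprD.
by field; rewrite !expf_neq0.
Qed.

Lemma palin_sum_perm a (p : 'S_N) x : palin_sum (fun i => a (p i)) x = palin_sum a x.
Proof.
rewrite /palin_sum [RHS](reindex_inj (mulIg p)); apply: eq_bigr => s _.
by apply: eq_bigr => i _; rewrite permM.
Qed.

Lemma palin_sum_eq a b x : a =1 b -> palin_sum a x = palin_sum b x.
Proof. by move=> E; apply: eq_bigr => p _; apply: eq_bigr => i _; rewrite E. Qed.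

Lemma powsum_palin_sum k b x : torus x ->
  powsum k x * palin_sum b x =
  \sum_j (palin_sum (upd b j (b j + k)) x + palin_sum (upd b j (maxn k (b j) - minn k (b j))) x).
Proof.
move=> tx; rewrite big_split /= /palin_sum mulr_sumr exchange_big [X in _ = _ + X]exchange_big -big_split /=.
apply: eq_bigr => p _; rewrite /powsum mulr_suml -big_split /=.
rewrite [RHS](reindex_inj (@perm_inj _ p)) /=; apply: eq_bigr => i _.
have U v : \prod_l palin (upd b (p i) v (p l)) (x l) =
    palin v (x i) * \prod_(l < N | l != i) palin (b (p l)) (x l).
  rewrite (bigD1 i) //= /upd eqxx; congr (_ * _); apply: eq_bigr => l ne.
  by rewrite (inj_eq perm_inj) (negPf ne).
by rewrite !U (bigD1 i) //= mulrA palinM // mulrDl.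
Qed.

(** Orbit sums are polynomials in power sums, in the form of an induction principle
    with a bound on the degree. Take an index with nonzero exponent k and let b be a
    with this exponent removed. The product of the power sum of weight k and of the
    sum for b has as many terms equal to the sum for a as b has zeros; all other
    terms have fewer nonzero exponents than a. *)
Lemma powsum_closed (C : nat -> (intpart -> K) -> Prop) (X : intpart -> 'I_N -> K) :
  (forall nu, torus (X nu)) ->
  (forall d f g, (forall nu, f nu = g nu) -> C d f -> C d g) ->
  (forall d d' f, (d <= d')%N -> C d f -> C d' f) ->
  (forall d c, C d (fun=> c)) ->
  (forall d f g, C d f -> C d g -> C d (fun nu => f nu + g nu)) ->
  (forall d c f, C d f -> C d (fun nu => c * f nu)) ->
  (forall d k f, C d f -> C (k + d)%N (fun nu => powsum k (X nu) * f nu)) ->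
  forall a, C (\sum_i a i)%N (fun nu => palin_sum a (X nu)).
Proof.
move=> tX Cext Cmon Cc CD CZ Cp a.
have Csum d (r : seq 'I_N) F :
    (forall i, i \in r -> C d (F i)) -> C d (fun nu => \sum_(i <- r) F i nu).
  exact: (closed_sum (Cc d 0) (CD d)).
pose nnz b := #|[set i | b i != 0%N]|.
elim: {a}_.+1 {-2}a (ltnSn (nnz a)) => // M IH a leM.
have [/existsP[j0 aj0]|/existsPn H0] := boolP [exists j, a j != 0%N]; last first.
  apply: (Cext _ (fun=> \sum_(p : 'S_N) \prod_(i < N) 2)); last exact: Cc.
  move=> nu; apply: eq_bigr => p _; apply: eq_bigr => i _.
  have /eqP -> : a (p i) == 0%N by have := H0 (p i); rewrite negbK.
  by rewrite /palin expr0 invr1.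
pose k := a j0; pose b := upd a j0 0.
have Ea : a =1 upd b j0 k.
  by move=> i; rewrite /b /upd; case: eqP => [->|].
have sumb : (\sum_i a i = k + \sum_i b i)%N.
  rewrite (bigD1 j0) // [in RHS](bigD1 j0) //=; congr addn.
  rewrite {1}/b /upd eqxx add0n; apply: eq_bigr => i /negPf ne.
  by rewrite /b /upd ne.
have sumu j v : (\sum_i upd b j v i + b j = \sum_i b i + v)%N.
  rewrite (bigD1 j) // [in RHS](bigD1 j) //= {1}/upd eqxx.
  rewrite (eq_bigr b); first by rewrite addnC addnA addnAC.
  by move=> i /negPf ne; rewrite /upd ne.
have nnzb : (nnz b < nnz a)%N.
  rewrite /nnz [X in (_ < X)%N](cardsD1 j0) inE aj0 add1n ltnS subset_leq_card //.
  by apply/subsetP => i; rewrite !inE /b /upd; case: ifP; rewrite ?eqxx // => ->.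
(* Changing an exponent that is already nonzero does not create a new one. *)
have nnzu j v : b j != 0%N -> (nnz (upd b j v) <= nnz b)%N.
  move=> bj; apply: subset_leq_card; apply/subsetP => i; rewrite !inE /upd.
  by case: (i =P j) => [->|].
pose Z := [set j | b j == 0%N].
have z0 : (2 * #|Z|)%:R != 0 :> K.
  rewrite char0 muln_eq0 /= -lt0n; apply/card_gt0P; exists j0.
  by rewrite inE /b /upd eqxx.
pose t1 j := palin_sum (upd b j (b j + k)); pose t2 j := palin_sum (upd b j (maxn k (b j) - minn k (b j))).
pose r := [seq j <- enum 'I_N | b j != 0%N].
apply: (Cext _ (fun nu => (2 * #|Z|)%:R^-1 * (powsum k (X nu) * palin_sum b (X nu) +
   (-1) * \sum_(j <- r) (t1 j (X nu) + t2 j (X nu))))).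
  move=> nu; apply: (mulfI z0); rewrite mulVKf // powsum_palin_sum //.
  rewrite (bigID (fun j => b j == 0%N)) /= mulN1r /r big_filter big_enum_cond addrK.
  rewrite (eq_bigr (fun=> 2%:R * palin_sum a (X nu))).
    rewrite (eq_bigl (fun j => j \in Z)); last by move=> j; rewrite inE.
    by rewrite sumr_const -[LHS]mulr_natl natrM mulrCA mulrA.
  move=> j /eqP bj; rewrite bj minn0 maxn0 subn0 add0n -mulr2n -[LHS]mulr_natl; congr (_ * _).
  rewrite -[LHS](palin_sum_perm _ (tperm j j0)); apply: palin_sum_eq => i.
  rewrite Ea /upd; case: tpermP => [->|->|/eqP ij /eqP ij0].
  - by rewrite eq_sym bj; case: ifP => // _; rewrite /b /upd eqxx.
  - by rewrite !eqxx.
  by rewrite (negPf ij) (negPf ij0).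
apply/CZ/CD.
  by rewrite sumb; apply: Cp; apply: IH; apply: leq_trans nnzb _; rewrite -ltnS.
apply/CZ; apply/Csum => j; rewrite mem_filter => /andP[bj _].
have ltM v : (nnz (upd b j v) < M)%N.
  by apply: leq_ltn_trans (nnzu j v bj) _; rewrite -ltnS; apply: leq_trans leM; rewrite ltnS.
apply/CD; (apply: Cmon (IH _ (ltM _))); rewrite sumb.
  by have := sumu j (b j + k)%N; lia.
by have := sumu j (maxn k (b j) - minn k (b j))%N; lia.
Qed.

End PowerSums.

(** * Duality of the square symbol *)

Section SquareDuality.
Variables (K : fieldType).
Hypothesis char0 : forall k, (k%:R == 0 :> K) = (k == 0%N).
Variables (q t S R : K).
Hypothesis gen : generic q t S.
Hypothesis R2 : R ^+ 2 = q * t.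
Implicit Types (lam mu nu kap : intpart).

Definition dualS := 1 / (R * S).

Lemma R_neq0 : R != 0.
Proof. by case: gen => q0 t0 _ _; move: (mulf_neq0 q0 t0); rewrite -R2 expf_eq0. Qed.

Lemma generic_dual : generic t q dualS.
Proof.
case: (gen) => q0 t0 S0 H; have R0 := R_neq0.
split=> //; first by rewrite /dualS div1r invr_eq0 mulf_neq0.
have E2 (y : K) (k : int) : y ^ (2 * k) = (y ^ k) ^+ 2 by rewrite mulrC -exprz_exp.
move=> a b c E.
have : q ^ (2 * b - c) * t ^ (2 * a - c) * S ^ (2 * - c) = 1.
  rewrite -[RHS](expr1n _ 2) -[X in X ^+ 2]E /dualS div1r exprz_inv expfzMl.
  have Eq : q ^ (- c) * t ^ (- c) = (R ^ (- c)) ^+ 2 by rewrite -E2 -expfzMl -R2 -exprz_exp.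
  rewrite !expfzDr // !E2.
  have -> : (t ^ a * q ^ b * (R ^ (- c) * S ^ (- c))) ^+ 2 =
     (t ^ a) ^+ 2 * (q ^ b) ^+ 2 * ((R ^ (- c)) ^+ 2 * (S ^ (- c)) ^+ 2) by rewrite !exprMn.
  rewrite -Eq; move: (t ^ a) (q ^ b) (q ^ (- c)) (t ^ (- c)) (S ^ (- c)) => A B C D F; ring.
move/H => [h1 h2 h3]; have c0 : c = 0 by lia.
split=> //; lia.
Qed.

Definition vpoint N (q t S : K) nu : 'I_N -> K := point q t (t ^ (1 - N%:Z) * S) nu.

Lemma vpointE N (q' t' S' : K) nu (i : 'I_N) : t' != 0 ->
  vpoint q' t' S' nu i = q' ^+ nth 0%N nu i * t'^-1 ^+ i * S'.
Proof.
move=> t0; rewrite /vpoint /point mulrA -[_ * _ * t' ^ _]mulrA; congr (_ * _ * _).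
rewrite [t' ^+ _]exprnP -expfzDr // exprVn (invr_expz t' i); congr (t' ^ _).
have := ltn_ord i; lia.
Qed.

Lemma torus_vpoint N (q' t' S' : K) nu : generic q' t' S' -> torus (@vpoint N q' t' S' nu).
Proof.
case=> q0 t0 S0 _; apply: torus_point => //; by rewrite mulf_neq0 ?expfz_neq0.
Qed.

(** Geometric progressions along the rows of nu. *)
Lemma rowsum N (Q Th : K) nu :
  \sum_(i < N) Q ^+ nth 0%N nu i * Th ^+ i =
  (Q - 1) * (\sum_(i < N) \sum_(j < nth 0%N nu i) Q ^+ j * Th ^+ i) + \sum_(i < N) Th ^+ i.
Proof.
rewrite mulr_sumr -big_split; apply: eq_bigr => i _ /=.
by rewrite -mulr_suml mulrA -subrX1 mulrBl mul1r subrK.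
Qed.

(** Up to constants the power sum at the point of nu is a combination of the sums
    over the boxes of (q^j t^(-i))^k and of its inverse. Reading the same box sums by
    columns gives the dual power sum; R^2 = q t makes the quotients of corresponding
    coefficients equal for the two sums. *)
Lemma powsum_dual N k : exists a b : K, forall nu, inbox N N nu ->
  powsum k (@vpoint N t q dualS (conjp nu)) = a * powsum k (@vpoint N q t S nu) + b.
Proof.
case: (gen) => q0 t0 S0 Hg; have R0 := R_neq0.
case: k => [|k].
  exists 0, (\sum_(i < N) 2); move=> nu _; rewrite mul0r add0r.
  by apply: eq_bigr => i _; rewrite /palin expr0 invr1.
set Q := q ^+ k.+1; set Th := t^-1 ^+ k.+1; set U := S ^+ k.+1; set W := R ^+ k.+1.
have Q0 : Q != 0 by rewrite expf_neq0.
have Th0 : Th != 0 by rewrite expf_neq0 // invr_eq0.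
have U0 : U != 0 by rewrite expf_neq0.
have W0 : W != 0 by rewrite expf_neq0.
have Q1 : Q - 1 != 0.
  rewrite subr_eq0; apply/negP => /eqP E.
  have [//] : [/\ k.+1%:Z = 0, 0%:Z = 0 & 0%:Z = 0].
  by apply: Hg; rewrite !expr0z !mulr1.
have W2 : W * W * Th = Q by rewrite /W -exprMn -expr2 R2 /Th -exprMn mulfK.
pose bet nu (Q Th : K) := \sum_(i < N) \sum_(j < nth 0%N nu i) Q ^+ j * Th ^+ i.
have P1 nu : powsum k.+1 (@vpoint N q t S nu) =
    U * ((Q - 1) * bet nu Q Th + \sum_(i < N) Th ^+ i) +
    U^-1 * ((Q^-1 - 1) * bet nu Q^-1 Th^-1 + \sum_(i < N) Th^-1 ^+ i).
  rewrite -!rowsum !mulr_sumr -big_split; apply: eq_bigr => i _ /=.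
  rewrite /palin vpointE // !exprMn -[(q ^+ _) ^+ k.+1]exprM -[(t^-1 ^+ _) ^+ k.+1]exprM.
  rewrite mulnC exprM [(i * _)%N]mulnC exprM -/Q -/Th -/U !exprVn -!invfM.
  by rewrite [X in X + _]mulrC [X in _ + X^-1]mulrC.
have P2 nu : inbox N N nu -> powsum k.+1 (@vpoint N t q dualS (conjp nu)) =
    (W * U) * ((Th - 1) * bet nu Q Th + \sum_(i < N) Q ^+ i) +
    (W * U)^-1 * ((Th^-1 - 1) * bet nu Q^-1 Th^-1 + \sum_(i < N) Q^-1 ^+ i).
  move=> bx.
  have Eb (A B : K) : bet nu A B = \sum_(j < N) \sum_(i < nth 0%N (conjp nu) j) B ^+ i * A ^+ j.
    rewrite /bet (box_exchange +%R (fun i j => A ^+ j * B ^+ i) bx).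
    by apply: eq_bigr => j _; apply: eq_bigr => i _; rewrite mulrC.
  rewrite !Eb -!rowsum !mulr_sumr -big_split; apply: eq_bigr => j _ /=.
  have ED : dualS ^+ k.+1 = (W * U)^-1 by rewrite /dualS div1r exprVn exprMn.
  rewrite /palin vpointE //; move: ED; move: dualS => D ED.
  rewrite !exprMn -[(t ^+ _) ^+ k.+1]exprM -[(q^-1 ^+ _) ^+ k.+1]exprM.
  rewrite [(_ * k.+1)%N]mulnC exprM [(j * _)%N]mulnC exprM.
  rewrite ED.
  have -> : t ^+ k.+1 = Th^-1 by rewrite /Th exprVn invrK.
  rewrite [q^-1 ^+ _]exprVn -/Q !exprVn !invfM !invrK addrC.
  by congr (_ + _); rewrite mulrC.
exists (W * (Th - 1) / (Q - 1)).
exists (W * U * \sum_(i < N) Q ^+ i + (W * U)^-1 * \sum_(i < N) Q^-1 ^+ i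
  - W * (Th - 1) / (Q - 1) * (U * \sum_(i < N) Th ^+ i + U^-1 * \sum_(i < N) Th^-1 ^+ i)).
move=> nu bx; rewrite P1 P2 //.
move: (bet nu Q Th) (bet nu Q^-1 Th^-1) (\sum_(i < N) Th ^+ i) (\sum_(i < N) Th^-1 ^+ i)
  (\sum_(i < N) Q ^+ i) (\sum_(i < N) Q^-1 ^+ i) => b1 b2 c1 c2 d1 d2.
have -> : Th = Q / (W * W) by rewrite -W2 mulrC mulKf // mulf_neq0.
by field; rewrite Q1 Q0 W0 U0.
Qed.

Lemma powsum_span N d k (f : ('I_N -> K) -> K) : span (parts_upto N d) f ->
  span (parts_upto N (k + d)) (fun x => powsum k x * f x).
Proof.
move=> sf; apply: (sym_span char0); first by case: (lower_parts_upto N (k + d)).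
  move=> x tx g; case: sf => c Ec.
  rewrite !Ec //; last by move=> i; apply: torus_flip.
  congr (_ * _); last by apply: eq_bigr => mu _; rewrite mfun_sym.
  rewrite /powsum (reindex_inj (@perm_inj _ g.1)); apply: eq_bigr => i _ /=.
  rewrite permK /flip /palin; case: (g.2 i) => //.
  by rewrite exprVn invrK addrC.
apply: (@lsuppM _ _ (fun e => \sum_i absv e i <= k)%N (fun e => \sum_i absv e i <= d)%N).
- move=> e1 e2 h1 h2; rewrite mem_parts_upto size_shape sumn_shape /=.
  apply: leq_trans (leq_add h1 h2); rewrite -big_split; apply: leq_sum => i _.
  rewrite /absv ffunE; move: (e1 i) (e2 i) => a b /=; lia.
- apply: lsupp_sum => i _.
  apply: (@lsupp_ext _ _ _ (fun x => 1 * palin k (x i))); first by move=> x _; rewrite mul1r.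
  apply: lsupp_sub (lsupp_palin i 1 (leqnn k)) => e /(_ setT).
  by rewrite (eq_bigl xpredT) => [|j]; rewrite in_setT.
apply: lsupp_sub (lsupp_span _ sf).
  by move=> e; rewrite mem_parts_upto sumn_shape => /andP[].
by move=> mu; rewrite mem_parts_upto => /andP[].
Qed.

Lemma span_const N d (c : K) : span (parts_upto N d) (fun _ : 'I_N -> K => c).
Proof.
apply: (@span_ext _ _ _ (fun x => c * mfun nilp x)); first by move=> x _; rewrite mfun_nil mulr1.
apply/spanZ/span_mfun; first by case: (lower_parts_upto N d).
by rewrite mem_parts_upto.
Qed.

(** Functions of a partition that come from a symmetric function of degree at most d
    at the point of this partition; values at the conjugate partition for the dual
    parameters will be seen to be among them. *)
Definition dual_span N d (g : intpart -> K) :=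
  exists2 f : ('I_N -> K) -> K, span (parts_upto N d) f &
    forall nu, inbox N N nu -> f (vpoint q t S nu) = g nu.

Lemma dual_span_ext N d f g : (forall nu, f nu = g nu) -> dual_span N d f -> dual_span N d g.
Proof. by move=> E [h sh Eh]; exists h => // nu bx; rewrite Eh. Qed.

Lemma dual_span_leq N d d' f : (d <= d')%N -> dual_span N d f -> dual_span N d' f.
Proof.
move=> le [h sh Eh]; exists h => //; apply: span_sub sh; first by case: (lower_parts_upto N d').
by move=> mu; rewrite !mem_parts_upto => /andP[-> /leq_trans ->].
Qed.

Lemma dual_span_const N d c : dual_span N d (fun=> c).
Proof. by exists (fun=> c) => //; apply: span_const. Qed.

Lemma dual_spanD N d f g : dual_span N d f -> dual_span N d g -> dual_span N d (fun nu => f nu + g nu).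
Proof.
move=> [h sh Eh] [h' sh' Eh']; exists (fun x => h x + h' x); first exact: spanD.
by move=> nu bx; rewrite Eh // Eh'.
Qed.

Lemma dual_spanZ N d c f : dual_span N d f -> dual_span N d (fun nu => c * f nu).
Proof.
move=> [h sh Eh]; exists (fun x => c * h x); first exact: spanZ.
by move=> nu bx; rewrite Eh.
Qed.

Lemma dual_span_sum N d (I : eqType) (r : seq I) (F : I -> intpart -> K) :
  (forall i, i \in r -> dual_span N d (F i)) -> dual_span N d (fun nu => \sum_(i <- r) F i nu).
Proof. exact: (closed_sum (dual_span_const N d 0) (@dual_spanD N d)). Qed.

Lemma dual_span_powsum N d k f : dual_span N d f ->
  dual_span N (k + d) (fun nu => powsum k (@vpoint N t q dualS (conjp nu)) * f nu).
Proof.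
move=> [h sh Eh]; have [a' [b Eab]] := powsum_dual N k.
exists (fun x => a' * (powsum k x * h x) + b * h x).
  apply: spanD; first by apply/spanZ/powsum_span.
  apply: spanZ; apply: span_sub sh; first by case: (lower_parts_upto N (k + d)).
  move=> mu; rewrite !mem_parts_upto => /andP[-> /leq_trans]; apply; exact: leq_addl.
by move=> nu bx; rewrite Eab // Eh // mulrDl mulrA.
Qed.

Lemma dual_span_palin_sum N (a : 'I_N -> nat) :
  dual_span N (\sum_i a i)%N (fun nu => palin_sum a (@vpoint N t q dualS (conjp nu))).
Proof.
apply: (powsum_closed char0) => [nu|d f g|d d' f|d c|d f g|d c f|d k f].
- exact/torus_vpoint/generic_dual.
- exact: dual_span_ext.
- exact: dual_span_leq.
- exact: dual_span_const.
- exact: dual_spanD.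
- exact: dual_spanZ.
exact: dual_span_powsum.
Qed.

Lemma dual_span_Pval N kap : (size kap <= N)%N ->
  dual_span N (sumn kap) (fun nu => Pval N t q dualS kap (conjp nu)).
Proof.
move=> sz; have gd := generic_dual.
have [c Ec] := Pstar_span char0 (generic_tS (1 - N%:Z) gd) sz.
apply: (@dual_span_ext _ _ (fun nu => \sum_(eta <- Dle N kap)
    c eta * ((stab N eta)%:R^-1 * palin_sum (fun i : 'I_N => nth 0%N eta i) (@vpoint N t q dualS (conjp nu))))).
  move=> nu; rewrite Pval_P Ec; last exact: torus_vpoint.
  apply: eq_bigr => eta _; rewrite /palin_sum -Sym_part mulKf //.
  by rewrite char0 -lt0n stab_gt0.
apply: dual_span_sum => eta /mem_Dle[sze de]; apply/dual_spanZ/dual_spanZ.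
apply: dual_span_leq (dual_span_palin_sum _).
by rewrite -/(psum eta N) psum_over // dom_sumn.
Qed.

(** As a function of the point of nu, the dual polynomial of mu' at nu' has degree at
    most |mu| and vanishes unless mu is contained in nu. *)
Lemma Pval_dual_big N lam mu : (sumn mu <= N)%N -> inbox N N lam -> inbox N N mu ->
  Pval N q t S mu mu * Pval N t q dualS (conjp mu) (conjp lam) =
  Pval N t q dualS (conjp mu) (conjp mu) * Pval N q t S mu lam.
Proof.
move=> leN bl bm; have gd := generic_dual.
have szm : (size mu <= N)%N by case/andP: bm.
have szm' : (size (conjp mu) <= N)%N by case/andP: bm.
have [f sf Ef] := dual_span_Pval szm'; rewrite sumn_conj in sf.
rewrite -!Ef // !Pval_P.
apply: (Pstar_degree char0 (generic_tS _ gen) szm sf); last exact: torus_vpoint.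
move=> nu; rewrite mem_parts_upto => /andP[szn len] ne.
have bn : inbox N N nu.
  rewrite /inbox szn size_conj /= (leq_trans (nth_le_sumn nu 0)) //.
  exact: leq_trans len leN.
rewrite Ef // Pval_P (Pstar_vanish char0) //; first exact: generic_tS.
  by case/andP: bn.
move=> /incl_sumn; rewrite !sumn_conj => /(_ len) /conj_inj E.
by rewrite E eqxx in ne.
Qed.

Theorem Pval_dual m n lam mu : inbox m n lam -> inbox m n mu ->
  Pval n q t S mu lam / Pval n q t S mu mu =
  Pval m t q dualS (conjp mu) (conjp lam) / Pval m t q dualS (conjp mu) (conjp mu).
Proof.
move=> /andP[szl szl'] /andP[szm szm']; have gd := generic_dual.
(* All partitions of size at most |mu| then fit in the N by N square. *)
pose N := (m + n + sumn mu)%N.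
have nN : (n <= N)%N by rewrite /N -addnA addnC -addnA leq_addr.
have mN : (m <= N)%N by rewrite /N -addnA leq_addr.
have [h1 h2] : (size lam <= N)%N /\ (size mu <= N)%N by rewrite !(leq_trans _ nN).
have [h3 h4] : (size (conjp lam) <= N)%N /\ (size (conjp mu) <= N)%N by rewrite !(leq_trans _ mN).
rewrite !(Pval_stable char0 gen _ _ h2 h1) // (Pval_stable char0 gen szm szm h2 h2).
rewrite (Pval_stable char0 gd szm' szl' h4 h3) (Pval_stable char0 gd szm' szm' h4 h4).
have E : Pval N q t S mu mu * Pval N t q dualS (conjp mu) (conjp lam) =
  Pval N t q dualS (conjp mu) (conjp mu) * Pval N q t S mu lam.
  by apply: Pval_dual_big; rewrite /inbox ?h1 ?h2 ?h3 ?h4 // /N leq_addl.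
apply/eqP; rewrite eqr_div.
- by rewrite mulrC -E mulrC.
- by rewrite Pval_P Pstar_diag_neq0 //; apply: generic_tS.
by rewrite Pval_P Pstar_diag_neq0 //; apply: generic_tS.
Qed.

End SquareDuality.

(** * A product over the boxes of a rectangle *)

Section BoxInduction.
Implicit Types (lam mu nu : intpart).

Lemma eq_from_lt (a b : nat) : (forall i, (i < a)%N = (i < b)%N) -> a = b.
Proof.
by move=> H; apply/eqP; rewrite eqn_leq leqNgt H ltnn leqNgt -H ltnn.
Qed.

(** Recorded for rows and for columns, as both kinds of coordinates change. *)
Definition addbox i j lam lam' :=
  [/\ nth 0%N lam i = j, nth 0%N (conjp lam) j = i,
      forall k, nth 0%N lam' k = (nth 0%N lam k + (k == i))%N &
      forall k, nth 0%N (conjp lam') k = (nth 0%N (conjp lam) k + (k == j))%N].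

(** The box removed is the one at the end of the last row. *)
Lemma box_ind (Pr : intpart -> Prop) :
  Pr nilp ->
  (forall i j lam lam', addbox i j lam lam' -> Pr lam -> Pr lam') ->
  forall lam, Pr lam.
Proof.
move=> P0 PS lam; elim: {lam}_.+1 {-2}lam (ltnSn (sumn lam)) => // N IH lam leN.
have [s0|] := posnP (size lam).
  by have -> : lam = nilp by apply: intpart_eq => i; rewrite !nth_default ?s0.
set n := size lam => n0; pose i0 := n.-1; pose j0 := (nth 0%N lam i0).-1.
have i0n : (i0 < n)%N by rewrite prednK.
have l0 : nth 0%N lam i0 = j0.+1 by rewrite prednK // nth_gt0.
pose a i := (nth 0%N lam i - (i == i0))%N.
have lz k : (i0 < k)%N -> nth 0%N lam k = 0%N.
  by move=> lt; rewrite nth_default // -/n -(prednK n0).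
have dec i j : (i <= j)%N -> (a j <= a i)%N.
  rewrite /a leq_eqVlt => /orP[/eqP -> //|lt].
  have [ii0|/eqP nii0] := i =P i0.
    by rewrite lz // -ii0.
  by rewrite subn0 (leq_trans (leq_subr _ _)) // intpart_nth // ltnW.
pose mu := shape (fun i : 'I_n => a i).
have nmu k : nth 0%N mu k = a k.
  rewrite (nth_shape_dec n k dec); case: ltnP => // le.
  by rewrite /a nth_default // sub0n.
have szmu : (size mu <= n)%N by apply: size_shape.
have szl : (size lam <= n)%N by [].
have Elam k : nth 0%N lam k = (nth 0%N mu k + (k == i0))%N.
  rewrite nmu /a; have [->|_] := k =P i0; last by rewrite subn0 addn0.
  by rewrite l0 subn1 addn1.
apply: (PS i0 j0 mu); last first.
  apply: IH; rewrite -ltnS; apply: leq_trans leN; rewrite ltnS.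
  rewrite -(psum_over szmu) -(psum_over szl) /psum.
  rewrite (bigD1 (Ordinal i0n)) // [X in (_ < X)%N](bigD1 (Ordinal i0n)) //=.
  rewrite -addSn leq_add //; first by rewrite [leqRHS]Elam eqxx addn1.
  by apply: leq_sum => i _; rewrite [leqRHS]Elam leq_addr.
split=> //.
- by rewrite nmu /a eqxx l0 subn1.
- apply: eq_from_lt => i; rewrite conj_lt nmu /a.
  have [lt|gt|->] := ltngtP i i0.
  + by rewrite subn0 -l0 intpart_nth // ltnW.
  + by rewrite lz // sub0n.
  by rewrite l0 subn1 /= ltnn.
move=> k; rewrite (nth_conj_sum k szl) (nth_conj_sum k szmu).
rewrite (bigD1 (Ordinal i0n)) // [in RHS](bigD1 (Ordinal i0n)) //=.
rewrite [X in (_ + X)%N](eq_bigr (fun i : 'I_n => (k < nth 0%N mu i)%N : nat)); last first.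
  move=> i ne; rewrite Elam -(inj_eq val_inj) /= in ne *.
  by rewrite (negPf ne) addn0.
rewrite addnAC; congr (_ + _)%N; rewrite l0 nmu /a eqxx l0 subn1 /= ltnS.
by case: ltngtP.
Qed.

End BoxInduction.

Section Identity.
Variables (K : fieldType) (q t S : K).
Hypothesis gen : generic q t S.
Implicit Types (lam mu : intpart).

Let q0 : q != 0. Proof. by case: gen. Qed.
Let t0 : t != 0. Proof. by case: gen. Qed.

(** The grid coordinates of the ends of the rows, and in [col_pt] of the columns, of
    lam. *)
Definition row_pt lam i : K := q ^ (nth 0%N lam i)%:Z * t ^ (- i%:Z).
Definition col_pt lam j : K := q ^ j%:Z * t ^ (- (nth 0%N (conjp lam) j)%:Z).

Lemma qt_neq (a b a' b' : int) : (a != a') || (b != b') -> q ^ a * t ^ b != q ^ a' * t ^ b'.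
Proof.
move=> D; have := @generic_neq _ q t S a b 0 a' b' 0 gen; rewrite !expr0z !mulr1; apply.
by move: D => /orP[] ->; rewrite ?orbT.
Qed.

Lemma row_pt_neq0 lam i : row_pt lam i != 0. Proof. by rewrite mulf_neq0 ?expfz_neq0. Qed.
Lemma col_pt_neq0 lam j : col_pt lam j != 0. Proof. by rewrite mulf_neq0 ?expfz_neq0. Qed.

Lemma row_sub_tcol_neq0 lam i j : row_pt lam i - t * col_pt lam j != 0.
Proof.
rewrite subr_eq0 /row_pt /col_pt mulrCA -{2}[t]expr1z -expfzDr //; apply: qt_neq.
rewrite -negb_and; apply/negP => /andP[/eqP[E1] /eqP E2].
have E3 : nth 0%N (conjp lam) j = i.+1 by lia.
by have := conj_lt lam i j; rewrite E3 E1 ltnSn ltnn.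
Qed.

Lemma row_sub_qcol_neq0 lam i j : row_pt lam i - q * col_pt lam j != 0.
Proof.
rewrite subr_eq0 /row_pt /col_pt mulrA -{2}[q]expr1z -expfzDr //; apply: qt_neq.
rewrite -negb_and; apply/negP => /andP[/eqP E1 /eqP E2].
have E3 : nth 0%N (conjp lam) j = i by lia.
have E4 : nth 0%N lam i = j.+1 by lia.
by have := conj_lt lam i j; rewrite E3 E4 ltnSn ltnn.
Qed.

Lemma addbox_row_pt i j lam lam' k : addbox i j lam lam' ->
  row_pt lam' k = if k == i then q * row_pt lam k else row_pt lam k.
Proof.
case=> _ _ H _; rewrite /row_pt H; case: eqP => _; last by rewrite addn0.
by rewrite addn1 exprSz mulrA.
Qed.

Lemma addbox_col_pt i j lam lam' k : addbox i j lam lam' ->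
  col_pt lam' k = if k == j then t^-1 * col_pt lam k else col_pt lam k.
Proof.
case=> _ _ _ H; rewrite /col_pt H; case: eqP => _; last by rewrite addn0.
rewrite mulrCA; congr (_ * _); rewrite -exprN1 -expfzDr //; congr (_ ^ _); lia.
Qed.

Lemma addbox_w i j lam lam' : addbox i j lam lam' ->
  row_pt lam i = q ^ j%:Z * t ^ (- i%:Z) /\ col_pt lam j = q ^ j%:Z * t ^ (- i%:Z).
Proof. by case=> h1 h2 _ _; rewrite /row_pt /col_pt h1 h2. Qed.

Variables (m n : nat).

Lemma addbox_bounds i j lam lam' : addbox i j lam lam' -> inbox m n lam' ->
  [/\ (i < n)%N, (j < m)%N & inbox m n lam].
Proof.
case=> h1 h2 h3 h4 /andP[sz sz'].
have lti : (i < n)%N.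
  by apply: leq_trans sz; rewrite -nth_gt0 h3 eqxx addn1.
have ltj : (j < m)%N.
  by apply: leq_trans sz'; rewrite -nth_gt0 h4 eqxx addn1.
split=> //; apply/andP; split.
  rewrite size_leP -leqn0; move: sz; rewrite size_leP h3 addn_eq0 => /andP[/eqP -> _].
  by [].
rewrite size_leP -leqn0; move: sz'; rewrite size_leP h4 addn_eq0 => /andP[/eqP -> _].
by [].
Qed.

Definition linX (a : K) : {poly K} := 'X - a%:P.

(** Along the boundary of lam each horizontal step contributes to the products over
    columns and each vertical step to those over rows, and the quotient telescopes.
    Adding a box at a corner w changes the factors at w, q w, w/t and q w/t only. *)
Lemma contour_identity lam : inbox m n lam ->
  (\prod_(j < m) linX (q * col_pt lam j)) * (\prod_(i < n) linX (row_pt lam i)) * linX (t ^ (- n%:Z)) =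
  linX (q ^ m%:Z) * (\prod_(i < n) linX (t^-1 * row_pt lam i)) * (\prod_(j < m) linX (col_pt lam j)).
Proof.
move: lam; apply: box_ind => [_|i j lam lam' ab IH bx].
  have EZ j : col_pt nilp j = q ^ j%:Z.
    rewrite /col_pt nth_conj /= expr0z mulr1 //.
  have EX i : row_pt nilp i = t ^ (- i%:Z) by rewrite /row_pt nth_nilp expr0z mul1r.
  have E1 : (\prod_(j < m) linX (q * col_pt nilp j)) = \prod_(j < m) linX (q ^ j.+1%:Z).
    by apply: eq_bigr => j _; rewrite EZ exprSz.
  have E2 : (\prod_(j < m) linX (col_pt nilp j)) = \prod_(j < m) linX (q ^ j%:Z).
    by apply: eq_bigr => j _; rewrite EZ.
  have E3 : (\prod_(i < n) linX (row_pt nilp i)) = \prod_(i < n) linX (t ^ (- i%:Z)).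
    by apply: eq_bigr => j _; rewrite EX.
  have E4 : (\prod_(i < n) linX (t^-1 * row_pt nilp i)) = \prod_(i < n) linX (t ^ (- i.+1%:Z)).
    apply: eq_bigr => i _; rewrite EX -exprN1 -expfzDr //; congr (linX (_ ^ _)); lia.
  have A (F : nat -> {poly K}) k : \prod_(i < k) F i.+1 * F 0%N = \prod_(i < k) F i * F k.
    by rewrite mulrC -(big_ord_recl k (fun i : 'I_k.+1 => F i)) big_ord_recr.
  have A1 := A (fun j => linX (q ^ j%:Z)) m.
  have A2 := A (fun j => linX (t ^ (- j%:Z))) n.
  rewrite E1 E2 E3 E4.
  rewrite -mulrA -A2 mulrA [_ * \prod_(i < n) _]mulrC -mulrA.
  have -> : t ^ (- 0%N%:Z) = q ^ 0%N%:Z by [].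
  by rewrite -mulrA A1 mulrA mulrC.
have [lti ltj bl] := addbox_bounds ab bx.
have := IH bl; have [] := addbox_w ab; set w := q ^ j%:Z * _ => EX EZ.
rewrite (bigD1 (Ordinal ltj)) //= (bigD1 (Ordinal lti)) //=.
rewrite [in RHS](bigD1 (Ordinal lti)) //= [in RHS](bigD1 (Ordinal ltj)) //= EX EZ.
set A := \prod_(k < m | _) _; set B := \prod_(k < n | _) _.
set C := \prod_(k < n | _) _; set D := \prod_(k < m | _) _ => H.
rewrite (bigD1 (Ordinal ltj)) //= (bigD1 (Ordinal lti)) //=.
rewrite [in RHS](bigD1 (Ordinal lti)) //= [in RHS](bigD1 (Ordinal ltj)) //=.
rewrite !(addbox_row_pt _ ab) !(addbox_col_pt _ ab) !eqxx EX EZ.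
have -> : \prod_(k < m | k != Ordinal ltj) linX (q * col_pt lam' k) = A.
  apply: eq_bigr => k ne; rewrite (addbox_col_pt _ ab) -(inj_eq val_inj) /= in ne *.
  by rewrite (negPf ne).
have -> : \prod_(k < n | k != Ordinal lti) linX (row_pt lam' k) = B.
  apply: eq_bigr => k ne; rewrite (addbox_row_pt _ ab) -(inj_eq val_inj) /= in ne *.
  by rewrite (negPf ne).
have -> : \prod_(k < n | k != Ordinal lti) linX (t^-1 * row_pt lam' k) = C.
  apply: eq_bigr => k ne; rewrite (addbox_row_pt _ ab) -(inj_eq val_inj) /= in ne *.
  by rewrite (negPf ne).
have -> : \prod_(k < m | k != Ordinal ltj) linX (col_pt lam' k) = D.
  apply: eq_bigr => k ne; rewrite (addbox_col_pt _ ab) -(inj_eq val_inj) /= in ne *.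
  by rewrite (negPf ne).
have lw : linX w != 0 by rewrite /linX polyXsubC_eq0.
apply: (mulfI lw).
have -> : linX (q * (t^-1 * w)) = linX (t^-1 * (q * w)) by rewrite mulrCA.
move: (linX w) (linX (q * w)) (linX (t^-1 * w)) (linX (t^-1 * (q * w))) (linX (q ^ m%:Z))
  (linX (t ^ (- n%:Z))) A B C D H {lw} => c1 c2 c3 c4 lm lT A B C D H.
transitivity (c2 * A * (c1 * B) * lT * c4); first by ring.
by rewrite H; ring.
Qed.

Lemma horner_lin (a u : K) : (linX a).[u] = u - a.
Proof. exact: hornerXsubC. Qed.

Lemma horner_prod_lin k (p : pred 'I_k) (F : 'I_k -> K) (u : K) :
  (\prod_(i < k | p i) linX (F i)).[u] = \prod_(i < k | p i) (u - F i).
Proof. by rewrite horner_prod; apply: eq_bigr => i _; rewrite horner_lin. Qed.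

Lemma contour_eval lam (u : K) : inbox m n lam ->
  (\prod_(j < m) (u - q * col_pt lam j)) * (\prod_(i < n) (u - row_pt lam i)) * (u - t ^ (- n%:Z)) =
  (u - q ^ m%:Z) * (\prod_(i < n) (u - t^-1 * row_pt lam i)) * (\prod_(j < m) (u - col_pt lam j)).
Proof.
move=> /contour_identity /(congr1 (horner^~ u)); by rewrite !hornerM !horner_prod_lin !horner_lin.
Qed.

(** Both sides of [contour_identity] vanish at w; the common linear factor is
    divided out before evaluation. *)
Lemma contour_corner i j lam lam' : addbox i j lam lam' -> inbox m n lam' ->
  let w := q ^ j%:Z * t ^ (- i%:Z) in
  (w - q * w) * (\prod_(k < m | k != j :> nat) (w - q * col_pt lam k)) *
  (\prod_(k < n | k != i :> nat) (w - row_pt lam k)) * (w - t ^ (- n%:Z)) =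
  (w - q ^ m%:Z) * (w - t^-1 * w) * (\prod_(k < n | k != i :> nat) (w - t^-1 * row_pt lam k)) *
  (\prod_(k < m | k != j :> nat) (w - col_pt lam k)).
Proof.
move=> ab bx w; have [lti ltj bl] := addbox_bounds ab bx.
have [EX EZ] := addbox_w ab; rewrite -/w in EX EZ.
have H := contour_identity bl.
move: H; rewrite (bigD1 (Ordinal ltj)) //= (bigD1 (Ordinal lti)) //=.
rewrite [in RHS](bigD1 (Ordinal lti)) //= [in RHS](bigD1 (Ordinal ltj)) //= EX EZ.
set A := \prod_(k < m | _) _; set B := \prod_(k < n | _) _.
set C := \prod_(k < n | _) _; set D := \prod_(k < m | _) _ => H.
have lw : linX w != 0 by rewrite /linX polyXsubC_eq0.
have H2 : linX (q * w) * A * B * linX (t ^ (- n%:Z)) =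
   linX (q ^ m%:Z) * linX (t^-1 * w) * C * D.
  apply: (mulfI lw).
  move: (linX w) (linX (q * w)) (linX (t^-1 * w)) (linX (q ^ m%:Z)) (linX (t ^ (- n%:Z)))
    A B C D H {lw} => c1 c2 c3 lm lT A B C D H.
  transitivity (c2 * A * (c1 * B) * lT); first by ring.
  by rewrite H; ring.
have := congr1 (horner^~ w) H2; by rewrite !hornerM !horner_prod_lin !horner_lin.
Qed.

Definition ratio_box lam i j : K := (row_pt lam i - q * col_pt lam j) / (row_pt lam i - t * col_pt lam j).
Definition ratio_prod lam : K := \prod_(i < n) \prod_(j < m) ratio_box lam i j.

(** The effect on [ratio_prod] of adding the box (i, j), whatever the partition. *)
Definition box_factor i j : K :=
  let w := q ^ j%:Z * t ^ (- i%:Z) in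
  ((w - t ^ (- n%:Z)) * (q / t * w - q ^ m%:Z)) / ((w - q ^ m%:Z) * (q / t * w - t ^ (- n%:Z))).

Lemma prod_cross (f : nat -> nat -> K) i j : (i < n)%N -> (j < m)%N ->
  \prod_(a < n) \prod_(b < m) f a b =
  f i j * (\prod_(b < m | b != j :> nat) f i b) * (\prod_(a < n | a != i :> nat) f a j) *
  \prod_(a < n | a != i :> nat) \prod_(b < m | b != j :> nat) f a b.
Proof.
move=> lti ltj; rewrite (bigD1 (Ordinal lti)) //= (bigD1 (Ordinal ltj)) //= -!mulrA.
congr (_ * (_ * _)); rewrite -big_split; apply: eq_bigr => a _ /=.
by rewrite (bigD1 (Ordinal ltj)).
Qed.

Lemma prod_const_neq0 k (p : pred 'I_k) (c : K) : c != 0 -> \prod_(i < k | p i) c != 0.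
Proof. by move=> c0; apply/prodf_neq0. Qed.

(** The hypotheses on the products are the boundary identity at the corner w, with
    its zero removed, and at q w / t; they eliminate F and C2. *)
Lemma corner_algebra (w tn qm A B B2 C C2 D E F k1 k2 sg ta : K) :
  q - 1 != 0 -> t - 1 != 0 -> q - t != 0 -> w != 0 ->
  w - qm != 0 -> q / t * w - tn != 0 ->
  B != 0 -> B2 != 0 -> D != 0 -> E != 0 -> k1 != 0 -> k2 != 0 -> sg != 0 -> ta != 0 ->
  (w - q * w) * A * D * (w - tn) = (w - qm) * (w - t^-1 * w) * E * F ->
  (q / t * w - q * w) * (k1 / k2 * B) * ((q / t * w - w) * (sg * C2)) * (q / t * w - tn) =
  (q / t * w - qm) * ((q / t * w - t^-1 * w) * (sg / ta * C)) * ((q / t * w - w) * (k2^-1 * B2)) ->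
  (q * w - q / t * w) / (q * w - w) * (k1 * F / B2) * (C2 / (sg * D)) =
  (w - q * w) / (w - t * w) * (A / B) * (C / (sg * ta * E)) *
  ((w - tn) * (q / t * w - qm) / ((w - qm) * (q / t * w - tn))).
Proof.
move=> q1 t1 qt w0 h1 h2 B0 B20 D0 E0 k10 k20 sg0 ta0 H1 H2.
have EF : F = (w - q * w) * A * D * (w - tn) / ((w - qm) * (w - t^-1 * w) * E).
  rewrite H1 mulrAC divff ?mul1r // !mulf_neq0 //.
  by rewrite (_ : w - t^-1 * w = (t - 1) * w / t) ?mulf_neq0 ?invr_eq0 //; field.
have u1 : q / t * w - q * w != 0.
  rewrite (_ : _ - _ = - (t - 1) * q * w / t); last by field.
  by rewrite !mulf_neq0 ?oppr_eq0 ?invr_eq0.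
have u2 : q / t * w - w != 0.
  rewrite (_ : _ - _ = (q - t) * w / t); last by field.
  by rewrite !mulf_neq0 ?invr_eq0.
have EC : C2 = (q / t * w - qm) * ((q / t * w - t^-1 * w) * (C / ta)) * B2 /
    ((q / t * w - q * w) * (k1 * B) * (q / t * w - tn)).
  have Z : (q / t * w - q * w) * (k1 / k2 * B) * ((q / t * w - w) * sg) * (q / t * w - tn) != 0.
    by rewrite !mulf_neq0 ?invr_eq0.
  apply: (mulfI Z).
  transitivity ((q / t * w - q * w) * (k1 / k2 * B) * ((q / t * w - w) * (sg * C2)) * (q / t * w - tn)).
    by move: (q / t * w) (k1 / k2) => u k; ring.
  rewrite H2; move: (q / t * w) u1 u2 h2 {Z H2} => u u1 u2 h2.
  by field; rewrite ?k20 ?k10 ?B0 ?ta0 ?t0 ?h2 ?u1.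
rewrite EF EC; move: h2 u1 u2 {EF EC H1 H2} => h2 u1 u2.
have h2' : q * w - tn * t != 0.
  rewrite (_ : _ - _ = t * (q / t * w - tn)); last by field.
  by rewrite mulf_neq0.
field.
rewrite ?q1 ?t1 ?qt ?w0 ?h1 ?h2' ?B0 ?B20 ?D0 ?E0 ?k10 ?k20 ?sg0 ?ta0 ?t0 ?q0 /=.
have -> : q * w + - tn * t != 0 by rewrite mulNr.
have -> : w - t * w != 0.
  by rewrite (_ : _ - _ = - (t - 1) * w) ?mulf_neq0 ?oppr_eq0 //; ring.
have -> : q * w + - (q * w) * t != 0.
  by rewrite (_ : _ + _ = - (t - 1) * (q * w)) ?mulf_neq0 ?oppr_eq0 //; ring.
have -> : w * t - w != 0.
  by rewrite (_ : _ - _ = (t - 1) * w) ?mulf_neq0 //; ring.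
by rewrite (_ : _ - _ = (q - 1) * w) ?mulf_neq0 //; ring.
Qed.

(** Only the factors in row i and column j change, and their products are known from
    [contour_corner] and from [contour_eval] at q w / t. *)
Lemma ratio_prod_addbox i j lam lam' : addbox i j lam lam' -> inbox m n lam' ->
  ratio_prod lam' = ratio_prod lam * box_factor i j.
Proof.
move=> ab bx; have [lti ltj bl] := addbox_bounds ab bx.
have Hc := contour_corner ab bx.
have He := @contour_eval lam (q / t * (q ^ j%:Z * t ^ (- i%:Z))) bl.
have [EX EZ] := addbox_w ab.
have EX' : row_pt lam' i = q * row_pt lam i by rewrite (addbox_row_pt _ ab) eqxx.
have EZ' : col_pt lam' j = t^-1 * col_pt lam j by rewrite (addbox_col_pt _ ab) eqxx.
have NX (k : 'I_n) : (k != i :> nat) -> row_pt lam' k = row_pt lam k.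
  by move=> ne; rewrite (addbox_row_pt _ ab) (negPf ne).
have NZ (k : 'I_m) : (k != j :> nat) -> col_pt lam' k = col_pt lam k.
  by move=> ne; rewrite (addbox_col_pt _ ab) (negPf ne).
have dX := row_sub_tcol_neq0 lam; have dX' := row_sub_tcol_neq0 lam'.
rewrite /ratio_prod !(prod_cross (ratio_box _) lti ltj) /box_factor.
have -> : \prod_(a < n | a != i :> nat) \prod_(b < m | b != j :> nat) ratio_box lam' a b =
   \prod_(a < n | a != i :> nat) \prod_(b < m | b != j :> nat) ratio_box lam a b.
  by apply: eq_bigr => a na; apply: eq_bigr => b nb; rewrite /ratio_box NX // NZ.
rewrite [RHS]mulrAC; congr (_ * _); rewrite /ratio_box.
have wm : q ^ j%:Z * t ^ (- i%:Z) - q ^ m%:Z != 0.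
  rewrite subr_eq0; have := @qt_neq j (- i%:Z) m 0; rewrite expr0z mulr1; apply.
  by rewrite eqz_nat neq_ltn ltj.
have un : q / t * (q ^ j%:Z * t ^ (- i%:Z)) - t ^ (- n%:Z) != 0.
  rewrite subr_eq0; have := @qt_neq j.+1 (- i.+1%:Z) 0 (- n%:Z); rewrite expr0z mul1r => /(_ isT).
  apply: contraNneq => <-; apply/eqP; rewrite -!invr_expz !exprSz; field.
  by rewrite t0 -exprnP expf_neq0.
have w0 : q ^ j%:Z * t ^ (- i%:Z) != 0 by rewrite mulf_neq0 ?expfz_neq0.
have q1 : q - 1 != 0.
  by rewrite subr_eq0; have := @qt_neq 1 0 0 0 isT; rewrite !expr0z !mulr1 expr1z.
have t1 : t - 1 != 0.
  by rewrite subr_eq0; have := @qt_neq 0 1 0 0 isT; rewrite !expr0z !mul1r expr1z.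
have qt : q - t != 0.
  by rewrite subr_eq0; have := @qt_neq 1 0 0 1 isT; rewrite !expr0z mul1r mulr1 !expr1z.
set w := q ^ j%:Z * t ^ (- i%:Z) in Hc He EX EZ wm un w0 *.
pose A := \prod_(b < m | b != j :> nat) (w - q * col_pt lam b).
pose B := \prod_(b < m | b != j :> nat) (w - t * col_pt lam b).
pose B2 := \prod_(b < m | b != j :> nat) (q * w - t * col_pt lam b).
pose F := \prod_(b < m | b != j :> nat) (w - col_pt lam b).
pose C := \prod_(a < n | a != i :> nat) (row_pt lam a - q * w).
pose C2 := \prod_(a < n | a != i :> nat) (row_pt lam a - q / t * w).
pose D := \prod_(a < n | a != i :> nat) (w - row_pt lam a).
pose E := \prod_(a < n | a != i :> nat) (w - t^-1 * row_pt lam a).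
pose k1 := \prod_(b < m | b != j :> nat) q.
pose k2 := \prod_(b < m | b != j :> nat) t.
pose sg := \prod_(a < n | a != i :> nat) (-1 : K).
pose ta := \prod_(a < n | a != i :> nat) t.
have B0 : B != 0 by apply/prodf_neq0 => b _; rewrite -EX.
have B20 : B2 != 0 by apply/prodf_neq0 => b nb; rewrite -EX -EX' -NZ.
have D0 : D != 0.
  apply/prodf_neq0 => a na; rewrite -oppr_eq0 opprB -NX //.
  by have := dX' a j; rewrite EZ' EZ mulrA divff // mul1r.
have E0 : E != 0.
  apply/prodf_neq0 => a na; rewrite (_ : _ - _ = - t^-1 * (row_pt lam a - t * col_pt lam j)).
    by rewrite mulf_neq0 ?oppr_eq0 ?invr_eq0.
  by rewrite EZ; field.
have k10 : k1 != 0 by apply: prod_const_neq0.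
have k20 : k2 != 0 by apply: prod_const_neq0.
have sg0 : sg != 0 by apply: prod_const_neq0; rewrite oppr_eq0 oner_eq0.
have ta0 : ta != 0 by apply: prod_const_neq0.
rewrite (_ : \prod_(b < m | b != j :> nat) ((row_pt lam' i - q * col_pt lam' b) / (row_pt lam' i - t * col_pt lam' b)) =
   k1 * F / B2); last first.
  rewrite prodf_div; congr (_ / _).
    rewrite /k1 /F -big_split; apply: eq_bigr => b nb.
    by rewrite NZ // EX' EX /= mulrBr.
  by apply: eq_bigr => b nb; rewrite NZ // EX' EX.
rewrite (_ : \prod_(a < n | a != i :> nat) ((row_pt lam' a - q * col_pt lam' j) / (row_pt lam' a - t * col_pt lam' j)) =
   C2 / (sg * D)); last first.
  rewrite prodf_div; congr (_ / _).
    by apply: eq_bigr => a na; rewrite NX // EZ' EZ mulrA.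
  rewrite /sg /D -big_split; apply: eq_bigr => a na.
  by rewrite NX // EZ' EZ /= mulrA divff // mul1r mulN1r opprB.
rewrite (_ : \prod_(b < m | b != j :> nat) ((row_pt lam i - q * col_pt lam b) / (row_pt lam i - t * col_pt lam b)) =
   A / B); last first.
  by rewrite prodf_div EX.
rewrite (_ : \prod_(a < n | a != i :> nat) ((row_pt lam a - q * col_pt lam j) / (row_pt lam a - t * col_pt lam j)) =
   C / (sg * ta * E)); last first.
  rewrite prodf_div EZ; congr (_ / _).
  rewrite /sg /ta /E -!big_split; apply: eq_bigr => a na /=.
  by field.
rewrite EX' EZ' EX EZ.
have := @corner_algebra w (t ^ (- n%:Z)) (q ^ m%:Z) A B B2 C C2 D E F k1 k2 sg ta
  q1 t1 qt w0 wm un B0 B20 D0 E0 k10 k20 sg0 ta0 Hc.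
(* The identity at q w / t is brought to the form of the second hypothesis. *)
have -> : q * (t^-1 * w) = q / t * w by rewrite mulrA.
have -> : t * (t^-1 * w) = w by rewrite mulrA divff // mul1r.
apply.
move: He; rewrite (bigD1 (Ordinal ltj)) //= [X in _ * X * _ = _](bigD1 (Ordinal lti)) //=.
rewrite [X in _ = _ * X * _](bigD1 (Ordinal lti)) //= [X in _ = _ * X](bigD1 (Ordinal ltj)) //= EX EZ.
rewrite (_ : \prod_(k < m | k != Ordinal ltj) (q / t * w - q * col_pt lam k) = k1 / k2 * B); last first.
  rewrite /k1 /k2 /B -prodf_div -big_split; apply: eq_bigr => b nb /=.
  by field.
rewrite (_ : \prod_(k < n | k != Ordinal lti) (q / t * w - row_pt lam k) = sg * C2); last first.
  rewrite /sg /C2 -big_split; apply: eq_bigr => b nb /=.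
  by rewrite mulN1r opprB.
rewrite (_ : \prod_(k < n | k != Ordinal lti) (q / t * w - t^-1 * row_pt lam k) = sg / ta * C); last first.
  rewrite /sg /ta /C -prodf_div -big_split; apply: eq_bigr => b nb /=.
  by field.
rewrite (_ : \prod_(k < m | k != Ordinal ltj) (q / t * w - col_pt lam k) = k2^-1 * B2) //.
rewrite /k2 /B2 -prodfV -big_split; apply: eq_bigr => b nb /=.
by field.
Qed.

Theorem ratio_prod_boxes lam : inbox m n lam ->
  ratio_prod lam = ratio_prod nilp * \prod_(i < n) \prod_(j < nth 0%N lam i) box_factor i j.
Proof.
move: lam; apply: box_ind => [_|i j lam lam' ab IH bx].
  by rewrite big1 ?mulr1 // => i _; rewrite nth_nilp big_ord0.
have [lti ltj bl] := addbox_bounds ab bx.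
rewrite (ratio_prod_addbox ab bx) (IH bl) -mulrA; congr (_ * _).
rewrite (bigD1 (Ordinal lti)) //= [in RHS](bigD1 (Ordinal lti)) //=.
have [h1 h2 h3 h4] := ab.
rewrite h3 eqxx h1 addn1 big_ord_recr /= mulrAC; congr (_ * _).
apply: eq_bigr => k ne; rewrite h3 -(inj_eq val_inj) /= in ne *.
by rewrite (negPf ne) addn0.
Qed.

End Identity.

(** * Complements in a rectangle *)

Local Arguments compl : simpl never.

Section Complement.
Implicit Types (lam mu : intpart) (m n : nat).

Lemma nth_compl m n lam i :
  nth 0%N (compl m n lam) i = (if i < n then m - nth 0 lam (n - i.+1) else 0)%N.
Proof.
pose a i := (m - nth 0 lam (n - i.+1))%N.
have srt : sorted geq (mkseq a n).
  rewrite /mkseq; apply: (homo_sorted (e := ltn)); last exact: iota_ltn_sorted.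
  move=> j k /= lt; apply: leq_sub2l; apply: intpart_nth; lia.
have -> : compl m n lam = mkpart (mkseq a n).
  by apply: val_inj; rewrite [RHS](mkpart_sorted srt).
rewrite nth_mkpart //; case: ltnP => h; first by rewrite nth_mkseq.
by rewrite nth_default ?size_mkseq.
Qed.

Lemma compl_conj m n lam : inbox m n lam -> conjp (compl m n lam) = compl n m (conjp lam).
Proof.
move=> /andP[szn szm]; apply: intpart_eq => j; apply: eq_from_lt => i.
rewrite conj_lt !nth_compl.
case: (ltnP i n) => hi; case: (ltnP j m) => hj; rewrite ?ltn0 //.
- have := conj_lt lam (n - i.+1) (m - j.+1).
  set a := nth 0%N lam _; set b := nth 0%N (conjp lam) _ => E.
  apply/idP/idP => h.
    have : ~~ (m - j.+1 < a)%N by lia.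
    rewrite -E; lia.
  have : ~~ (n - i.+1 < b)%N by lia.
  rewrite E; lia.
- by apply/negbTE; rewrite -leqNgt (leq_trans (leq_subr _ _)).
by apply/esym/negbTE; rewrite -leqNgt (leq_trans (leq_subr _ _)).
Qed.

Lemma size_compl m n lam : (size (compl m n lam) <= n)%N.
Proof. by rewrite size_leP nth_compl ltnn. Qed.

Lemma inbox_compl m n lam : inbox m n lam -> inbox m n (compl m n lam).
Proof. by move=> bx; rewrite /inbox size_compl compl_conj // size_compl. Qed.

Lemma compl_addcol m n lam : inbox m n lam -> compl m.+1 n lam = addcol n (compl m n lam).
Proof.
move=> /andP[_ sz]; apply: intpart_eq => i; rewrite nth_addcol !nth_compl.
case: ltnP => // h; rewrite subSn //.
by rewrite (leq_trans _ sz) // size_conj intpart_nth.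
Qed.

Lemma inbox_S m n lam : inbox m n lam -> inbox m.+1 n lam.
Proof. by case/andP => h1 h2; rewrite /inbox h1 leqW. Qed.

Lemma big_ord_compl (K : comNzRingType) (a b : nat) (F : nat -> K) : (a <= b)%N ->
  \prod_(j < b - a) F (b - j.+1)%N = \prod_(j < b | (a <= j)%N) F j.
Proof.
move=> ab; rewrite [RHS](reindex_inj rev_ord_inj) /=.
rewrite (big_ord_widen b (fun j => F (b - j.+1)%N) (leq_subr _ _)).
apply: eq_bigl => j; have := ltn_ord j; lia.
Qed.

End Complement.

Section Diagonals.
Variables (K : fieldType).
Hypothesis char0 : forall k, (k%:R == 0 :> K) = (k == 0%N).
Implicit Types (q t S : K) (lam mu : intpart) (m n : nat).

(** The parameter of the complements in the normalization of [Pval]. *)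
Definition compS m n q t S : K := t ^ (n%:Z - 1) * (q ^- m / S).

Lemma generic_comp m n q t S : generic q t S -> generic q t (compS m n q t S).
Proof.
move=> /generic_inv /(generic_shift (- m%:Z) (n%:Z - 1)).
by rewrite /compS -invr_expz -exprnP mulrCA mulrA.
Qed.

Lemma interp_comp m n q t S lam mu : t != 0 ->
  interp_at n q t (q ^- m / S) lam mu = Pval n q t (compS m n q t S) lam mu.
Proof.
move=> t0; rewrite /Pval /compS mulrA -expfzDr //.
by rewrite (_ : 1 - n%:Z + (n%:Z - 1) = 0) ?expr0z ?mul1r //; lia.
Qed.

Lemma inbox_le m n lam i : inbox m n lam -> (nth 0 lam i <= m)%N.
Proof. by case/andP => _ sz; rewrite (leq_trans _ sz) // size_conj intpart_nth. Qed.

Lemma Pval_diag_box m n q t S lam : generic q t S -> inbox m n lam ->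
  Pval n q t S lam lam = \prod_(i < n) \prod_(j < m | (j < nth 0%N lam i)%N)
    ydiff (row_pt q t lam i * S) (t * col_pt q t lam j * S).
Proof.
move=> gen bx; case: (gen) => q0 t0 S0 _; case/andP: (bx) => sz _.
rewrite (Pval_diag char0 gen sz); apply: eq_bigr => i _.
rewrite (big_ord_widen m (fun j => ydiff (q ^ (nth 0%N lam i)%:Z * t ^ (- i%:Z) * S)
  (q ^ j%:Z * t ^ (1 - (nth 0%N (conjp lam) j)%:Z) * S)) (inbox_le i bx)).
apply: eq_bigr => j _; congr (ydiff _ (_ * _)).
by rewrite /col_pt expfzDr // expr1z mulrCA.
Qed.

Lemma ydiffV (a b : K) : ydiff a^-1 b^-1 = ydiff a b.
Proof. by rewrite /ydiff !invrK [a^-1 + _]addrC [b^-1 + _]addrC. Qed.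

Lemma compS_inv m n q t S (a b a' b' : int) : q != 0 -> t != 0 ->
  a - m%:Z = - a' -> b + (n%:Z - 1) = - b' ->
  q ^ a * t ^ b * compS m n q t S = (q ^ a' * t ^ b' * S)^-1.
Proof.
move=> q0 t0 Ea Eb; rewrite !invfM !invr_expz -Ea -Eb (expfzDr a) // (expfzDr b) // /compS exprnP invr_expz.
by move: (q ^ a) (q ^ (- m%:Z)) (t ^ b) (t ^ (n%:Z - 1)) => x y z u; ring.
Qed.

(** Complementation reverses the rows and columns and inverts the coordinates of
    their ends, and [ydiff] does not see the inversion. *)
Lemma Pval_diag_compl m n q t S lam : generic q t S -> inbox m n lam ->
  Pval n q t (compS m n q t S) (compl m n lam) (compl m n lam) =
  \prod_(i < n) \prod_(j < m | (nth 0%N lam i <= j)%N)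
    ydiff (row_pt q t lam i * S) (q * col_pt q t lam j * S).
Proof.
move=> gen bx; case: (gen) => q0 t0 S0 _.
rewrite (Pval_diag char0 (generic_comp m n gen) (size_compl m n lam)).
rewrite [RHS](reindex_inj rev_ord_inj); apply: eq_bigr => i _ /=.
rewrite -(big_ord_compl (fun j => ydiff (row_pt q t lam (n - i.+1) * S) (q * col_pt q t lam j * S)));
  last exact: inbox_le bx.
rewrite nth_compl ltn_ord; apply: eq_bigr => j _.
have hj : (j < m)%N by apply: leq_trans (ltn_ord j) (leq_subr _ _).
have le1 : (nth 0%N lam (n - i.+1) <= m)%N by apply: inbox_le bx.
have le2 : (nth 0%N (conjp lam) (m - j.+1) <= n)%N.
  by apply: (@inbox_le n m); rewrite -inbox_conj.
rewrite -[RHS]ydiffV; congr ydiff.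
  rewrite /row_pt; apply: compS_inv => //; first by rewrite -subzn //; ring.
  by have := ltn_ord i; lia.
have -> : nth 0%N (conj_seq (compl_seq m n lam)) j = nth 0%N (compl n m (conjp lam)) j.
  by rewrite -compl_conj.
rewrite nth_compl hj /col_pt [q * (_ * _)]mulrA -exprSz.
apply: compS_inv => //; first by lia.
by rewrite -subzn //; ring.
Qed.

End Diagonals.

(** * Comparison with the dual, box by box *)

Section Norm.
Variables (K : fieldType) (q t : K).
Hypotheses (q0 : q != 0) (t0 : t != 0).
Implicit Types (lam mu : intpart) (m n : nat).

Definition box_pt i j : K := q ^ j%:Z * t ^ (- i%:Z).

Definition norm_box n lam i j : K :=
  ((1 - box_pt i j * t ^ n%:Z) * (1 - row_pt q t lam i / (t * col_pt q t lam j))) /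
  ((1 - box_pt i j * (q * t ^ (n%:Z - 1))) * (1 - row_pt q t lam i / (q * col_pt q t lam j))).

Lemma prod_rows n lam (F : nat -> nat -> K) : (size lam <= n)%N ->
  \prod_(i < size lam) \prod_(j < nth 0%N lam i) F i j =
  \prod_(i < n) \prod_(j < nth 0%N lam i) F i j.
Proof.
move=> sz; rewrite (big_ord_widen n (fun i => \prod_(j < nth 0%N lam i) F i j) sz).
rewrite big_mkcond; apply: eq_bigr => i _ /=; case: ltnP => // h.
by rewrite nth_default // big_ord0.
Qed.

Lemma normP_box n lam : (size lam <= n)%N ->
  normP n lam q t = \prod_(i < n) \prod_(j < nth 0%N lam i) norm_box n lam i j.
Proof.
move=> sz; rewrite /normP /C0 /Cminus.
rewrite (prod_rows (fun i j => 1 - q ^+ j * t ^- i * t ^+ n) sz).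
rewrite (prod_rows (fun i j => 1 - q ^+ j * t ^- i * (q * t ^ (n%:Z - 1))) sz).
rewrite (prod_rows (fun i j => 1 - q ^+ (nth 0%N lam i - j.+1) *
   t ^+ (nth 0%N (conjp lam) j - i.+1) * q) sz).
rewrite (prod_rows (fun i j => 1 - q ^+ (nth 0%N lam i - j.+1) *
   t ^+ (nth 0%N (conjp lam) j - i.+1) * t) sz).
rewrite -!big_split -prodf_div; apply: eq_bigr => i _ /=.
rewrite -!big_split -prodf_div; apply: eq_bigr => j _ /=.
have lj := ltn_ord j; have li : (i < nth 0%N (conjp lam) j)%N by rewrite conj_lt.
have -> : q ^+ (nth 0%N lam i - j.+1) * t ^+ (nth 0%N (conjp lam) j - i.+1) * q =
    row_pt q t lam i / (t * col_pt q t lam j).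
  rewrite /row_pt /col_pt !exprnP -!subzn // !intS !opprD !expfzDr // !invfM -!invr_expz ?expr1z !invrK.
  by field; rewrite ?q0 ?t0 ?expfz_neq0.
have -> : q ^+ (nth 0%N lam i - j.+1) * t ^+ (nth 0%N (conjp lam) j - i.+1) * t =
    row_pt q t lam i / (q * col_pt q t lam j).
  rewrite /row_pt /col_pt !exprnP -!subzn // !intS !opprD !expfzDr // !invfM -!invr_expz ?expr1z !invrK.
  by field; rewrite ?q0 ?t0 ?expfz_neq0.
by rewrite /norm_box /box_pt exprnP -invr_expz.
Qed.

Lemma row_pt_conj lam j : row_pt t q (conjp lam) j = (col_pt q t lam j)^-1.
Proof. by rewrite /row_pt /col_pt invfM !invr_expz opprK mulrC. Qed.

Lemma col_pt_conj lam i : col_pt t q (conjp lam) i = (row_pt q t lam i)^-1.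
Proof. by rewrite /row_pt /col_pt conjK invfM !invr_expz opprK mulrC. Qed.

End Norm.

Section BoxAlgebra.
Variables (K : fieldType) (q t R S : K).
Hypotheses (q0 : q != 0) (t0 : t != 0) (R0 : R != 0) (S0 : S != 0) (R2 : R ^+ 2 = q * t).

(** Since a b = R^2, the factors 1 - 1/(y y') in the two values [ydiff y y'] agree
    up to a monomial, and the linear factors remain. *)
Lemma ydiff_dual (x z a b : K) : x != 0 -> z != 0 -> a != 0 -> b != 0 -> a * b = q * t ->
  x - a * z != 0 ->
  ydiff (x * S) (b * z * S) =
  - (R / b) * ((x - b * z) / (x - a * z)) * ydiff (z^-1 * dualS S R) (a * x^-1 * dualS S R).
Proof.
move=> x0 z0 a0 b0 ab d0.
have -> : dualS S R = (R * S)^-1 by rewrite /dualS div1r.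
rewrite !ydiffE ?mulf_neq0 ?invr_eq0 ?mulf_neq0 //.
have -> : 1 - (z^-1 / (R * S))^-1 / (a / x / (R * S)) = 1 - b * x * z * S ^+ 2.
  have -> : b = R ^+ 2 / a by rewrite R2 -ab; field.
  by field; rewrite ?a0 ?x0 ?z0 ?R0 ?S0 ?oner_neq0.
field; rewrite ?a0 ?b0 ?x0 ?z0 ?R0 ?S0 ?d0 ?oner_neq0 //=.
Qed.

(** Conjugation exchanges 1 - x/(t z) and 1 - x/(q z), which occur as a quotient; this
    accounts for the square. *)
Lemma norm_ratio (w tn qm x z : K) : w != 0 -> tn != 0 -> qm != 0 -> x != 0 -> z != 0 ->
  1 - w * tn != 0 -> 1 - w * (q * tn / t) != 0 -> 1 - w^-1 * qm != 0 ->
  1 - w^-1 * (t * qm / q) != 0 ->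
  x - q * z != 0 -> x - t * z != 0 ->
  let nb := ((1 - w * tn) * (1 - x / (t * z))) / ((1 - w * (q * tn / t)) * (1 - x / (q * z))) in
  let nb' := ((1 - w^-1 * qm) * (1 - z^-1 / (q * x^-1))) /
     ((1 - w^-1 * (t * qm / q)) * (1 - z^-1 / (t * x^-1))) in
  let ph := (x - q * z) / (x - t * z) in
  let rb := ((w - tn^-1) * (q / t * w - qm)) / ((w - qm) * (q / t * w - tn^-1)) in
  nb * ph ^+ 2 = nb' * rb * (q / t).
Proof.
move=> w0 tn0 qm0 x0 z0 h1 h2 h3 h4 d1 d2 nb nb' ph rb.
have c1 : 1 - w * (q * tn / t) = (t - w * q * tn) / t by field.
have c3 : 1 - w^-1 * qm = (w - qm) / w by field.
have c4 : 1 - w^-1 * (t * qm / q) = (q * w - t * qm) / (q * w) by field; rewrite w0 q0.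
have c5 : 1 - x / (t * z) = (t * z - x) / (t * z) by field; rewrite z0 t0.
have c6 : 1 - x / (q * z) = (q * z - x) / (q * z) by field; rewrite z0 q0.
have n2 : t - w * q * tn != 0 by move: h2; rewrite c1; apply: contraNneq => ->; rewrite mul0r.
have n3 : w - qm != 0 by move: h3; rewrite c3; apply: contraNneq => ->; rewrite mul0r.
have n4 : q * w - t * qm != 0 by move: h4; rewrite c4; apply: contraNneq => ->; rewrite mul0r.
have m1 : q * z - x != 0 by rewrite -opprB oppr_eq0.
have m2 : t * z - x != 0 by rewrite -opprB oppr_eq0.
rewrite /nb /nb' /ph /rb.
have c7 : 1 - z^-1 / (q * x^-1) = (q * z - x) / (q * z) by field; rewrite z0 q0 x0.
have c8 : 1 - z^-1 / (t * x^-1) = (t * z - x) / (t * z) by field; rewrite z0 t0 x0.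
rewrite c1 c3 c4 c5 c6 c7 c8.
have c9 : w - tn^-1 = - (1 - w * tn) / tn by field.
have c10 : q / t * w - tn^-1 = - (t - w * q * tn) / (t * tn) by field; rewrite t0 tn0.
have c11 : q / t * w - qm = (q * w - t * qm) / t by field.
have -> : x - q * z = - (q * z - x) by rewrite opprB.
have -> : x - t * z = - (t * z - x) by rewrite opprB.
rewrite c9 c10 c11; move: (q * z - x) (t * z - x) (1 - w * tn) (t - w * q * tn) (w - qm)
  (q * w - t * qm) h1 n2 n3 n4 m1 m2 {h2 h3 h4 d1 d2 nb nb' ph rb c1 c3 c4 c5 c6 c7 c8 c9 c10 c11}.
move=> A B C D E F C0 D0 E0 F0 A0 B0.
by field; rewrite ?oppr_eq0 ?A0 ?B0 ?C0 ?D0 ?E0 ?F0 ?w0 ?tn0 ?qm0 ?x0 ?z0 ?q0 ?t0 ?oner_neq0.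
Qed.

End BoxAlgebra.

Section CurlyDuality.
Variables (K : fieldType).
Hypothesis char0 : forall k, (k%:R == 0 :> K) = (k == 0%N).
Implicit Types (q t S R : K) (lam mu : intpart) (m n : nat).

(** The part of the curly symbol that depends on one partition only. *)
Definition diag_ratio m n q t S lam : K :=
  Pval n q t S lam lam * Pval n q t (compS m n q t S) (compl m n lam) (compl m n lam) / normP n lam q t.

Definition ratio_term n q t S lam i j : K :=
  if (j < nth 0%N lam i)%N
  then ydiff (row_pt q t lam i * S) (t * col_pt q t lam j * S) / norm_box q t n lam i j
  else ydiff (row_pt q t lam i * S) (q * col_pt q t lam j * S).

Lemma diag_ratio_box m n q t S lam : generic q t S -> inbox m n lam ->
  diag_ratio m n q t S lam = \prod_(i < n) \prod_(j < m) ratio_term n q t S lam i j.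
Proof.
move=> gen bx; case: (gen) => q0 t0 S0 _; have /andP[szn szm] := bx.
rewrite /diag_ratio (Pval_diag_box char0 gen bx) (Pval_diag_compl char0 gen bx) normP_box // -big_split -prodf_div.
apply: eq_bigr => i _ /=; rewrite [RHS](bigID (fun j : 'I_m => (j < nth 0 lam i)%N)) /=.
rewrite (big_ord_widen m (norm_box q t n lam i) (inbox_le i bx)) mulrAC -prodf_div.
congr (_ * _); first by apply: eq_bigr => j lt; rewrite /ratio_term lt.
apply: eq_big => j; first by rewrite -leqNgt.
by move=> le; rewrite /ratio_term ltnNge le.
Qed.

Lemma sub1_neq0 q t S (a b : int) : generic q t S -> (a != 0) || (b != 0) ->
  1 - q ^ a * t ^ b != 0.
Proof.
move=> gen D; rewrite subr_eq0 eq_sym.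
by have := qt_neq gen (a := a) (b := b) (a' := 0) (b' := 0) D; rewrite !expr0z mulr1.
Qed.

Lemma box_factor_neq0 m n q t S i j : generic q t S -> (i < n)%N -> (j < m)%N ->
  box_factor q t m n i j != 0.
Proof.
move=> gen lti ltj; case: (gen) => q0 t0 _ _.
have E0 : q / t * (q ^ j%:Z * t ^ (- i%:Z)) = q ^ j.+1%:Z * t ^ (- i.+1%:Z).
  by rewrite -!invr_expz !exprSz invfM mulrACA.
have H (a b a' b' : int) := @qt_neq _ q t S gen a b a' b'.
rewrite /box_factor E0 !mulf_neq0 ?invr_eq0 ?mulf_neq0 // subr_eq0.
- by have := H j (- i%:Z) 0 (- n%:Z); rewrite expr0z mul1r; apply; lia.
- by have := H j.+1 (- i.+1%:Z) m 0; rewrite expr0z mulr1; apply; lia.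
- by have := H j (- i%:Z) m 0; rewrite expr0z mulr1; apply; lia.
by have := H j.+1 (- i.+1%:Z) 0 (- n%:Z); rewrite expr0z mul1r; apply; lia.
Qed.

(** The ratio for a box outside lam involves only the value of the polynomial, and for
    a box inside also the norm; [norm_ratio] makes the two agree up to the box factor. *)
Lemma ratio_term_dual m n q t S R lam i j : generic q t S -> R ^+ 2 = q * t ->
  (i < n)%N -> (j < m)%N ->
  ratio_term n q t S lam i j * (if (j < nth 0%N lam i)%N then box_factor q t m n i j else 1) =
  - (R / q) * ratio_box q t lam i j * ratio_term m t q (dualS S R) (conjp lam) j i.
Proof.
move=> gen R2 lti ltj; case: (gen) => q0 t0 S0 _.
have R0 := R_neq0 gen R2.
have x0 := row_pt_neq0 gen lam i; have z0 := col_pt_neq0 gen lam j.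
have d1 := row_sub_qcol_neq0 gen lam i j; have d2 := row_sub_tcol_neq0 gen lam i j.
have ph0 : ratio_box q t lam i j != 0 by rewrite mulf_neq0 ?invr_eq0.
rewrite /ratio_term conj_lt row_pt_conj col_pt_conj; case: ifP => _; last first.
  by rewrite mulr1 (ydiff_dual R0 S0 R2 x0 z0 t0 q0) // mulrC.
rewrite (ydiff_dual R0 S0 R2 x0 z0 q0 t0) //.
set D := ydiff _ _.
have w0 : box_pt q t i j != 0 by rewrite mulf_neq0 ?expfz_neq0.
have wV : box_pt t q j i = (box_pt q t i j)^-1 by rewrite /box_pt invfM !invr_expz opprK mulrC.
have NB : norm_box q t n lam i j * ratio_box q t lam i j ^+ 2 =
   norm_box t q m (conjp lam) j i * box_factor q t m n i j * (q / t).
  rewrite /norm_box wV row_pt_conj col_pt_conj /ratio_box /box_factor -/(box_pt q t i j) -[t ^ (- n%:Z)]invr_expz.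
  have E1 (a b : K) (k : nat) : a != 0 -> b * a ^ (k%:Z - 1) = b * a ^ k%:Z / a.
    by move=> a0; rewrite expfzDr // -exprN1 mulrA.
  rewrite !E1 //; apply: (norm_ratio q0 t0 w0) => //; rewrite ?expfz_neq0 //.
  - rewrite /box_pt -mulrA -expfzDr //; apply: (sub1_neq0 gen); lia.
  - rewrite -E1 // mulrCA mulrA /box_pt mulrA -exprSz -mulrA -expfzDr //; apply: (sub1_neq0 gen); lia.
  - rewrite -wV /box_pt -mulrA -expfzDr // mulrC; apply: (sub1_neq0 gen); lia.
  rewrite -E1 // mulrCA mulrA -wV /box_pt mulrA -exprSz -mulrA -expfzDr // mulrC; apply: (sub1_neq0 gen); lia.
have r0 := box_factor_neq0 gen lti ltj.
move: NB ph0 r0; rewrite /ratio_box.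
set A := _ - q * _; set B := _ - t * _; set N := norm_box _ _ _ _ _ _; set N' := norm_box _ _ _ _ _ _.
move: (box_factor _ _ _ _ _ _) => r NB ph0 r0.
have EN : N = N' * r * (q / t) / (A / B) ^+ 2 by rewrite -NB mulfK ?expf_neq0.
have [N0|N0] := eqVneq N' 0; first by rewrite EN N0 !mul0r invr0 !mulr0 mul0r.
rewrite EN; field; rewrite ?q0 ?t0 ?N0 ?r0 /=.
by rewrite d1 d2.
Qed.

(** The box factors of the boxes of lam compensate the variation of [ratio_prod], by
    [ratio_prod_boxes]. *)
Lemma diag_ratio_dual m n q t S R : generic q t S -> R ^+ 2 = q * t ->
  exists2 c : K, c != 0 & forall lam, inbox m n lam ->
    diag_ratio m n q t S lam = c * diag_ratio n m t q (dualS S R) (conjp lam).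
Proof.
move=> gen R2; have gend := generic_dual gen R2; case: (gen) => q0 t0 _ _.
have R0 := R_neq0 gen R2.
exists ((\prod_(i < n) \prod_(j < m) (- (R / q))) * ratio_prod q t m n nilp).
  rewrite mulf_neq0 //; apply/prodf_neq0 => i _; apply/prodf_neq0 => j _.
    by rewrite oppr_eq0 mulf_neq0 ?invr_eq0.
  by rewrite mulf_neq0 ?invr_eq0 ?(row_sub_qcol_neq0 gen) ?(row_sub_tcol_neq0 gen).
move=> lam bx; rewrite (diag_ratio_box gen bx) (diag_ratio_box gend) -?inbox_conj //.
pose r := \prod_(i < n) \prod_(j < nth 0%N lam i) box_factor q t m n i j.
have r0 : r != 0.
  apply/prodf_neq0 => i _; apply/prodf_neq0 => j _; apply: (box_factor_neq0 gen) => //.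
  by apply: leq_trans (ltn_ord j) (inbox_le i bx).
have Er : r = \prod_(i < n) \prod_(j < m) (if (j < nth 0%N lam i)%N then box_factor q t m n i j else 1).
  apply: eq_bigr => i _; rewrite (big_ord_widen m (box_factor q t m n i) (inbox_le i bx)).
  by rewrite big_mkcond.
apply: (mulIf r0); rewrite {1}Er.
rewrite mulrAC -[_ * r]mulrA -(ratio_prod_boxes gen bx) /ratio_prod [X in _ = _ * X]exchange_big -!big_split /=.
apply: eq_bigr => i _; rewrite -!big_split; apply: eq_bigr => j _ /=.
exact: (ratio_term_dual lam gen R2 (ltn_ord i) (ltn_ord j)).
Qed.

End CurlyDuality.

(** * Duality of the curly symbol *)

Section Curly.
Variables (K : fieldType).
Hypothesis char0 : forall k, (k%:R == 0 :> K) = (k == 0%N).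
Implicit Types (q t S R : K) (lam mu : intpart) (m n : nat).

Lemma Pval_diag_neq0 n q t S lam : generic q t S -> (size lam <= n)%N -> Pval n q t S lam lam != 0.
Proof. by move=> gen sz; rewrite Pval_P Pstar_diag_neq0 //; apply: generic_tS. Qed.

(** The last factor is a square symbol for the complements. *)
Lemma curly_diag_ratio m n q t S lam mu : generic q t S ->
  binom_curly m n lam mu q t S = diag_ratio m n q t S lam / diag_ratio m n q t S mu *
    (Pval n q t (compS m n q t S) (compl m n lam) (compl m n mu) /
     Pval n q t (compS m n q t S) (compl m n lam) (compl m n lam)).
Proof.
move=> gen; case: (gen) => q0 t0 S0 _.
rewrite /binom_curly /diag_ratio !interp_comp // -!/(Pval _ _ _ _ _ _).
move: (normP n lam q t) (normP n mu q t) => a b; rewrite !invfM invrK.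
have := Pval_diag_neq0 (generic_comp m n gen) (size_compl m n lam).
set d := Pval n q t _ _ _ => d0; set e := Pval n q t S mu mu; set e' := Pval n q t _ (compl m n mu) (compl m n mu).
move: e^-1 e'^-1 a^-1 => x y z.
by field.
Qed.

Lemma dualS_comp m n q t S R : generic q t S -> R ^+ 2 = q * t ->
  dualS (compS m n q t S) R = compS n m t q (dualS S R).
Proof.
move=> gen R2; case: (gen) => q0 t0 S0 _; have R0 := R_neq0 gen R2.
have -> : dualS (compS m n q t S) R = R^-1 * (t ^ (n%:Z - 1))^-1 * q ^+ m * S.
  by rewrite /dualS /compS div1r !invfM !invrK !mulrA.
have -> : compS n m t q (dualS S R) = q ^ (m%:Z - 1) * (t ^+ n)^-1 * R * S.
  by rewrite /dualS /compS div1r invrK !mulrA.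
have E (a : K) (k : nat) : a != 0 -> a ^ (k%:Z - 1) = a ^+ k / a.
  by move=> a0; rewrite expfzDr // -exprN1.
rewrite !E //.
have -> : R^-1 = R / (q * t) by rewrite -R2; field.
by field; rewrite q0 t0 expf_neq0.
Qed.

Theorem binom_curly_dual m n q t S R lam mu : generic q t S -> R ^+ 2 = q * t ->
  inbox m n lam -> inbox m n mu ->
  binom_curly m n lam mu q t S = binom_curly n m (conjp lam) (conjp mu) t q (dualS S R).
Proof.
move=> gen R2 bl bm; have gend := generic_dual gen R2.
have [c c0 Ec] := diag_ratio_dual char0 m n gen R2.
rewrite (curly_diag_ratio m n lam mu gen) (curly_diag_ratio n m (conjp lam) (conjp mu) gend) !Ec // -mulf_div divff // mul1r.
congr (_ * _); rewrite -!compl_conj // -dualS_comp //.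
by apply: (Pval_dual char0 (generic_comp m n gen) R2); apply: inbox_compl.
Qed.

(** All complements gain a full column, and the product in [Pval_addcol] depends only
    on the point of evaluation, which is the same in numerator and denominator. *)
Lemma binom_curlyS m n q t S lam mu : generic q t S -> inbox m n lam -> inbox m n mu ->
  binom_curly m.+1 n lam mu q t S = binom_curly m n lam mu q t S.
Proof.
move=> gen bl bm; case: (gen) => q0 t0 S0 _.
have gc := generic_comp m.+1 n gen.
rewrite /binom_curly !interp_comp // !compl_addcol // !(Pval_addcol char0 _ gc (size_compl _ _ _)) //.
have -> : q * compS m.+1 n q t S = compS m n q t S.
  by rewrite /compS exprS; field; rewrite q0 S0 expf_neq0.
set p := \prod_(i < n) _.
have p0 : p != 0.
  apply/prodf_neq0 => i _.
  have := @ydiff_generic _ q t _ (nth 0%N (compl m n mu) i).+1 (- i%:Z) 0 (1 - n%:Z) gc isT.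
  by rewrite expr0z mul1r.
by rewrite ![_ * (_ * p)]mulrA -mulf_div divff // mulr1.
Qed.

(** Rows of the rectangle are columns for the dual symbol. *)
Lemma binom_curly_widen m n M N q t S R lam mu : generic q t S -> R ^+ 2 = q * t ->
  inbox m n lam -> inbox m n mu -> (m <= M)%N -> (n <= N)%N ->
  binom_curly m n lam mu q t S = binom_curly M N lam mu q t S.
Proof.
have wd q' t' S' m' n' l u k : generic q' t' S' -> inbox m' n' l -> inbox m' n' u ->
   [/\ inbox (m' + k) n' l, inbox (m' + k) n' u &
     binom_curly (m' + k) n' l u q' t' S' = binom_curly m' n' l u q' t' S'].
  move=> gen bl bu; elim: k => [|k [h1 h2 h3]]; first by rewrite addn0.
  by rewrite addnS; split; rewrite ?binom_curlyS ?inbox_S.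
move=> gen R2 bl bm /subnKC <- /subnKC <-.
have [bl2 bm2 <-] := wd _ _ _ _ _ _ _ (M - m)%N gen bl bm.
have gend := generic_dual gen R2; have bl3 := bl2; have bm3 := bm2.
rewrite inbox_conj in bl3; rewrite inbox_conj in bm3; have [bl4 bm4 E] := wd _ _ _ _ _ _ _ (N - n)%N gend bl3 bm3.
by rewrite (binom_curly_dual gen R2) // -E -binom_curly_dual // inbox_conj.
Qed.

End Curly.

Section Generators.

Lemma frac_indep (F : fieldType) (x : F) (c : int) :
  FracField.tofrac x%:P * FracField.tofrac 'X ^ c = 1 :> {fraction {poly F}} -> c = 0 /\ x = 1.
Proof.
have X0 : FracField.tofrac ('X : {poly F}) != 0 by rewrite tofrac_eq0 polyX_eq0.
case: c => [n|n].
  rewrite -exprnP -rmorphXn -rmorphM -tofrac1.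
  move=> /eqP; rewrite tofrac_eq => /eqP E.
  have := congr1 (fun p : {poly F} => p.[0]) E.
  rewrite !hornerE. case: n E => [|n] E; last by rewrite expr0n mulr0 => /eqP; rewrite eq_sym oner_eq0.
  by rewrite expr0 mulr1 => ->.
rewrite NegzE -invr_expz => /(canRL (mulfVK (expfz_neq0 _ X0))).
rewrite mul1r -exprnP -rmorphXn => /eqP; rewrite tofrac_eq => /eqP E.
have := congr1 (fun p : {poly F} => size p) E; rewrite size_polyXn.
by have := size_polyC_leq1 x => + E2; rewrite E2.
Qed.

Definition frac_const (F : fieldType) : {rmorphism F -> {fraction {poly F}}} :=
  (@FracField.tofrac {poly F} \o polyC)%FUN.

Lemma frac_char0 (F : fieldType) : (forall k, (k%:R == 0 :> F) = (k == 0%N)) ->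
  forall k, (k%:R == 0 :> {fraction {poly F}}) = (k == 0%N).
Proof. by move=> H k; rewrite -(rmorph_nat (frac_const F)) fmorph_eq0. Qed.

Lemma Qqts_char0 k : (k%:R == 0 :> Qqts) = (k == 0%N).
Proof. do 3!apply: frac_char0; by move=> {}k; rewrite pnatr_eq0. Qed.

(** Relations are unwound from the top of the tower. *)
Lemma generic_tower (A B C : fieldType) (j : {rmorphism A -> B}) (k : {rmorphism B -> C})
    (x : A) (y : B) (z : C) : x != 0 -> y != 0 -> z != 0 ->
  (forall a : int, x ^ a = 1 -> a = 0) ->
  (forall u (b : int), j u * y ^ b = 1 -> b = 0 /\ u = 1) ->
  (forall u (c : int), k u * z ^ c = 1 -> c = 0 /\ u = 1) ->
  generic (k (j x)) (k y) z.
Proof.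
move=> x0 y0 z0 Hx Hy Hz; split; rewrite ?fmorph_eq0 // => a b c.
rewrite -!fmorphXz -rmorphM => /Hz[-> ].
by move=> /Hy[-> /Hx ->].
Qed.

Lemma tofrac_X_neq0 (F : fieldType) : FracField.tofrac ('X : {poly F}) != 0.
Proof. by rewrite tofrac_eq0 polyX_eq0. Qed.

Lemma generic_gens : generic gen_q gen_t gen_s.
Proof.
apply: (@generic_tower _ _ _ (frac_const _) (frac_const _)
  (FracField.tofrac 'X) (FracField.tofrac 'X) (FracField.tofrac 'X));
  try exact: tofrac_X_neq0; last 2 first.
- by move=> u b; apply: frac_indep.
- by move=> u b; apply: frac_indep.
move=> a E; have := @frac_indep rat 1 a; rewrite polyC1 tofrac1 mul1r => H.
by have [] := H E.
Qed.

End Generators.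

(** * Symbols in a common rectangle *)

Section SquareBinomial.
Variables (K : fieldType).
Hypothesis char0 : forall k, (k%:R == 0 :> K) = (k == 0%N).

Lemma binom_sq_dual m n (q t S R : K) (lam mu : intpart) : generic q t S -> R ^+ 2 = q * t ->
  inbox m n lam -> inbox m n mu ->
  binom_sq n lam mu q t S = binom_sq m (conjp lam) (conjp mu) t q (dualS S R).
Proof. by move=> gen R2 bl bm; apply: (Pval_dual char0 gen R2 bl bm). Qed.

Lemma binom_sq_widen n N (q t S : K) (lam mu : intpart) : generic q t S ->
  (size lam <= n)%N -> (size mu <= n)%N -> (n <= N)%N ->
  binom_sq n lam mu q t S = binom_sq N lam mu q t S.
Proof.
move=> gen szl szm le; have [szl' szm'] : (size lam <= N)%N /\ (size mu <= N)%N.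
  by split; apply: leq_trans le.
rewrite /binom_sq -!/(Pval _ _ _ _ _ _).
by rewrite (Pval_stable char0 gen szm szl szm' szl') (Pval_stable char0 gen szm szm szm' szm').
Qed.

Lemma inbox_widen m n M N (lam : intpart) : (m <= M)%N -> (n <= N)%N ->
  inbox m n lam -> inbox M N lam.
Proof.
move=> leM leN /andP[h1 h2].
by rewrite /inbox (leq_trans h1 leN) (leq_trans h2 leM).
Qed.

End SquareBinomial.

(* [K] is any extension of Q(q,t)(s) with a square root [r] of qt; the
   rectangles containing the partitions are arbitrary on each side. *)
Theorem corollary4p3 (K : fieldType) (iota : {rmorphism Qqts -> K}) (r : K)
    (hr : r ^+ 2 = iota (gen_q * gen_t)) (lam mu : intpart)
    (m n m' n' : nat)
    (hlam : incl lam (rect m n)) (hmu : incl mu (rect m n))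
    (hlam' : incl (conjp lam) (rect m' n'))
    (hmu' : incl (conjp mu) (rect m' n')) :
  let q := iota gen_q in
  let t := iota gen_t in
  let s := iota gen_s in
  binom_sq n lam mu q t s
    = binom_sq n' (conjp lam) (conjp mu) t q (1 / (r * s))
  /\ binom_curly m n lam mu q t s
    = binom_curly m' n' (conjp lam) (conjp mu) t q (1 / (r * s)).
Proof.
move=> q t s.
have char0 : forall k, (k%:R == 0 :> K) = (k == 0%N) := char0_ext iota Qqts_char0.
have gen : generic q t s := generic_ext iota generic_gens.
have R2 : r ^+ 2 = q * t by rewrite hr rmorphM.
move: q t s gen R2 {hr} => q t s gen R2.
have gend := generic_dual gen R2.
have bl := inbox_incl hlam; have bm := inbox_incl hmu.
have bl' := inbox_incl hlam'; have bm' := inbox_incl hmu'.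
(* A rectangle that contains lam and mu, and whose transpose contains the other one. *)
pose M := maxn m n'; pose N := maxn n m'.
have [leM leM'] : (m <= M)%N /\ (n' <= M)%N by rewrite leq_maxl leq_maxr.
have [leN leN'] : (n <= N)%N /\ (m' <= N)%N by rewrite leq_maxl leq_maxr.
have BL : inbox M N lam := inbox_widen leM leN bl.
have BM : inbox M N mu := inbox_widen leM leN bm.
split.
  have [/andP[szl _] /andP[szm _]] := (bl, bm).
  have [/andP[szl' _] /andP[szm' _]] := (bl', bm').
  rewrite (binom_sq_widen char0 gen szl szm leN) (binom_sq_dual char0 gen R2 BL BM).
  by rewrite -(binom_sq_widen char0 gend szl' szm' leM').
rewrite (binom_curly_widen char0 gen R2 bl bm leM leN) (binom_curly_dual char0 gen R2 BL BM).
have R2' : r ^+ 2 = t * q by rewrite R2 mulrC.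
by rewrite -(binom_curly_widen char0 gend R2' bl' bm' leN' leM').
Qed.
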